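(* Let $p=p(n)$ with $p/n\to c\in(0,\infty)$, and for each $n$ let $\mathbf Y_n=(y_{ij})$ be the $p\times n$ random matrix with $y_{ij}=\frac{1}{\sqrt{ns}}b_{ij}w_{ij}$, where: (i) $(w_{ij})$ are independent real- or complex-valued random variables with $\mathbb E w_{ij}=0$, $\mathbb E|w_{ij}|^2=\sigma_{ij}^2$ (and $\mathbb E w_{ij}^2=0$ in the complex case), and, for some $\epsilon>0$, $\mathbb E|w_{ij}|^{4+\epsilon}$ is bounded uniformly in $i,j,n$; (ii) $\sup_{n}\max_{i,j}|\sigma_{ij}(n)|\le\sigma_{\max}<\infty$; (iii) $(b_{ij})$ are i.i.d. Bernoulli random variables with $\mathbb P(b_{ij}=1)=s$, independent of $(w_{ij})$, where $s=q^2/n$ and $n^{\phi}\le q\le n^{1/2}$ for some fixed $\phi>0$. Consider, for $z\in\mathbb C\setminus\mathbb R^+$, the system of $p+n$ equations $$t_i(z)=\frac{-1}{z\left[1+\frac1n\operatorname{Tr}\big(\widetilde{\mathbf\Sigma}_i\widetilde{\mathbf T}_n(z)\big)\right]},\ 1\le i\le p,\qquad \tilde t_j(z)=\frac{-1}{z\left[1+\frac1n\operatorname{Tr}\big(\mathbf\Sigma_j\mathbf T_n(z)\big)\right]},\ 1\le j\le n,$$ where $\mathbf T_n(z)=\operatorname{diag}(t_i(z),1\le i\le p)$ and $\widetilde{\mathbf T}_n(z)=\operatorname{diag}(\tilde t_j(z),1\le j\le n)$. Then: 1. The system admits a unique solution $(t_1,\dots,t_p,\tilde t_1,\dots,\tilde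 t_n)\in\mathscr S(\mathbb R^+)^{p+n}$. In particular $m_n^0(z)=\frac1p\operatorname{Tr}\mathbf T_n(z)$ and $\underline m_n^0(z)=\frac1n\operatorname{Tr}\widetilde{\mathbf T}_n(z)$ belong to $\mathscr S(\mathbb R^+)$, i.e. there exist probability measures $\pi_n,\tilde\pi_n$ on $\mathbb R^+$ such that $$m_n^0(z)=\int_0^\infty\frac{\pi_n(\mathrm d\lambda)}{\lambda-z},\qquad \underline m_n^0(z)=\int_0^\infty\frac{\tilde\pi_n(\mathrm d\lambda)}{\lambda-z}.$$ 2. Almost surely, for all $z\in\mathbb C\setminus\mathbb R^+$, $$m_n(z)-m_n^0(z)\to0,\qquad \underline m_n(z)-\underline m_n^0(z)\to0\qquad(n\to\infty).$$
   Context: $\mathbb R^+=[0,\infty)$. $\mathscr S(\mathbb R^+)$ is the set of functions $z\mapsto\int\frac{\mathrm dv(x)}{x-z}$ on $\mathbb C\setminus\mathbb R^+$ (Stieltjes transforms) with $v$ a probability measure supported on $\mathbb R^+$. The quantities $w_{ij},b_{ij},\sigma_{ij},s,q$ may all depend on $n$. $\mathbf\Sigma_j=\operatorname{diag}(\sigma_{ij}^2,1\le i\le p)$ for $1\le j\le n$, and $\widetilde{\mathbf\Sigma}_i=\operatorname{diag}(\sigma_{ij}^2,1\le j\le n)$ for $1\le i\le p$. The functions $$m_n(z)=\frac1p\operatorname{Tr}\big(\mathbf Y_n\mathbf Y_n^*-z\mathbf I_p\big)^{-1},\qquad \underline m_n(z)=\frac1n\operatorname{Tr}\big(\mathbf Y_n^*\mathbf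 Y_n-z\mathbf I_n\big)^{-1}$$ are the Stieltjes transforms of the empirical spectral distributions of $\mathbf Y_n\mathbf Y_n^*$ and $\mathbf Y_n^*\mathbf Y_n$. *)

(* Defs.v *)
From HB Require Import structures.
From mathcomp Require Import all_boot all_order all_algebra.
From mathcomp Require Import all_classical all_reals all_analysis.
From mathcomp Require Import complex.

Set Implicit Arguments.
Unset Strict Implicit.
Unset Printing Implicit Defensive.

Import Order.TTheory GRing.Theory Num.Theory.
Import numFieldNormedType.Exports.

Local Open Scope ring_scope.
Local Open Scope classical_set_scope.
Local Open Scope sesquilinear_scope.

(* C minus [0, +oo). *)
Definition cut_plane (R : realType) : set R[i] :=
  [set z | ~ (complex.Im z = 0 /\ 0 <= complex.Re z)].

Definition nonneg_axis {R : realType} : set R := `[0, +oo[%classic.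

(* MathComp-Analysis integrates real functions only, so a complex integral is
   taken componentwise.  It is meaningful when both parts are integrable. *)
Definition cintegral (R : realType) (d : measure_display)
    (T : measurableType d) (mu : {measure set T -> \bar R})
    (D : set T) (f : T -> R[i]) : R[i] :=
  (Rintegral mu D (fun x => complex.Re (f x)) +i*
   Rintegral mu D (fun x => complex.Im (f x)))%C.

(* Only the values on [cut_plane] matter: a function on C minus [0, +oo) is
   represented by a total function, and compared on [cut_plane] only. *)
Definition in_stieltjes (R : realType) (f : R[i] -> R[i]) : Prop :=
  exists v : probability R R, v nonneg_axis = 1%E /\
    forall z, cut_plane z ->
      f z = cintegral v nonneg_axis (fun x : R => ((x%:C)%C - z)^-1).

(* Complex numbers carry no measurable structure in the library; a complex
   random variable is a measurable map into R * R through this bijection. *)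
Definition complex_pair (R : realType) (z : R[i]) : R * R :=
  (complex.Re z, complex.Im z).

Definition independent_family (R : realType) (d d' : measure_display)
    (Om : measurableType d) (P : probability Om R) (T : measurableType d')
    (I : finType) (X : I -> Om -> T) : Prop :=
  forall (J : {set I}) (A : I -> set T), (forall i, measurable (A i)) ->
    P [set o | forall i, i \in J -> A i (X i o)] =
    (\prod_(i in J) P (X i @^-1` A i))%E.

Definition family_sigma (d d' : measure_display) (Om : measurableType d)
    (T : measurableType d') (I : Type) (X : I -> Om -> T) : set (set Om) :=
  <<s [set E | exists i (A : set T), measurable A /\ E = X i @^-1` A] >>.

Definition independent_families (R : realType) (d d1 d2 : measure_display)
    (Om : measurableType d) (P : probability Om R)
    (T1 : measurableType d1) (T2 : measurableType d2)
    (I : Type) (X : I -> Om -> T1) (Y : I -> Om -> T2) : Prop :=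
  forall E F : set Om, family_sigma X E -> family_sigma Y F ->
    P (E `&` F) = (P E * P F)%E.

(* Sigma_j and tilde Sigma_i, for a p x n profile sigma. *)
Definition Sigma_col (R : realType) (p n : nat) (sigma : 'M[R]_(p, n))
    (j : 'I_n) : 'M[R[i]]_p :=
  diag_mx (\row_i ((sigma i j ^+ 2)%:C)%C).

Definition Sigma_row (R : realType) (p n : nat) (sigma : 'M[R]_(p, n))
    (i : 'I_p) : 'M[R[i]]_n :=
  diag_mx (\row_j ((sigma i j ^+ 2)%:C)%C).

Definition diag_fun (R : realType) (k : nat) (t : 'I_k -> R[i] -> R[i])
    (z : R[i]) : 'M[R[i]]_k :=
  diag_mx (\row_i t i z).

(* Division by zero returns 0 here, but it cannot occur in a solution:
   a Stieltjes transform of a probability measure on [0, +oo) never vanishes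
   on [cut_plane]. *)
Definition solves_system (R : realType) (p n : nat) (sigma : 'M[R]_(p, n))
    (t : 'I_p -> R[i] -> R[i]) (u : 'I_n -> R[i] -> R[i]) : Prop :=
  forall z, cut_plane z ->
    (forall i, t i z =
       -1 / (z * (1 + n%:R^-1 * \tr (Sigma_row sigma i *m diag_fun u z)))) /\
    (forall j, u j z =
       -1 / (z * (1 + n%:R^-1 * \tr (Sigma_col sigma j *m diag_fun t z)))).

Definition stieltjes_solution (R : realType) (p n : nat)
    (sigma : 'M[R]_(p, n))
    (t : 'I_p -> R[i] -> R[i]) (u : 'I_n -> R[i] -> R[i]) : Prop :=
  [/\ forall i, in_stieltjes (t i), forall j, in_stieltjes (u j)
    & solves_system sigma t u].

(* (1/k) Tr diag(t_1(z), ..., t_k(z)) *)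
Definition norm_trace (R : realType) (k : nat) (t : 'I_k -> R[i] -> R[i])
    (z : R[i]) : R[i] :=
  k%:R^-1 * \tr (diag_fun t z).

(* (1/k) Tr (A - z I_k)^-1 *)
Definition norm_trace_resolvent (R : realType) (k : nat) (A : 'M[R[i]]_k)
    (z : R[i]) : R[i] :=
  k%:R^-1 * \tr (invmx (A - z%:M)).

Definition sparse_matrix (R : realType) (p n : nat) (s : R)
    (b : 'I_p -> 'I_n -> bool) (w : 'I_p -> 'I_n -> R[i]) : 'M[R[i]]_(p, n) :=
  \matrix_(i, j) (((Num.sqrt (n%:R * s))^-1 * (b i j)%:R)%:C%C * w i j).

(* Main.v *)
Require Import Defs.
From HB Require Import structures.
From mathcomp Require Import all_boot all_order all_algebra.
From mathcomp Require Import all_classical all_reals all_analysis.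
From mathcomp Require Import complex measurable_realfun random_variable.
From mathcomp Require Import ring lra.

(* Everything is done at the points z = -x with x > 0 large, where all resolvent
   entries and all unknowns are positive and the system is a contraction.
   By the Schur complement, the diagonal entry G_ii of the resolvent is
   -1 / (z (1 + y_i H y_i^* )), where H is the resolvent of Y^* Y with the i-th
   row y_i removed.  The quadratic form concentrates around its conditional mean
   because the fourth moments of the entries of Y are O(1/(n q^2)), so the
   diagonal of the resolvent solves the system up to a small error, and the
   contraction compares it with the exact solution; this controls the mean of
   m_n.  The fluctuations are controlled by a martingale over the rows, with
   fourth moments O(p^-2), hence summable.  The passage from countably many
   points -x to the whole cut plane uses that a Stieltjes transform at z is
   determined, by Newton interpolation of the kernel 1/(l - z), by its values at
   such points, with an error that is uniform over all probability measures.
   Solutions of the system exist as limits of its iterates along an ultrafilter: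
   each iterate is the Stieltjes transform of a finite measure, again by the
   Schur complement, and Helly's theorem gives the limits. *)

Set Implicit Arguments.
Unset Strict Implicit.
Unset Printing Implicit Defensive.

Import Order.TTheory GRing.Theory Num.Theory.
Import numFieldNormedType.Exports.

Local Open Scope ring_scope.
Local Open Scope classical_set_scope.
Local Open Scope sesquilinear_scope.

(** Thinning multiplies every moment of an entry by the same factor s. The row errors therefore have
    second moments of order 1/n + 1/q^2, and when q is only of size n^phi this need not be summable.
    Almost sure convergence thus cannot be read off from the row errors. They are used in the mean
    only, where any rate suffices, while the fluctuations are bounded by an argument blind to the
    size of the entries: changing one row moves the normalized trace by at most 1/(p x), with no
    truncation. The comparison with the exact solution is made in l1 over the indices, because the
    row errors are small on average and not simultaneously in all rows. Stieltjes transforms are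
    never recognized by analytic properties: a function is one because it comes from the spectrum of
    an explicit Gram matrix, or as a limit of such functions. Interpolation likewise replaces normal
    families and analytic continuation. *)

(** * Algebra of Gram resolvents: Schur complement and rank-one updates *)

Section Resolvents.
Variable C : numClosedFieldType.

Lemma gram_diag (m n : nat) (A : 'M[C]_(m, n)) i :
  (A *m A^t*) i i = \sum_j `|A i j| ^+ 2.
Proof. by rewrite mxE; apply: eq_bigr => j _; rewrite !mxE normCK. Qed.

Lemma gram_diag_ge0 (m n : nat) (A : 'M[C]_(m, n)) i : 0 <= (A *m A^t*) i i.
Proof. by rewrite gram_diag; apply: sumr_ge0 => j _; rewrite exprn_ge0. Qed.

Lemma gram_row_eq0 (n : nat) (v : 'rV[C]_n) : (v *m v^t*) 0 0 = 0 -> v = 0.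
Proof.
rewrite gram_diag => /eqP; rewrite psumr_eq0 => [/allP h|j _]; last first.
  by rewrite exprn_ge0.
apply/rowP => j; rewrite mxE; have := h j (mem_index_enum _).
by rewrite expf_eq0 normr_eq0 => /eqP.
Qed.

Lemma trmxC_mul (m n k : nat) (A : 'M[C]_(m, n)) (B : 'M[C]_(n, k)) :
  (A *m B)^t* = B^t* *m A^t*.
Proof. by rewrite trmx_mul map_mxM. Qed.

(** In the partial order of [C], [0 <= z] means that z is real and nonnegative, so [~~ (0 <= z)]
    describes the cut plane. A left kernel vector v gives |v Y|^2 = z |v|^2, which forces z >= 0. *)
Lemma gram_unitmx (p n : nat) (Y : 'M[C]_(p, n)) (z : C) : ~~ (0 <= z) ->
  Y *m Y^t* - z%:M \in unitmx.
Proof.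
move=> hz; rewrite unitmxE unitfE; apply/negP => /det0P [v v0 /eqP].
rewrite mulmxBr subr_eq0 mul_mx_scalar mulmxA => /eqP e.
have := congr1 (fun u => (u *m v^t*) 0 0) e.
rewrite -(mulmxA _ _ (v^t*)) -trmxC_mul -scalemxAl [RHS]mxE => h.
have v1 : 0 < (v *m v^t*) 0 0.
  rewrite lt0r gram_diag_ge0 andbT; apply: contra v0 => /eqP /gram_row_eq0.
  by move/eqP.
move/negP: hz; apply; rewrite -(pmulr_lge0 _ v1) -h; exact: gram_diag_ge0.
Qed.

Lemma gram_unitmxC (p n : nat) (Y : 'M[C]_(p, n)) (z : C) : ~~ (0 <= z) ->
  Y^t* *m Y - z%:M \in unitmx.
Proof. by move=> hz; rewrite -{2}(trmxCK Y) gram_unitmx. Qed.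

(** Follows from the intertwining relation Y^* (Y Y^* - z) = (Y^* Y - z) Y^*. *)
Lemma resolvent_push (p n : nat) (Y : 'M[C]_(p, n)) (z : C) : ~~ (0 <= z) ->
  invmx (Y *m Y^t* - z%:M) =
  - z^-1 *: (1%:M - Y *m invmx (Y^t* *m Y - z%:M) *m Y^t*).
Proof.
move=> hz; have U := gram_unitmx Y hz; have V := gram_unitmxC Y hz.
have z0 : z != 0 by apply: contraNneq hz => ->.
set H := Y^t* *m Y - z%:M in V *.
have e : Y^t* *m (Y *m Y^t* - z%:M) = H *m Y^t*.
  by rewrite /H mulmxBr mulmxBl mulmxA mul_mx_scalar mul_scalar_mx.
apply: (can_inj (mulmxK U)); rewrite mulVmx // -scalemxAl mulmxBl mul1mx.
rewrite -(mulmxA _ (Y^t*)) e -(mulmxA Y) (mulmxA (invmx H)) mulVmx // mul1mx.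
by rewrite addrAC subrr add0r scaleNr -scalerN opprK scale_scalar_mx mulVf.
Qed.

Lemma resolvent_trace (p n : nat) (Y : 'M[C]_(p, n)) (z : C) : ~~ (0 <= z) ->
  \tr (invmx (Y *m Y^t* - z%:M)) =
  \tr (invmx (Y^t* *m Y - z%:M)) - z^-1 * (p%:R - n%:R).
Proof.
move=> hz; have V := gram_unitmxC Y hz.
have z0 : z != 0 by apply: contraNneq hz => ->.
rewrite resolvent_push // mxtraceZ raddfB /= mxtrace1 mxtrace_mulC.
set H := Y^t* *m Y - z%:M in V *.
rewrite mulmxA (_ : Y^t* *m Y = H + z%:M); last by rewrite subrK.
rewrite mulmxDl mulmxV // mul_scalar_mx mxtraceD mxtrace1 mxtraceZ.
by field.
Qed.

(** Zeroing the row instead of deleting it gives the same n x n Gram matrix Y^* Y and leaves the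
    index type unchanged. *)
Definition zero_row (p n : nat) (Y : 'M[C]_(p, n)) (i : 'I_p) : 'M[C]_(p, n) :=
  \matrix_(i', j) (if i' == i then 0 else Y i' j).

Definition row_form (p n : nat) (Y : 'M[C]_(p, n)) (z : C) (i : 'I_p) : C :=
  (row i Y *m invmx ((zero_row Y i)^t* *m zero_row Y i - z%:M)
     *m (row i Y)^t*) 0 0.

Lemma gram_zero_row (p n : nat) (Y : 'M[C]_(p, n)) (i : 'I_p) :
  Y^t* *m Y = (zero_row Y i)^t* *m zero_row Y i + (row i Y)^t* *m row i Y.
Proof.
apply/matrixP => j k; rewrite !mxE (bigD1 i) //= addrC; congr (_ + _).
  rewrite [RHS](bigD1 i) //= !mxE eqxx mulr0 add0r; apply: eq_bigr => l il.
  by rewrite !mxE (negPf il).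
by rewrite big_ord1 !mxE.
Qed.

(** Sherman-Morrison in a form without division, from the rank-one splitting [gram_zero_row]. *)
Lemma resolvent_row (p n : nat) (Y : 'M[C]_(p, n)) (z : C) i : ~~ (0 <= z) ->
  row i Y *m invmx ((zero_row Y i)^t* *m zero_row Y i - z%:M) =
  (1 + row_form Y z i) *: (row i Y *m invmx (Y^t* *m Y - z%:M)).
Proof.
move=> hz; have U := gram_unitmxC (zero_row Y i) hz.
have V := gram_unitmxC Y hz.
apply: (can_inj (mulmxK V)); rewrite -scalemxAl mulmxKV //.
rewrite (gram_zero_row Y i) addrAC mulmxDr mulmxKV // mulmxA.
rewrite [X in X *m row i Y]mx11_scalar mul_scalar_mx scalerDl scale1r.
by congr (_ + _ *: _).
Qed.

(** If the sum vanished, [resolvent_row] would make the row times the reduced resolvent zero, hence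
    [row_form] zero, and 1 = 0. *)
Lemma row_form_neq (p n : nat) (Y : 'M[C]_(p, n)) (z : C) i : ~~ (0 <= z) ->
  1 + row_form Y z i != 0.
Proof.
move=> hz; apply/eqP => h; have := resolvent_row Y i hz.
rewrite h scale0r => e; move: h; rewrite /row_form e mul0mx mxE addr0.
by move/eqP; rewrite oner_eq0.
Qed.

(** The Schur complement formula without block matrices: after [resolvent_push], [resolvent_row]
    evaluates the remaining form as r / (1 + r) with r = [row_form]. *)
Lemma resolvent_diag (p n : nat) (Y : 'M[C]_(p, n)) (z : C) i : ~~ (0 <= z) ->
  invmx (Y *m Y^t* - z%:M) i i = - z^-1 * (1 + row_form Y z i)^-1.
Proof.
move=> hz; have h := row_form_neq Y i hz.
have z0 : z != 0 by apply: contraNneq hz => ->.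
rewrite resolvent_push // mxE; congr (_ * _).
have -> : (1%:M - Y *m invmx (Y^t* *m Y - z%:M) *m Y^t*) i i =
  1 - (row i Y *m invmx (Y^t* *m Y - z%:M) *m (row i Y)^t*) 0 0.
  rewrite mxE mxE eqxx; congr (_ + _); rewrite mxE; congr (- _).
  rewrite -row_mul !mxE; apply: eq_bigr => k _; rewrite !mxE; congr (_ * _).
have := congr1 (fun u => (u *m (row i Y)^t*) 0 0) (resolvent_row Y i hz).
rewrite -scalemxAl [in X in _ = X]mxE -/(row_form _ _ _) => e.
set q := (X in 1 - X); move: e; rewrite -/q => e.
by apply: (mulfI h); rewrite divff // mulrBr -e; ring.
Qed.

Lemma resolvent_zero_row (p n : nat) (Y : 'M[C]_(p, n)) (z : C) i :
  ~~ (0 <= z) ->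
  invmx ((zero_row Y i)^t* *m zero_row Y i - z%:M) - invmx (Y^t* *m Y - z%:M)
  = (1 + row_form Y z i)^-1 *:
    (invmx ((zero_row Y i)^t* *m zero_row Y i - z%:M) *m (row i Y)^t* *m
    (row i Y *m invmx ((zero_row Y i)^t* *m zero_row Y i - z%:M))).
Proof.
move=> hz; have U := gram_unitmxC (zero_row Y i) hz.
have V := gram_unitmxC Y hz; have h := row_form_neq Y i hz.
rewrite resolvent_row // -scalemxAr scalerA mulVf // scale1r.
set Hi := (_ - z%:M) in U *; set H := Y^t* *m Y - _ in V *.
rewrite mulmxA -(mulmxA (invmx Hi)).
have -> : (row i Y)^t* *m row i Y = H - Hi.
  by rewrite /H /Hi (gram_zero_row Y i) opprB addrA subrK addrAC subrr add0r.
by rewrite mulmxBr mulVmx // mulmxBl mul1mx -mulmxA mulmxV // mulmx1.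
Qed.

End Resolvents.

(** * Resolvents at z = -x: positivity, norm and trace bounds *)

Section PositiveResolvents.
Variables (C : numClosedFieldType) (p n : nat) (x : C).
Hypothesis x0 : 0 < x.
Implicit Type Y : 'M[C]_(p, n).

Lemma oppr_pos_nge0 : ~~ (0 <= - x).
Proof. by rewrite oppr_ge0 lt_geF. Qed.

Let xR : x^* = x.
Proof. by apply/CrealP; exact: gtr0_real. Qed.

Lemma resolvent_herm Y :
  (invmx (Y^t* *m Y - (- x)%:M))^t* = invmx (Y^t* *m Y - (- x)%:M).
Proof.
rewrite trmx_inv map_invmx; congr invmx.
rewrite linearB /= map_mxB /= trmxC_mul trmxCK; congr (_ - _).
by rewrite tr_scalar_mx map_scalar_mx rmorphN /= xR.
Qed.

(** Substituting v = u (Y^* Y + x) splits the form into two nonnegative terms. All the positivity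
    and size bounds of this section are read off from this splitting. *)
Lemma resolvent_form Y (v : 'rV[C]_n) (u := v *m invmx (Y^t* *m Y - (- x)%:M)) :
  (u *m v^t*) 0 0 = (u *m Y^t* *m (u *m Y^t*)^t*) 0 0 + x * (u *m u^t*) 0 0.
Proof.
have V := gram_unitmxC Y oppr_pos_nge0.
have -> : v = u *m (Y^t* *m Y - (- x)%:M) by rewrite mulmxKV.
clearbody u; have := resolvent_herm Y.
set H := _ - _ in V * => h.
have hH : H^t* = H.
  by have := congr1 invmx h; rewrite -map_invmx -trmx_inv invmxK.
rewrite trmxC_mul trmxC_mul hH trmxCK /H raddfN opprK mulmxDl mulmxDr.
rewrite mul_scalar_mx -scalemxAr !mulmxA mxE; congr (_ + _).
by rewrite mxE.
Qed.

Lemma resolvent_form_lower Y (v : 'rV[C]_n)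
    (u := v *m invmx (Y^t* *m Y - (- x)%:M)) :
  x * (u *m u^t*) 0 0 <= (u *m v^t*) 0 0.
Proof. by rewrite resolvent_form lerDr gram_diag_ge0. Qed.

Lemma resolvent_form_ge0 Y (v : 'rV[C]_n) :
  0 <= (v *m invmx (Y^t* *m Y - (- x)%:M) *m v^t*) 0 0.
Proof.
apply: le_trans (resolvent_form_lower _ _).
by rewrite mulr_ge0 ?gram_diag_ge0 // ltW.
Qed.

Lemma row_form_ge0 Y i : 0 <= row_form Y (- x) i.
Proof. exact: resolvent_form_ge0. Qed.

Let delta_form (A : 'M[C]_n) j :
  ((delta_mx 0 j : 'rV[C]_n) *m A *m (delta_mx 0 j : 'rV[C]_n)^t*) 0 0 = A j j.
Proof.
rewrite trmx_delta map_delta_mx -rowE mxE (bigD1 j) //= !mxE !eqxx mulr1.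
by rewrite big1 ?addr0 // => k /negPf kj; rewrite !mxE kj mulr0.
Qed.

Lemma resolvent_diag_ge0 Y j : 0 <= invmx (Y^t* *m Y - (- x)%:M) j j.
Proof. by rewrite -delta_form resolvent_form_ge0. Qed.

(** The lower bound of the form at a basis vector. Together with the bound 1/x on the diagonal it
    controls the rows of the resolvent in l2, which governs the variance of the quadratic forms. *)
Lemma resolvent_row_norm Y j :
  x * (\sum_k `|invmx (Y^t* *m Y - (- x)%:M) j k| ^+ 2)
    <= invmx (Y^t* *m Y - (- x)%:M) j j.
Proof.
have /= := resolvent_form_lower Y (delta_mx 0 j).
rewrite delta_form -rowE gram_diag; apply: le_trans.
rewrite le_eqVlt; apply/orP; left; apply/eqP; congr (_ * _).
by apply: eq_bigr => k _; rewrite [in RHS]mxE.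
Qed.

Lemma resolvent_diag_le Y j : invmx (Y^t* *m Y - (- x)%:M) j j <= x^-1.
Proof.
have sq_le (g : C) : 0 <= g -> x * g ^+ 2 <= g -> g <= x^-1.
  rewrite le0r => /orP[/eqP -> _|g0]; first by rewrite invr_ge0 ltW.
  rewrite expr2 mulrA -ler_pdivlMr // divff ?gt_eqF // mulrC.
  by rewrite -ler_pdivlMr // div1r.
apply: sq_le; first exact: resolvent_diag_ge0.
apply: le_trans (resolvent_row_norm Y j); rewrite ler_pM2l //.
rewrite (bigD1 j) //= (ger0_norm (resolvent_diag_ge0 Y j)) lerDl sumr_ge0 //.
Qed.

Lemma resolvent_row_norm_le Y j :
  \sum_k `|invmx (Y^t* *m Y - (- x)%:M) j k| ^+ 2 <= x^-1 ^+ 2.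
Proof.
have := le_trans (resolvent_row_norm Y j) (resolvent_diag_le Y j).
by rewrite -ler_pdivlMl // expr2.
Qed.

Let resolvent_zero_rowE Y i
    (u := row i Y *m invmx ((zero_row Y i)^t* *m zero_row Y i - (- x)%:M)) j :
  invmx ((zero_row Y i)^t* *m zero_row Y i - (- x)%:M) j j -
  invmx (Y^t* *m Y - (- x)%:M) j j =
  (1 + row_form Y (- x) i)^-1 * `|u 0 j| ^+ 2.
Proof.
have := congr1 (fun A : 'M[C]_n => A j j) (resolvent_zero_row Y i oppr_pos_nge0).
rewrite mxE [X in _ + X = _ -> _]mxE => ->.
rewrite -/u mxE; congr (_ * _).
have -> : invmx ((zero_row Y i)^t* *m zero_row Y i - (- x)%:M) *m (row i Y)^t*
  = u^t* by rewrite /u trmxC_mul resolvent_herm.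
by rewrite mxE big_ord1 !mxE normCKC.
Qed.

Lemma resolvent_zero_row_ge Y i j :
  invmx (Y^t* *m Y - (- x)%:M) j j <=
  invmx ((zero_row Y i)^t* *m zero_row Y i - (- x)%:M) j j.
Proof.
rewrite -subr_ge0 resolvent_zero_rowE mulr_ge0 ?exprn_ge0 //.
by rewrite invr_ge0 addr_ge0 // row_form_ge0.
Qed.

(** The difference of the traces is |u|^2 / (1 + r) with r the row form, and x |u|^2 <= r. Since r /
    (1 + r) <= 1, the bound is independent of the size of the row. *)
Lemma resolvent_zero_row_trace Y i :
  \tr (invmx ((zero_row Y i)^t* *m zero_row Y i - (- x)%:M)) <=
  \tr (invmx (Y^t* *m Y - (- x)%:M)) + x^-1.
Proof.
rewrite -lerBlDl /mxtrace -sumrB (eq_bigr _ (fun j _ => resolvent_zero_rowE Y i j)).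
rewrite -mulr_sumr.
set u := row i Y *m _; set q := row_form _ _ _.
have q0 : 0 <= q := row_form_ge0 Y i.
have : x * \sum_j `|u 0 j| ^+ 2 <= q.
  by rewrite -gram_diag; exact: resolvent_form_lower.
rewrite -ler_pdivlMl // => h; apply: le_trans (ler_wpM2l _ h) _.
  by rewrite invr_ge0 addr_ge0.
have q1 : 0 < 1 + q by rewrite ltr_pwDl.
rewrite mulrCA -[leRHS]mulr1 ler_pM2l ?invr_gt0 // mulrC ler_pdivrMr // mul1r.
by rewrite lerDr.
Qed.

(** Zeroing row i turns both matrices into the same one, and both traces lie within 1/x below the
    trace of its resolvent. *)
Lemma resolvent_trace_row_change Y Y' i :
  (forall i' j, i' != i -> Y i' j = Y' i' j) ->
  `|\tr (invmx (Y^t* *m Y - (- x)%:M)) - \tr (invmx (Y'^t* *m Y' - (- x)%:M))|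
    <= x^-1.
Proof.
move=> YY'; have e : zero_row Y i = zero_row Y' i.
  by apply/matrixP => i' j; rewrite !mxE; case: eqVneq => // /YY'.
have t1 (Z : 'M[C]_(p, n)) : \tr (invmx (Z^t* *m Z - (- x)%:M)) <=
    \tr (invmx ((zero_row Z i)^t* *m zero_row Z i - (- x)%:M)).
  by apply: ler_sum => j _; exact: resolvent_zero_row_ge.
have tr_real (Z : 'M[C]_(p, n)) : \tr (invmx (Z^t* *m Z - (- x)%:M)) \is Num.real.
  by apply: ger0_real; apply: sumr_ge0 => j _; exact: (resolvent_diag_ge0 Z).
rewrite real_ler_norml ?rpredB //; apply/andP; split.
  rewrite lerNl opprB lerBlDl; apply: le_trans (t1 Y') _; rewrite -e.
  exact: resolvent_zero_row_trace.
rewrite lerBlDl; apply: le_trans (t1 Y) _; rewrite e.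
exact: resolvent_zero_row_trace.
Qed.

End PositiveResolvents.

(** * Stieltjes transforms of finitely supported measures *)

Section FiniteStieltjes.
Variable R : realType.
Local Notation C := R[i].

Lemma cut_planeE (z : C) : cut_plane z <-> ~~ (0 <= z).
Proof.
rewrite /cut_plane /= lecE /= ; split=> [h|/negP h [e1 e2]].
  by apply/negP => /andP[/eqP e1 e2]; apply: h.
by apply: h; rewrite e1 eqxx.
Qed.

Lemma cut_plane_sub_neq0 (z : C) (l : R) : cut_plane z -> 0 <= l ->
  l%:C%C - z != 0.
Proof.
move=> /cut_planeE hz l0; rewrite subr_eq0; apply: contraNneq hz => <-.
by rewrite lecE /= eqxx.
Qed.

Lemma cut_plane_neq0 (z : C) : cut_plane z -> z != 0.
Proof.
by move=> /cut_plane_sub_neq0 /(_ (lexx 0)); rewrite sub0r oppr_eq0.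
Qed.

(* [fin_stieltjes m f]: on the cut plane, [f] is the Stieltjes transform of a
   finitely supported positive measure of total mass [m] on [0, +oo). *)
Definition fin_stieltjes (m : R) (f : C -> C) : Prop :=
  exists s : seq (R * R), [/\ forall e, e \in s -> 0 <= e.1 /\ 0 <= e.2,
    \sum_(e <- s) e.1 = m
  & forall z, cut_plane z -> f z = \sum_(e <- s) e.1%:C%C / (e.2%:C%C - z)].

Lemma fin_stieltjes_ext m f g : (forall z, cut_plane z -> f z = g z) ->
  fin_stieltjes m f -> fin_stieltjes m g.
Proof. by move=> fg [s [h1 h2 h3]]; exists s; split=> // z hz; rewrite -fg ?h3. Qed.

Lemma fin_stieltjes0 : fin_stieltjes 0 (fun=> 0).
Proof. by exists [::]; split=> // [|z _]; rewrite big_nil. Qed.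

Lemma fin_stieltjesD m m' f f' : fin_stieltjes m f -> fin_stieltjes m' f' ->
  fin_stieltjes (m + m') (fun z => f z + f' z).
Proof.
move=> [s [h1 h2 h3]] [s' [h1' h2' h3']]; exists (s ++ s'); split.
- by move=> e; rewrite mem_cat => /orP[/h1|/h1'].
- by rewrite big_cat h2 h2'.
- by move=> z hz; rewrite big_cat h3 // h3'.
Qed.

Lemma fin_stieltjesZ m f (a : R) : 0 <= a -> fin_stieltjes m f ->
  fin_stieltjes (a * m) (fun z => a%:C%C * f z).
Proof.
move=> a0 [s [h1 h2 h3]]; exists [seq (a * e.1, e.2) | e <- s]; split.
- by move=> _ /mapP[e /h1 [? ?] ->]; rewrite mulr_ge0.
- by rewrite big_map -mulr_sumr h2.
- move=> z hz; rewrite big_map h3 // mulr_sumr; apply: eq_bigr => e _ /=.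
  by rewrite rmorphM mulrA.
Qed.

Lemma fin_stieltjes_sum (k : nat) (m : 'I_k -> R) (f : 'I_k -> C -> C) :
  (forall i, fin_stieltjes (m i) (f i)) ->
  fin_stieltjes (\sum_i m i) (fun z => \sum_i f i z).
Proof.
elim: k m f => [|k IH] m f h.
  rewrite big_ord0; apply: fin_stieltjes_ext fin_stieltjes0 => z _.
  by rewrite big_ord0.
rewrite big_ord_recr /=.
have := fin_stieltjesD (IH _ _ (fun i => h (widen_ord (leqnSn k) i))) (h ord_max).
by apply: fin_stieltjes_ext => z _; rewrite big_ord_recr.
Qed.

(** [Q] and [l] are chosen before z: the spectral decomposition gives all resolvents of one Gram
    matrix the same weights and poles. *)
Lemma gram_spectral (p n : nat) (Y : 'M[C]_(p, n)) :
  exists (Q : 'M[C]_p) (l : 'I_p -> R), [/\ Q^t* *m Q = 1%:M,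
    forall k, 0 <= l k
  & forall z, cut_plane z -> forall i j, invmx (Y *m Y^t* - z%:M) i j =
     \sum_k (Q k i)^* * Q k j / ((l k)%:C%C - z)].
Proof.
set A := Y *m Y^t*.
have hA : A^t* = A by rewrite /A trmxC_mul trmxCK.
have /orthomx_spectralP : A \is normalmx by apply/normalmxP; rewrite hA.
set Q := spectralmx A; set d := spectral_diag A.
have Qu : Q \is unitarymx := spectral_unitarymx A.
rewrite invmx_unitary // => eA.
have QQ : Q *m Q^t* = 1%:M by exact/unitarymxP.
have QQ' : Q^t* *m Q = 1%:M by rewrite -invmx_unitary // mulVmx ?unitarymx_unit.
have dE : Q *m Y *m (Q *m Y)^t* = diag_mx d.
  rewrite trmxC_mul mulmxA -(mulmxA Q) -/A eA !mulmxA QQ mul1mx.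
  by rewrite -mulmxA QQ mulmx1.
have d0 k : 0 <= d 0 k.
  have := congr1 (fun B : 'M[C]_p => B k k) dE; rewrite [RHS]mxE eqxx mulr1n.
  by move=> <-; exact: gram_diag_ge0.
have dR k : (complex.Re (d 0 k))%:C%C = d 0 k by apply: RRe_real; exact: ger0_real.
exists Q, (fun k => complex.Re (d 0 k)); split => //.
  by move=> k; have := d0 k; rewrite lecE => /andP[].
move=> z hz i j.
have nz k : d 0 k - z != 0.
  by rewrite -dR cut_plane_sub_neq0 //; have := d0 k; rewrite lecE => /andP[].
have -> : invmx (A - z%:M) = Q^t* *m diag_mx (\row_k (d 0 k - z)^-1) *m Q.
  have U : A - z%:M \in unitmx by apply: gram_unitmx; exact/cut_planeE.
  apply: (can_inj (mulmxK U)); rewrite mulVmx //.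
  have -> : A - z%:M = Q^t* *m diag_mx (\row_k (d 0 k - z)) *m Q.
    have -> : \row_k (d 0 k - z) = d - const_mx z.
      by apply/rowP => k; rewrite !mxE.
    rewrite raddfB /= mulmxBr mulmxBl -eA; congr (_ - _).
    by rewrite diag_const_mx mul_mx_scalar -scalemxAl QQ' scalemx1.
  rewrite !mulmxA -(mulmxA _ Q) QQ mulmx1 -(mulmxA (Q^t*)) mulmx_diag.
  rewrite (_ : \row_j _ = const_mx 1); last first.
    by apply/rowP => k; rewrite !mxE mulVf.
  by rewrite diag_const_mx mulmx1 QQ'.
rewrite mxE; apply: eq_bigr => k _; rewrite dR mul_mx_diag !mxE; ring.
Qed.

(** The spectral measure of the i-th basis vector: its weights are the squared moduli of a column of
    a unitary matrix, hence have sum 1. *)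
Lemma fin_stieltjes_resolvent (p n : nat) (Y : 'M[C]_(p, n)) i :
  fin_stieltjes 1 (fun z => invmx (Y *m Y^t* - z%:M) i i).
Proof.
have [Q [l [QQ l0 E]]] := gram_spectral Y.
have e k : ((Normc.normc (Q k i) ^+ 2)%:C)%C = (Q k i)^* * Q k i.
  by rewrite -normCKC rmorphXn.
exists [seq (Normc.normc (Q k i) ^+ 2, l k) | k <- index_enum 'I_p]; split.
- by move=> _ /mapP[k _ ->] /=; rewrite sqr_ge0.
- rewrite big_map /=; apply: (@complexI R); rewrite rmorph_sum /=.
  have := congr1 (fun B : 'M[C]_p => B i i) QQ; rewrite [RHS]mxE eqxx => h.
  have -> : (1%:C)%C = true%:R :> C by [].
  by rewrite -h mxE; apply: eq_bigr => k _; rewrite e !mxE.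
- move=> z hz; rewrite E // big_map; apply: eq_bigr => k _ /=.
  by rewrite e.
Qed.

Lemma fin_stieltjes_trace (p n : nat) (Y : 'M[C]_(p, n)) : (0 < p)%N ->
  fin_stieltjes 1 (norm_trace_resolvent (Y *m Y^t*)).
Proof.
move=> p0; have := fin_stieltjes_sum (fin_stieltjes_resolvent Y).
move=> /(@fin_stieltjesZ _ _ p%:R^-1); rewrite invr_ge0 ler0n => /(_ isT).
rewrite sumr_const card_ord mulVf ?pnatr_eq0 -?lt0n //.
by apply: fin_stieltjes_ext => z _; rewrite fmorphV /= rmorph_nat.
Qed.

(* The measure of [f] is carried by the positive semidefinite matrix whose first
   row holds the square roots of the weights, the others forming the diagonal
   matrix of the square roots of the atoms. *)
Lemma fin_stieltjes_row_form m f : fin_stieltjes m f ->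
  exists N (Y : 'M[C]_(1 + N, N)), forall z, cut_plane z ->
    row_form Y z (lshift N 0) = f z.
Proof.
move=> [s [h1 _ h3]]; set N := size s.
pose b (k : 'I_N) : R := (nth (0, 0) s k).1.
pose l (k : 'I_N) : R := (nth (0, 0) s k).2.
have b0 k : 0 <= b k by have [] := h1 _ (mem_nth (0, 0) (ltn_ord k)).
have l0 k : 0 <= l k by have [] := h1 _ (mem_nth (0, 0) (ltn_ord k)).
pose Y : 'M[C]_(1 + N, N) := col_mx (\row_k ((Num.sqrt (b k))%:C)%C)
  (diag_mx (\row_k ((Num.sqrt (l k))%:C)%C)).
have cR (x : R) : (x%:C%C)^* = x%:C%C by apply/eqP; rewrite eq_complex /= oppr0 !eqxx.
have sq (x : R) : 0 <= x -> ((Num.sqrt x)%:C%C) * (Num.sqrt x)%:C%C = x%:C%C.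
  by move=> x0; rewrite -rmorphM -expr2 sqr_sqrtr.
exists N, Y => z hz; rewrite h3 // (big_nth (0, 0)) big_mkord.
have rY : row (lshift N 0) Y = \row_k ((Num.sqrt (b k))%:C)%C.
  by rewrite rowKu; apply/rowP => k; rewrite !mxE.
rewrite /row_form rY.
have -> : (zero_row Y (lshift N 0))^t* *m zero_row Y (lshift N 0) =
    diag_mx (\row_k (l k)%:C%C).
  have -> : zero_row Y (lshift N 0) =
      col_mx (0 : 'M[C]_(1, N)) (diag_mx (\row_k ((Num.sqrt (l k))%:C)%C)).
    apply/matrixP => i k; rewrite mxE; case: (split_ordP i) => j ->.
      by rewrite !col_mxEu !mxE (ord1 j) eqxx.
    by rewrite !col_mxEd; case: eqP => // /(congr1 val).
  rewrite tr_col_mx map_row_mx mul_row_col mulmx0 add0r tr_diag_mx map_diag_mx.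
  rewrite mulmx_diag; congr diag_mx; apply/rowP => k; rewrite !mxE.
  by rewrite /= cR sq.
have -> : invmx (diag_mx (\row_k (l k)%:C%C) - z%:M) =
    diag_mx (\row_(k < N) ((l k)%:C%C - z)^-1).
  have -> : diag_mx (\row_k (l k)%:C%C) - z%:M =
      diag_mx (\row_(k < N) ((l k)%:C%C - z)).
    rewrite -diag_const_mx -raddfB; congr diag_mx.
    by apply/rowP => k; rewrite !mxE.
  set D := diag_mx (\row_(k < N) ((l k)%:C%C - z)).
  have DV : D *m diag_mx (\row_(k < N) ((l k)%:C%C - z)^-1) = 1%:M.
    rewrite mulmx_diag -diag_const_mx; congr diag_mx; apply/rowP => k.
    by rewrite !mxE divff // cut_plane_sub_neq0.
  have [DU _] := mulmx1_unit DV.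
  by rewrite -[LHS]mulmx1 -DV mulmxA mulVmx // mul1mx.
rewrite mul_mx_diag mxE; apply: eq_bigr => k _; rewrite !mxE /= cR.
by rewrite mulrAC sq.
Qed.

Lemma fin_stieltjes_neq m f z : fin_stieltjes m f -> cut_plane z ->
  1 + f z != 0.
Proof.
move=> /fin_stieltjes_row_form [N [Y hY]] hz; rewrite -hY //.
by apply: row_form_neq; exact/cut_planeE.
Qed.

(** Once f is realized as a [row_form], the right-hand side is a diagonal entry of a Gram resolvent
    by the Schur complement. Its mass is therefore 1 whatever m is. *)
Lemma fin_stieltjes_step m f : fin_stieltjes m f ->
  fin_stieltjes 1 (fun z => -1 / (z * (1 + f z))).
Proof.
move=> /fin_stieltjes_row_form [N [Y hY]].
apply: (fin_stieltjes_ext _ (fin_stieltjes_resolvent Y (lshift N 0))) => z hz.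
rewrite resolvent_diag; last exact/cut_planeE.
by rewrite hY // invfM mulN1r mulNr.
Qed.

End FiniteStieltjes.

(** * Measurability of complex functions and of matrix inverses *)

Section ComplexMeasurability.
Variable R : realType.
Local Notation C := R[i].

Definition cmeasurable d (T : measurableType d) (f : T -> C) : Prop :=
  measurable_fun setT (fun t => complex.Re (f t)) /\
  measurable_fun setT (fun t => complex.Im (f t)).

Context d (T : measurableType d).
Implicit Types f g : T -> C.

Lemma cmeasurable_cst (a : C) : cmeasurable (fun _ : T => a).
Proof. by split; exact: measurable_cst. Qed.

Lemma cmeasurable_real (f : T -> R) : measurable_fun setT f ->
  cmeasurable (fun t => (f t)%:C%C).
Proof. by move=> mf; split => //=; exact: measurable_cst. Qed.

Lemma cmeasurableD f g : cmeasurable f -> cmeasurable g ->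
  cmeasurable (fun t => f t + g t).
Proof.
move=> [f1 f2] [g1 g2]; split.
  rewrite (_ : (fun t => _) = (fun t => complex.Re (f t)) \+ (fun t => complex.Re (g t))).
    exact: measurable_funD.
  by apply/funext => t /=; case: (f t) (g t) => [? ?] [? ?].
rewrite (_ : (fun t => _) = (fun t => complex.Im (f t)) \+ (fun t => complex.Im (g t))).
  exact: measurable_funD.
by apply/funext => t /=; case: (f t) (g t) => [? ?] [? ?].
Qed.

Lemma cmeasurableM f g : cmeasurable f -> cmeasurable g ->
  cmeasurable (fun t => f t * g t).
Proof.
move=> [f1 f2] [g1 g2]; split.
  rewrite (_ : (fun t => _) = (fun t => complex.Re (f t) * complex.Re (g t)) \-
     (fun t => complex.Im (f t) * complex.Im (g t))).
    by apply: measurable_funB; exact: measurable_funM.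
  by apply/funext => t /=; case: (f t) (g t) => [? ?] [? ?].
rewrite (_ : (fun t => _) = (fun t => complex.Re (f t) * complex.Im (g t)) \+
     (fun t => complex.Im (f t) * complex.Re (g t))).
  by apply: measurable_funD; exact: measurable_funM.
by apply/funext => t /=; case: (f t) (g t) => [? ?] [? ?].
Qed.

Lemma cmeasurableN f : cmeasurable f -> cmeasurable (fun t => - f t).
Proof.
move=> hf; rewrite (_ : (fun t => _) = (fun t => -1 * f t)).
  exact: cmeasurableM (cmeasurable_cst _) hf.
by apply/funext => t; rewrite mulN1r.
Qed.

Lemma cmeasurable_conj f : cmeasurable f -> cmeasurable (fun t => (f t)^*).
Proof.
move=> [f1 f2]; split.
  by rewrite (_ : (fun t => _) = fun t => complex.Re (f t)) //; apply/funext => t /=; case: (f t).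
rewrite (_ : (fun t => _) = \- (fun t => complex.Im (f t))).
  exact: measurable_funN.
by apply/funext => t /=; case: (f t).
Qed.

Lemma measurable_normc2 f : cmeasurable f ->
  measurable_fun setT (fun t => Normc.normc (f t) ^+ 2).
Proof.
move=> [f1 f2].
rewrite (_ : (fun t => _) = (fun t => complex.Re (f t) * complex.Re (f t)) \+
     (fun t => complex.Im (f t) * complex.Im (f t))).
  by apply: measurable_funD; exact: measurable_funM.
apply/funext => t /=; case: (f t) => [a b] /=.
by rewrite sqr_sqrtr ?addr_ge0 ?sqr_ge0 // !expr2.
Qed.

Lemma measurable_normc f : cmeasurable f ->
  measurable_fun setT (fun t => Normc.normc (f t)).
Proof.
move=> hf; have ms : measurable_fun setT (@Num.sqrt R).
  exact: continuous_measurable_fun (@sqrt_continuous R).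
rewrite (_ : (fun t => _) = @Num.sqrt R \o (fun t => Normc.normc (f t) ^+ 2)).
  exact: measurableT_comp ms (measurable_normc2 hf).
apply/funext => t /=; rewrite sqrtr_sqr ger0_norm //.
by case: (f t) => a b /=; exact: sqrtr_ge0.
Qed.

(** The inverse is the conjugate divided by the squared modulus, with the real inverse written as a
    power of exponent -1. At a zero of f both sides are 0. *)
Lemma cmeasurableV f : cmeasurable f -> cmeasurable (fun t => (f t)^-1).
Proof.
move=> hf; have mN := measurable_normc2 hf.
rewrite (_ : (fun t => _) = fun t =>
  (f t)^* * ((Normc.normc (f t) ^+ 2) `^ (-1))%:C%C).
  apply: cmeasurableM (cmeasurable_conj hf) (cmeasurable_real _).
  exact: (measurableT_comp (measurable_powR (-1)) mN).
apply/funext => t; rewrite powR_inv1 ?sqr_ge0 // fmorphV rmorphXn /=.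
rewrite -[X in X ^- 2]/`|f t|.
have [->|nz] := eqVneq (f t) 0; first by rewrite conjC0 mul0r invr0.
by rewrite normCK invfM mulrCA mulfV ?mulr1 // conjC_eq0.
Qed.

Lemma cmeasurable_sum (I : Type) (s : seq I) (P : pred I) (f : I -> T -> C) :
  (forall i, cmeasurable (f i)) ->
  cmeasurable (fun t => \sum_(i <- s | P i) f i t).
Proof.
move=> h; elim: s => [|i s IH].
  under eq_fun do rewrite big_nil; exact: cmeasurable_cst.
under eq_fun do rewrite big_cons.
by case: (P i) => //; exact: cmeasurableD.
Qed.

Lemma cmeasurable_prod (I : Type) (s : seq I) (P : pred I) (f : I -> T -> C) :
  (forall i, cmeasurable (f i)) ->
  cmeasurable (fun t => \prod_(i <- s | P i) f i t).
Proof.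
move=> h; elim: s => [|i s IH].
  under eq_fun do rewrite big_nil; exact: cmeasurable_cst.
under eq_fun do rewrite big_cons.
by case: (P i) => //; exact: cmeasurableM.
Qed.

Definition mx_measurable (m n : nat) (A : T -> 'M[C]_(m, n)) : Prop :=
  forall i j, cmeasurable (fun t => A t i j).

Lemma mx_measurable_mul m n k (A : T -> 'M[C]_(m, n)) (B : T -> 'M[C]_(n, k)) :
  mx_measurable A -> mx_measurable B -> mx_measurable (fun t => A t *m B t).
Proof.
move=> hA hB i j; under eq_fun do rewrite mxE.
by apply: cmeasurable_sum => l; exact: cmeasurableM.
Qed.

Lemma mx_measurable_trC m n (A : T -> 'M[C]_(m, n)) :
  mx_measurable A -> mx_measurable (fun t => (A t)^t*).
Proof.
by move=> hA i j; under eq_fun do rewrite !mxE; exact: cmeasurable_conj.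
Qed.

Lemma cmeasurable_det n (A : T -> 'M[C]_n) :
  mx_measurable A -> cmeasurable (fun t => \det (A t)).
Proof.
move=> hA; rewrite /determinant; apply: cmeasurable_sum => s.
by apply: cmeasurableM (cmeasurable_cst _) _; exact: cmeasurable_prod.
Qed.

Lemma mx_measurable_inv n (A : T -> 'M[C]_n) : (forall t, A t \in unitmx) ->
  mx_measurable A -> mx_measurable (fun t => invmx (A t)).
Proof.
move=> hU hA i j; rewrite (_ : (fun t => _) =
   fun t => (\det (A t))^-1 * cofactor (A t) j i); last first.
  by apply/funext => t; rewrite /invmx hU !mxE.
apply: cmeasurableM; first by apply: cmeasurableV; exact: cmeasurable_det.
apply: cmeasurableM (cmeasurable_cst _) _; apply: cmeasurable_det => k l.
by under eq_fun do rewrite !mxE.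
Qed.

End ComplexMeasurability.

(** * Null sequences of complex numbers along a filter *)

Section ComplexLimits.
Variable R : realType.
Local Notation C := R[i].
Local Notation nc := (@Normc.normc R).

Lemma normcE (z : C) : `|z| = (nc z)%:C%C. Proof. by []. Qed.

Lemma normc_ge0 (z : C) : 0 <= nc z.
Proof. by case: z => a b; exact: sqrtr_ge0. Qed.

Lemma normc_triangle (x y : C) : nc (x + y) <= nc x + nc y.
Proof. exact: le_normcD. Qed.

Lemma normc_opp (x : C) : nc (- x) = nc x.
Proof. exact: normcN. Qed.

Lemma normc_distC (x y : C) : nc (x - y) = nc (y - x).
Proof. by rewrite -normc_opp opprB. Qed.

Lemma normc_real (x : R) : nc x%:C%C = `|x|.
Proof. by rewrite /= expr0n addr0 sqrtr_sqr. Qed.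

Lemma normc_sum (I : Type) (s : seq I) (P : pred I) (F : I -> C) :
  nc (\sum_(i <- s | P i) F i) <= \sum_(i <- s | P i) nc (F i).
Proof.
elim/big_ind2: _ => //; first by rewrite Normc.normc0.
by move=> x a y b h1 h2; apply: le_trans (normc_triangle _ _) (lerD h1 h2).
Qed.

Lemma normc_sq (z : C) : nc z ^+ 2 = complex.Re z ^+ 2 + complex.Im z ^+ 2.
Proof. by case: z => a b; rewrite /= sqr_sqrtr // addr_ge0 ?sqr_ge0. Qed.

Lemma normc_Re (z : C) : `|complex.Re z| <= nc z.
Proof.
rewrite -ler_sqr ?nnegrE ?normc_ge0 //.
by rewrite real_normK ?num_real // normc_sq lerDl sqr_ge0.
Qed.

Lemma normc_Im (z : C) : `|complex.Im z| <= nc z.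
Proof.
rewrite -ler_sqr ?nnegrE ?normc_ge0 //.
by rewrite real_normK ?num_real // normc_sq lerDr sqr_ge0.
Qed.

Lemma normc_le_ReIm (z : C) : nc z <= `|complex.Re z| + `|complex.Im z|.
Proof.
rewrite -ler_sqr ?nnegrE ?normc_ge0 ?addr_ge0 // normc_sq sqrrD.
by rewrite !real_normK ?num_real // addrAC lerDl mulrn_wge0 // mulr_ge0.
Qed.

(** The tolerance is real, whereas the norm of [C] takes values in [C]. The filter is arbitrary
    because limits are taken both at infinity and along an ultrafilter. *)
Definition cnull (T : Type) (F : set_system T) (D : T -> C) : Prop :=
  forall e : R, 0 < e -> \forall n \near F, nc (D n) < e.

Context (T : Type) (F : set_system T) {FF : ProperFilter F}.
Implicit Types D : T -> C.

Lemma cnullP D : cnull F D <-> D n @[n --> F] --> (0 : C^o).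
Proof.
apply: (iff_trans _ (iff_sym (@cvgr0Pnorm_lt _ C^o _ F _ D))); split=> h e e0; last first.
  have e0' : 0 < e%:C%C :> C by rewrite ltcR.
  by apply: filterS (h _ e0') => n; rewrite normcE ltcR.
have eR : (complex.Re e)%:C%C = e by apply: RRe_real; exact: gtr0_real.
have : 0 < complex.Re e by rewrite -ltcR eR.
by move=> /h; apply: filterS => n; rewrite normcE -eR ltcR.
Qed.

Lemma cnull_real (D : T -> R) (E : T -> C) : (forall n, nc (E n) <= D n) ->
  D n @[n --> F] --> (0 : R) -> cnull F E.
Proof.
move=> ED /cvgr0Pnorm_lt h e /h; apply: filterS => n.
by apply: le_lt_trans; apply: le_trans (ED n) (ler_norm _).
Qed.

Lemma cnullD D E : cnull F D -> cnull F E -> cnull F (fun n => D n + E n).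
Proof.
move=> hD hE e e0; have e2 : 0 < e / 2 by rewrite divr_gt0.
apply: filterS2 (hD _ e2) (hE _ e2) => n h1 h2.
by apply: le_lt_trans (normc_triangle _ _) _; rewrite [e]splitr ltrD.
Qed.

Lemma cnull0 : cnull F (fun=> 0).
Proof. by move=> e e0; near=> n; rewrite Normc.normc0. Unshelve. all: end_near. Qed.

Lemma cnullM D E (B : R) : (forall n, nc (E n) <= B) -> cnull F D ->
  cnull F (fun n => E n * D n).
Proof.
move=> EB hD e e0.
have B0 : 0 < `|B| + 1 by rewrite ltr_pwDr.
have := hD _ (divr_gt0 e0 B0); apply: filterS => n h.
rewrite Normc.normcM; apply: le_lt_trans (_ : nc (E n) * nc (D n) <= (`|B| + 1) * nc (D n)) _.
  apply: ler_wpM2r; first exact: normc_ge0.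
  by apply: le_trans (EB n) _; apply: le_trans (ler_norm B) _; rewrite lerDl.
by rewrite mulrC -ltr_pdivlMr.
Qed.

Lemma cnullZ (a : C) D : cnull F D -> cnull F (fun n => a * D n).
Proof. exact: (@cnullM _ (fun=> a) (nc a)). Qed.

Lemma cnull_sum (I : Type) (s : seq I) (D : I -> T -> C) :
  (forall i, cnull F (D i)) -> cnull F (fun n => \sum_(i <- s) D i n).
Proof.
move=> h; elim: s => [|i s IH].
  by under eq_fun do rewrite big_nil; exact: cnull0.
by under eq_fun do rewrite big_cons; exact: cnullD.
Qed.

Lemma cnull_cst (a : C) : cnull F (fun=> a) -> a = 0.
Proof.
move=> h; apply/eqP; rewrite -normr_eq0 normcE.
have [a0|] := ltP 0 (nc a); first by have [n] := filter_ex (h _ a0); rewrite ltxx.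
by move=> a0; rewrite (_ : nc a = 0) //; apply: le_anti; rewrite a0 normc_ge0.
Qed.

End ComplexLimits.

(** * Interpolation of Cauchy kernels and the identity principle *)

Section Extension.
Variable R : realType.
Local Notation C := R[i].
Local Notation nc := (@Normc.normc R).

(* The only feature of a Stieltjes transform that the identity principle below
   uses: linear combinations of its values are controlled by the sup norm of
   the corresponding combination of Cauchy kernels. *)
Definition stieltjes_bound (K : R) (f : C -> C) : Prop :=
  forall (s : seq (C * C)) (M : R), (forall e, e \in s -> cut_plane e.2) ->
  (forall l : R, 0 <= l -> nc (\sum_(e <- s) e.1 / (l%:C%C - e.2)) <= M) ->
  nc (\sum_(e <- s) e.1 * f e.2) <= K * M.

Lemma stieltjes_boundB K K' f g : stieltjes_bound K f -> stieltjes_bound K' g ->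
  stieltjes_bound (K + K') (fun z => f z - g z).
Proof.
move=> hf hg s M hs hM; under eq_bigr do rewrite mulrBr.
rewrite sumrB mulrDl; apply: le_trans (normc_triangle _ _) _.
by rewrite normc_opp lerD ?hf ?hg.
Qed.

Lemma fin_stieltjes_bound m f : fin_stieltjes m f -> stieltjes_bound m f.
Proof.
move=> [t [h1 h2 h3]] s M hs hM.
have -> : \sum_(e <- s) e.1 * f e.2 =
    \sum_(a <- t) a.1%:C%C * \sum_(e <- s) e.1 / (a.2%:C%C - e.2).
  under [RHS]eq_bigr do rewrite mulr_sumr.
  rewrite exchange_big /= big_seq_cond [RHS]big_seq_cond.
  apply: eq_bigr => e /andP[/hs he _]; rewrite h3 // mulr_sumr.
  by apply: eq_bigr => a _; rewrite mulrCA.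
apply: le_trans (normc_sum _ _ _) _; rewrite -h2 mulr_suml.
rewrite big_seq_cond [leRHS]big_seq_cond; apply: ler_sum => a /andP[/h1 [a1 a2] _].
by rewrite Normc.normcM normc_real ger0_norm // ler_wpM2l // hM.
Qed.

Lemma cut_plane_dist (z : C) : cut_plane z ->
  exists2 dl : R, 0 < dl & forall l : R, 0 <= l -> dl <= nc (l%:C%C - z).
Proof.
move=> hz; have [y0|y0] := eqVneq (complex.Im z) 0.
  have x0 : complex.Re z < 0 by rewrite ltNge; apply/negP => x0; apply: hz.
  exists (- complex.Re z); first by rewrite oppr_gt0.
  move=> l l0; apply: le_trans _ (normc_Re _); case: z x0 {hz y0} => a b /= a0.
  by apply: le_trans _ (ler_norm _); rewrite lerDr.
exists `|complex.Im z|; first by rewrite normr_gt0.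
move=> l l0; apply: le_trans _ (normc_Im _).
by case: z {hz y0} => a b /=; rewrite add0r normrN.
Qed.

(** Each new node multiplies the remainder by (z - w k) / (l - w k). Partial fractions turn the
    resulting products of two kernels back into a combination of kernels, which needs distinct
    nodes. The weights do not depend on l. *)
Lemma newton_remainder (w : nat -> C) (z : C) (k : nat) :
  injective w -> (forall i, cut_plane (w i)) -> cut_plane z ->
  exists s : seq (C * C),
    (forall e, e \in s -> exists2 i, (i < k)%N & e.2 = w i) /\
    forall l : R, 0 <= l ->
      (l%:C%C - z)^-1 - \sum_(e <- s) e.1 / (l%:C%C - e.2) =
      (l%:C%C - z)^-1 * \prod_(i < k) ((z - w i) / (l%:C%C - w i)).
Proof.
move=> winj hw hz; elim: k => [|k [s [hs E]]].
  by exists [::]; split=> // l l0; rewrite big_nil big_ord0 subr0 mulr1.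
pose cf (e : C * C) := e.1 * (z - w k) / (e.2 - w k).
(* The product of the kernel at [e.2], weighted by [e.1], with (z - w k) / (l - w k) is [cf e] times
   the kernel at [e.2] minus the kernel at [w k]. The product for z is the kernel at z minus that at
   [w k]. Collecting the kernels at [w k] gives the new weight. *)
exists ((1 - \sum_(e <- s) cf e, w k) :: [seq (cf e, e.2) | e <- s]); split.
  move=> e; rewrite inE => /predU1P[->|/mapP[a /hs [i ik ai] ->]] /=.
    by exists k.
  by exists i => //; rewrite ltnS ltnW.
move=> l l0.
have -> : \prod_(i < k.+1) ((z - w i) / (l%:C%C - w i)) =
    \prod_(i < k) ((z - w i) / (l%:C%C - w i)) * ((z - w k) / (l%:C%C - w k)).
  by rewrite big_ord_recr.
rewrite [RHS]mulrA -(E l l0) big_cons big_map /=.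
set g := l%:C%C; have gz : g - z != 0 by exact: cut_plane_sub_neq0.
have gk : g - w k != 0 by exact: cut_plane_sub_neq0.
rewrite [RHS]mulrBl [in RHS]mulr_suml.
have -> : \sum_(e <- s) e.1 / (g - e.2) * ((z - w k) / (g - w k)) =
  \sum_(e <- s) cf e / (g - e.2) - (\sum_(e <- s) cf e) / (g - w k).
  rewrite mulr_suml -sumrB big_seq_cond [RHS]big_seq_cond.
  apply: eq_bigr => e /andP[/hs [i ik ei] _].
  have gi : g - e.2 != 0 by rewrite ei; exact: cut_plane_sub_neq0.
  have ik' : e.2 - w k != 0.
    by rewrite ei subr_eq0; apply/eqP => /winj ikE; rewrite ikE ltnn in ik.
  by rewrite /cf; field; rewrite gi gk ik'.
by field; rewrite gz gk.
Qed.

Lemma Re_lt0_cut (z : C) : complex.Re z < 0 -> cut_plane z.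
Proof. by move=> z0 [_]; rewrite leNgt z0. Qed.

(** The last hypothesis says |z - w|^2 <= |w|^2 - 1, that is, z lies inside the disc around w
    through 0. On the other hand |l - w| >= |w|, because w is in the left half-plane and l >= 0. *)
Lemma ratio_bound (z w : C) (l B : R) : complex.Re w < 0 -> nc w <= B -> 0 <= l ->
  nc z ^+ 2 + 1 <= 2 * (complex.Re z * complex.Re w + complex.Im z * complex.Im w) ->
  nc ((z - w) / (l%:C%C - w)) <= Num.sqrt (1 - (B ^+ 2)^-1).
Proof.
move=> w0 wB l0 h; have lw := cut_plane_sub_neq0 (Re_lt0_cut w0) l0.
have wn : 0 < nc w ^+ 2.
  rewrite normc_sq ltr_pwDl ?sqr_ge0 //.
  by rewrite exprn_even_gt0 //= lt_eqF.
have wB2 : nc w ^+ 2 <= B ^+ 2.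
  by rewrite ler_sqr ?nnegrE ?normc_ge0 // (le_trans (normc_ge0 w) wB).
have lwn : nc w ^+ 2 <= nc (l%:C%C - w) ^+ 2.
  rewrite !normc_sq; case: w w0 {lw h wB wn wB2} => a b /= a0; nra.
have zw : nc (z - w) ^+ 2 <= nc w ^+ 2 - 1.
  move: h; rewrite !normc_sq; case: z w {w0 wB lw wn wB2 lwn} => a b [a' b'] /=; nra.
rewrite -(ger0_norm (normc_ge0 _)) -sqrtr_sqr ler_wsqrtr //.
rewrite Normc.normcM Normc.normcV exprMn exprVn.
have l2 : 0 < nc (l%:C%C - w) ^+ 2 by exact: lt_le_trans wn lwn.
rewrite ler_pdivrMr //.
have B2 : 0 < B ^+ 2 by exact: lt_le_trans wn wB2.
have -> : (1 - (B ^+ 2)^-1) * nc (l%:C%C - w) ^+ 2 =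
  nc (l%:C%C - w) ^+ 2 * (B ^+ 2 - 1) / B ^+ 2 by field; rewrite -sqrf_eq0 gt_eqF.
rewrite ler_pdivlMr //; set a := nc (z - w) ^+ 2 in zw *.
have a0 : 0 <= a by exact: sqr_ge0.
set L := nc (_ - w) ^+ 2 in lwn l2 *; set W := nc w ^+ 2 in wn wB2 lwn zw *.
set BB := B ^+ 2 in wB2 B2 *; nra.
Qed.

Section Filter.
Context (T : Type) (F : set_system T) {FF : ProperFilter F}.
Variables (D : T -> C -> C) (K : R).
Hypothesis Dbound : forall n, stieltjes_bound K (D n).

Let K_ge0 : 0 <= K.
Proof.
have [n _] := filter_ex (@filterT _ F _).
have := @Dbound n [::] 1 (fun e => ltac:(by [])) _.
rewrite mulr1 big_nil Normc.normc0; apply=> l _.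
by rewrite big_nil Normc.normc0.
Qed.

(** With k nodes the Newton remainder is at most rho^k / dl uniformly in l, where rho < 1. By
    [Dbound] the value at z is then close to a fixed finite combination of values at the nodes, for
    all n at once, so k can be chosen before n. *)
Lemma stieltjes_extend (w : nat -> C) (z : C) (B : R) : injective w ->
  (forall i, complex.Re (w i) < 0) -> (forall i, nc (w i) <= B) ->
  cut_plane z ->
  (forall i, nc z ^+ 2 + 1 <=
    2 * (complex.Re z * complex.Re (w i) + complex.Im z * complex.Im (w i))) ->
  (forall i, cnull F (fun n => D n (w i))) -> cnull F (fun n => D n z).
Proof.
move=> winj w0 wB hz zw wnull e e0.
have hw i : cut_plane (w i) by exact: Re_lt0_cut.
have [dl dl0 hdl] := cut_plane_dist hz.
have B0 : 0 < B.
  apply: lt_le_trans (wB 0%N); apply: lt_le_trans (normc_Re _).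
  by rewrite normr_gt0 lt_eqF.
pose rho := Num.sqrt (1 - (B ^+ 2)^-1).
have rho1 : `|rho| < 1.
  rewrite ger0_norm ?sqrtr_ge0 // -sqrtr1 ltr_sqrt // ltrBlDr ltrDl.
  by rewrite invr_gt0 exprn_gt0.
have rho0 : 0 <= rho by exact: sqrtr_ge0.
have [k hk] : exists k, K * (dl^-1 * rho ^+ k) < e / 2.
  have c0 : 0 < (K + 1) / dl by rewrite divr_gt0 // ltr_wpDl.
  have := cvgr0_norm_lt _ (cvg_expr rho1) _ (divr_gt0 (divr_gt0 e0 (ltr0n _ 2)) c0).
  move=> /(_ _) /filter_ex [k]; rewrite ger0_norm ?exprn_ge0 // => hk; exists k.
  move: hk; rewrite ltr_pdivlMr //; apply: le_lt_trans.
  rewrite mulrA [leRHS]mulrC ler_wpM2r ?exprn_ge0 // ler_pM2r ?invr_gt0 //.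
  by rewrite lerDl.
have [s [hs E]] := newton_remainder k winj hw hz.
have b1 n : nc (D n z - \sum_(a <- s) a.1 * D n a.2) <= K * (dl^-1 * rho ^+ k).
  have := @Dbound n ((1, z) :: [seq (- a.1, a.2) | a <- s]) (dl^-1 * rho ^+ k).
  rewrite big_cons big_map /= mul1r; under eq_bigr do rewrite mulNr.
  rewrite sumrN; apply.
    by move=> a; rewrite inE => /predU1P[-> //|/mapP[b /hs [i _ bi] ->]] /=; rewrite bi.
  move=> l l0; rewrite big_cons big_map /= mul1r.
  under eq_bigr do rewrite mulNr.
  rewrite sumrN E // Normc.normcM ler_pM ?normc_ge0 //.
    by rewrite Normc.normcV lef_pV2 ?posrE ?hdl // (lt_le_trans dl0 (hdl _ l0)).
  elim: (k) => [|j IH]; first by rewrite big_ord0 expr0 Normc.normc1.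
  rewrite big_ord_recr /= exprSr Normc.normcM ler_pM ?normc_ge0 //.
  exact: ratio_bound.
have b2 : cnull F (fun n => \sum_(a <- s) a.1 * D n a.2).
  elim: (s) hs {E b1} => [|a s' IH] hs.
    by under eq_fun do rewrite big_nil; exact: cnull0.
  under eq_fun do rewrite big_cons; apply: cnullD.
    have [i _ ->] := hs a (mem_head _ _); exact: cnullZ.
  by apply: IH => b bs; apply: hs; rewrite inE bs orbT.
apply: filterS (b2 (e / 2) _) => [n hn|]; last by rewrite divr_gt0.
rewrite -(subrK (\sum_(a <- s) a.1 * D n a.2) (D n z)).
apply: le_lt_trans (normc_triangle _ _) _; rewrite [e]splitr ltrD //.
exact: le_lt_trans (b1 n) hk.
Qed.

(* Two applications of [stieltjes_extend]: from the negative axis to the left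
   half-plane, then from the line [Re z = -1] to the whole cut plane. *)
Lemma stieltjes_determined (X : R) :
  (forall m i : nat, X <= m%:R -> cnull F (fun n =>
     D n (- (m%:R + i.+1%:R^-1)%:C%C))) ->
  forall z, cut_plane z -> cnull F (fun n => D n z).
Proof.
have invinj (i j : nat) (a : R) : a + i.+1%:R^-1 = a + j.+1%:R^-1 -> i = j.
  by move=> /addrI /invr_inj /eqP; rewrite eqr_nat eqSS => /eqP.
have inv0 (i : nat) : (0 : R) < i.+1%:R^-1 by rewrite invr_gt0 ltr0n.
have inv1 (i : nat) : i.+1%:R^-1 <= (1 : R) by rewrite invf_le1 ?ler1n ?ltr0n.
move=> neg_null.
have left_null z : complex.Re z < 0 -> cnull F (fun n => D n z).
  (* The integer m is taken so large that |z|^2 + 1 <= m |Re z|, the disc condition of [ratio_bound]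
     with room to spare. The nodes -(m + 1/(i+1)) are distinct and bounded. *)
  move=> z0; pose Y := `|X| + (nc z ^+ 2 + 1) / - complex.Re z.
  have Y1 : 0 <= (nc z ^+ 2 + 1) / - complex.Re z.
    by rewrite divr_ge0 ?addr_ge0 ?sqr_ge0 // oppr_ge0 ltW.
  pose m := Num.bound Y; have Ym : Y < m%:R by apply: archi_boundP; rewrite addr_ge0.
  have hm : (nc z ^+ 2 + 1) <= m%:R * (- complex.Re z).
    rewrite -ler_pdivrMr ?oppr_gt0 //; apply: le_trans (ltW Ym).
    by rewrite lerDr.
  apply: (@stieltjes_extend (fun i => - (m%:R + i.+1%:R^-1)%:C%C) z (m%:R + 1)).
  - by move=> i j /oppr_inj /complexI; exact: invinj.
  - by move=> i /=; rewrite oppr_lt0 ltr_wpDl // ler0n.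
  - move=> i; rewrite normc_opp normc_real ger0_norm ?lerD2l //.
  - exact: Re_lt0_cut.
  - move=> i /=; have := inv0 i; move: hm; set iv := i.+1%:R^-1.
    move: z0; set a := complex.Re z; set M := m%:R; rewrite oppr0 mulr0 addr0.
    set N := nc z ^+ 2 => a0 hm iv0; have N0 : 0 <= N by exact: sqr_ge0.
    nra.
  - move=> i; apply: neg_null; apply: le_trans (ler_norm _) _.
    by apply: le_trans (ltW Ym); rewrite lerDl.
move=> z hz; have [/left_null //|z0] := ltP (complex.Re z) 0.
have y0 : complex.Im z != 0 by apply/eqP => y0; apply: hz.
(* The sign puts the nodes on the same side of the real axis as z. *)
pose tau := Num.sg (complex.Im z).
have tauM : tau * complex.Im z = `|complex.Im z| by rewrite /tau -normrEsg.
(* Chosen so that t |Im z| - Re z = |z|^2 + 1, which gives the disc condition at the nodes -1 + i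
   tau (t + 1/(i+1)). *)
pose t := (nc z ^+ 2 + 1 + complex.Re z) / `|complex.Im z|.
have y0' : 0 < `|complex.Im z| by rewrite normr_gt0.
have t0 : 0 <= t by rewrite divr_ge0 ?addr_ge0 ?sqr_ge0.
have tau2 : `|tau| = 1 by rewrite /tau normr_sg y0.
have tau0 : tau != 0 by rewrite -normr_eq0 tau2 oner_eq0.
apply: (@stieltjes_extend (fun i => (-1 +i* (tau * (t + i.+1%:R^-1)))%C) z (1 + (t + 1))).
- by move=> i j [] /(mulfI tau0); exact: invinj.
- by move=> i /=; rewrite oppr_lt0.
- move=> i; apply: le_trans (normc_le_ReIm _) _; rewrite /= normrN1 normrM tau2.
  by rewrite mul1r lerD2l ger0_norm ?lerD2l // addr_ge0 // ltW.
- exact: hz.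
- move=> i /=; rewrite mulrN1 mulrCA (mulrA tau) tauM.
  have -> : `|complex.Im z| * (t + i.+1%:R^-1) =
    nc z ^+ 2 + 1 + complex.Re z + `|complex.Im z| * i.+1%:R^-1.
    by rewrite mulrDr /t mulrC divfK // gt_eqF.
  have := mulr_gt0 y0' (inv0 i); move: (_ * _^-1) z0 => a.
  have := sqr_ge0 (nc z); lra.
- by move=> i; apply: left_null; rewrite /= oppr_lt0.
Qed.

End Filter.
End Extension.

(** * Distribution functions: compactness, regularization and tightness *)

Section Helly.
Variable R : realType.
Local Notation C := R[i].
Local Notation nc := (@Normc.normc R).

Lemma probability_of_cdf (F : R -> R) :
  nondecreasing F -> right_continuous F ->
  F @ -oo --> (0 : R) -> F @ +oo --> (1 : R) ->
  exists v : probability R R, forall y, v `]-oo, y]%classic = (F y)%:E.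
Proof.
move=> Fnd Frc FNy Fy; pose m1 := isCumulative.Build R _ R F Fnd Frc.
pose m2 := isCumulativeBounded.Build R 0 1 F FNy Fy.
pose Fc : cumulativeBounded (0:R) (1:R) := HB.pack F m1 m2.
have h := cdf_lebesgue_stieltjes_id Fc.
match type of h with forall r, @cdf _ _ _ ?P ?X r = _ =>
  by exists (distribution P X) => y; exact: (h y) end.
Qed.

(** A cluster point of an ultrafilter is a limit, and [0, 1] is compact. The same ultrafilter serves
    every point y, so no diagonal extraction is needed. *)
Lemma ultra_lim (U : set_system nat) (phi : nat -> R) : UltraFilter U ->
  (forall k, 0 <= phi k <= 1) -> exists g : R, phi @ U --> g.
Proof.
move=> UU h; have [] := @segment_compact R 0 1 (phi @ U) _.
  by apply: (@filterE _ U) => k /=; rewrite in_itv /=; exact: h.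
move=> g [_ cg]; exists g => V nV.
case: (in_ultra_setVsetC (phi @^-1` V) UU) => [VU|nVU]; first exact: VU.
by have [r []] := cg (~` V) V nVU nV.
Qed.

(** The right limit of a monotone G. A pointwise limit of distribution functions is monotone but may
    fail to be right-continuous. *)
Definition right_reg (G : R -> R) (y : R) : R := inf [set G r | r in `]y, +oo[].

Section Regularization.
Variable G : R -> R.
Hypotheses (Gnd : {homo G : x y / x <= y}) (G0 : forall y, 0 <= G y).

Let lb y : has_lbound [set G r | r in `]y, +oo[].
Proof. by exists 0 => _ [r _ <-]. Qed.

Let ne y : [set G r | r in `]y, +oo[] !=set0.
Proof. by exists (G (y + 1)), (y + 1) => //=; rewrite in_itv /= ltrDl ltr01. Qed.

Lemma right_reg_ge y : G y <= right_reg G y.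
Proof.
by apply: lb_le_inf (ne y) _ => _ [r /= + <-]; rewrite in_itv /= andbT => /ltW /Gnd.
Qed.

Lemma right_reg_le y r : y < r -> right_reg G y <= G r.
Proof. by move=> yr; apply: (ge_inf (lb y)); exists r => //=; rewrite in_itv /= yr. Qed.

Lemma right_reg_nd : {homo right_reg G : x y / x <= y}.
Proof.
move=> x y xy; apply: lb_le_inf (ne y) _ => _ [r /= + <-].
by rewrite in_itv /= andbT => yr; apply: right_reg_le; exact: le_lt_trans yr.
Qed.

Lemma right_reg_rc : right_continuous (right_reg G).
Proof.
move=> y; apply/cvgrPdist_lt => e e0.
have [_ [r /= yr <-] re] := inf_adherent e0 (conj (ne y) (lb y)).
move: yr; rewrite in_itv /= andbT => yr.
near=> t; have yt : y < t by near: t; exact: nbhs_right_gt.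
have tr : t < r by near: t; exact: nbhs_right_lt.
rewrite distrC ger0_norm ?subr_ge0 ?right_reg_nd // ?(ltW yt) //.
by rewrite ltrBlDl; apply: le_lt_trans re; exact: right_reg_le.
Unshelve. all: end_near. Qed.

End Regularization.

Lemma count_le (a : R) (N : nat) : 0 <= a -> a <= N%:R ->
  \sum_(j < N) (j.+1%:R <= a)%R%:R <= a <= \sum_(j < N) (j.+1%:R <= a)%R%:R + 1.
Proof.
move=> a0 aN; pose S N : R := \sum_(j < N) (j.+1%:R <= a)%R%:R.
have [h1 h2] : S N <= a /\ (S N = N%:R \/ a < S N + 1 /\ S N <= N%:R).
  elim: {aN} N => [|N [IH1 IH2]]; first by rewrite /S big_ord0; split=> //; left.
  have SE : S N.+1 = S N + (N.+1%:R <= a)%R%:R by rewrite /S big_ord_recr.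
  case: (lerP N.+1%:R a) SE => ha -> /=; last first.
    rewrite addr0; split=> //; right; move: IH2 ha; rewrite -natr1.
    by case=> [->|[h1 h2]] h3; split=> //; lra.
  move: ha; rewrite -natr1 => ha; case: IH2 => [->|[h1 h2]]; last by lra.
  by split=> //; left.
apply/andP; split=> //; rewrite -/(S N); case: h2 => [->|[/ltW]] //.
by apply: le_trans aN _; rewrite lerDl.
Qed.

(* 1/(l + x) lies within 1/(x N) below its level-set approximation; the level
   sets are initial segments, so only the distribution function is needed. *)
Definition level (x : R) (N j : nat) : R := x * N%:R / j.+1%:R - x.

Definition layers (x : R) (N : nat) (l : R) : R :=
  (x * N%:R)^-1 * \sum_(j < N) (l <= level x N j)%R%:R.

Lemma layers_approx (x l : R) (N : nat) : 0 < x -> 0 <= l -> (0 < N)%N ->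
  layers x N l <= (l + x)^-1 <= layers x N l + (x * N%:R)^-1.
Proof.
move=> x0 l0 N0; have NR : 0 < N%:R :> R by rewrite ltr0n.
have lx : 0 < l + x by rewrite ltr_wpDl.
(* The kernel times x N, a number in [0, N]. The condition [l <= level x N j] says that j + 1 <= a,
   so the layers sum up to the floor of a, which is what [count_le] estimates. *)
pose a := x * N%:R / (l + x).
have a0 : 0 <= a by rewrite divr_ge0 ?mulr_ge0 // ltW.
have aN : a <= N%:R by rewrite ler_pdivrMr // mulrC ler_wpM2l ?lerDr // ltW.
have E : \sum_(j < N) (l <= level x N j)%R%:R = \sum_(j < N) (j.+1%:R <= a)%R%:R :> R.
  apply: eq_bigr => j _; congr (nat_of_bool _)%:R.
  rewrite /level lerBrDr ler_pdivlMr ?ltr0n // /a ler_pdivlMr // mulrC.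
  by [].
have /andP[h1 h2] := count_le a0 aN.
have xN : 0 < x * N%:R by rewrite mulr_gt0.
have -> : (l + x)^-1 = (x * N%:R)^-1 * a.
  by rewrite /a mulrA mulVf ?mul1r // gt_eqF.
rewrite /layers E ler_wpM2l ?invr_ge0 ?(ltW xN) //=.
rewrite -[X in _ + X]mulr1 -mulrDr ler_wpM2l // invr_ge0 ltW //.
Qed.

Definition fin_cdf (s : seq (R * R)) (y : R) : R := \sum_(e <- s | e.2 <= y) e.1.

Section FinCdf.
Variable s : seq (R * R).
Hypotheses (s0 : forall e, e \in s -> 0 <= e.1 /\ 0 <= e.2)
  (s1 : \sum_(e <- s) e.1 = 1).

Lemma fin_cdf_ind y : fin_cdf s y = \sum_(e <- s) e.1 * (e.2 <= y)%R%:R.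
Proof.
rewrite /fin_cdf big_mkcond; apply: eq_bigr => e _.
by case: ifP; rewrite ?mulr1 ?mulr0.
Qed.

Lemma fin_cdf01 y : 0 <= fin_cdf s y <= 1.
Proof.
rewrite fin_cdf_ind; apply/andP; split.
  by rewrite big_seq_cond; apply: sumr_ge0 => e /andP[/s0 [? ?] _]; rewrite mulr_ge0 ?ler0n.
rewrite -[leRHS]s1 big_seq_cond [leRHS]big_seq_cond.
apply: ler_sum => e /andP[/s0 [e1 _] _]; rewrite ler_piMr //.
by case: (e.2 <= y)%R; rewrite /= ?ler01 ?lexx.
Qed.

Lemma fin_cdf_nd : {homo fin_cdf s : x y / x <= y}.
Proof.
move=> x y xy; rewrite !fin_cdf_ind big_seq_cond [X in _ <= X]big_seq_cond.
apply: ler_sum => e /andP[/s0 [e1 _] _]; rewrite ler_wpM2l // ler_nat.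
by have [h|h] := lerP e.2 x; [rewrite (le_trans h xy)|].
Qed.

Lemma fin_cdf_neg y : y < 0 -> fin_cdf s y = 0.
Proof.
move=> y0; rewrite fin_cdf_ind big_seq_cond big1 // => e /andP[/s0 [_ e2] _].
by rewrite leNgt (lt_le_trans y0 e2) mulr0.
Qed.

Lemma fin_cdf_layers x N : 0 < x -> (0 < N)%N ->
  (x * N%:R)^-1 * \sum_(j < N) fin_cdf s (level x N j)
    <= \sum_(e <- s) e.1 / (e.2 + x) <=
  (x * N%:R)^-1 * \sum_(j < N) fin_cdf s (level x N j) + (x * N%:R)^-1.
Proof.
move=> x0 N0.
have -> : (x * N%:R)^-1 * \sum_(j < N) fin_cdf s (level x N j) =
  \sum_(e <- s) e.1 * layers x N e.2.
  under eq_bigr do rewrite fin_cdf_ind.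
  rewrite exchange_big mulr_sumr; apply: eq_bigr => e _.
  by rewrite /layers -mulr_sumr mulrCA.
apply/andP; split; last first.
  have c1 : \sum_(e <- s) e.1 * (x * N%:R)^-1 = (x * N%:R)^-1.
    by rewrite -mulr_suml s1 mul1r.
  rewrite -[X in _ + X]c1 -big_split /=.
  rewrite big_seq_cond [leRHS]big_seq_cond; apply: ler_sum.
  move=> e /andP[/s0 [e1 e2] _]; rewrite -mulrDr ler_wpM2l //.
  by have /andP[] := layers_approx x0 e2 N0.
rewrite big_seq_cond [leRHS]big_seq_cond; apply: ler_sum.
move=> e /andP[/s0 [e1 e2] _]; rewrite ler_wpM2l //.
by have /andP[] := layers_approx x0 e2 N0.
Qed.

(** Atoms up to y contribute at most 1/y per unit of mass and those beyond y at most 1/(2y). The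
    transform at -y is thus at most (F(y) + 1) / (2y), and the hypothesis bounds it from below by
    1/(y + c). *)
Lemma fin_cdf_tight (c y : R) : 0 <= c -> 0 < y ->
  (y + c)^-1 <= \sum_(e <- s) e.1 / (e.2 + y) ->
  1 - 2 * c / y <= fin_cdf s y.
Proof.
move=> c0 y0 h.
have : \sum_(e <- s) e.1 / (e.2 + y) <= y^-1 * ((fin_cdf s y + 1) / 2).
  have -> : y^-1 * ((fin_cdf s y + 1) / 2) =
     \sum_(e <- s) e.1 * (y^-1 * (((e.2 <= y)%R%:R + 1) / 2)).
    transitivity (y^-1 * ((fin_cdf s y + \sum_(e <- s) e.1) / 2)).
      by rewrite s1.
    rewrite fin_cdf_ind -big_split /= mulr_suml mulr_sumr.
    by apply: eq_bigr => e _; ring.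
  rewrite big_seq_cond [leRHS]big_seq_cond; apply: ler_sum.
  move=> e /andP[/s0 [e1 e2] _]; rewrite ler_wpM2l //.
  have ey : 0 < e.2 + y by rewrite ltr_wpDl.
  rewrite -[(e.2 + y)^-1]mul1r ler_pdivrMr //.
  rewrite [leRHS](_ : _ = ((e.2 <= y)%R%:R + 1) / 2 * (e.2 + y) / y); last by ring.
  rewrite ler_pdivlMr // mul1r.
  by case: (lerP e.2 y) => h'; rewrite /= ?mulr1n ?mulr0n; lra.
move=> /(le_trans h); have yc : 0 < y + c by rewrite ltr_pwDl.
set F := fin_cdf s y; rewrite mulrC ler_pdivlMr // => {}h.
have e1 : 1 - c / y <= (y + c)^-1 * y.
  rewrite -[_^-1 * y]mulrC ler_pdivlMr //.
  have -> : (1 - c / y) * (y + c) = y - c ^+ 2 / y by field; rewrite gt_eqF.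
  by rewrite lerBlDr lerDl divr_ge0 ?sqr_ge0 // ltW.
have := le_trans e1 h; rewrite -mulrA; lra.
Qed.

End FinCdf.
End Helly.

(** * Complex integrals and transforms of probability measures *)

Section StieltjesMeasures.
Variable R : realType.
Local Notation C := R[i].
Local Notation nc := (@Normc.normc R).

Section ComplexIntegral.
Context d (T : measurableType d) (mu : {measure set T -> \bar R}) (D : set T).
Hypothesis mD : measurable D.
Implicit Types f g : T -> C.

Definition cintegrable f : Prop :=
  mu.-integrable D (fun t => (complex.Re (f t))%:E) /\
  mu.-integrable D (fun t => (complex.Im (f t))%:E).

Lemma cintegrable_bounded f (M : R) : (mu D < +oo)%E -> cmeasurable f ->
  (forall t, D t -> nc (f t) <= M) -> cintegrable f.
Proof.
move=> muD [f1 f2] fM.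
have bd (h : T -> R) : (forall t, D t -> `|h t| <= nc (f t)) ->
    [bounded h t | t in D].
  move=> hf; exists M; split; first exact: num_real.
  by move=> x Mx t Dt /=; apply: le_trans (hf t Dt) (le_trans (fM t Dt) (ltW Mx)).
split; apply: measurable_bounded_integrable => //.
- exact: measurable_funTS.
- by apply: bd => t _; exact: normc_Re.
- exact: measurable_funTS.
- by apply: bd => t _; exact: normc_Im.
Qed.

Lemma cintegralD f g : cintegrable f -> cintegrable g ->
  cintegrable (fun t => f t + g t) /\
  cintegral mu D (fun t => f t + g t) = cintegral mu D f + cintegral mu D g.
Proof.
move=> [f1 f2] [g1 g2].
have eR : (fun t => complex.Re (f t + g t)) =
    (fun t => complex.Re (f t) + complex.Re (g t)).
  by apply/funext => t; case: (f t) (g t) => [? ?] [? ?].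
have eI : (fun t => complex.Im (f t + g t)) =
    (fun t => complex.Im (f t) + complex.Im (g t)).
  by apply/funext => t; case: (f t) (g t) => [? ?] [? ?].
split; last by rewrite /cintegral eR eI !RintegralD.
split.
  rewrite (_ : (fun t => _) = (fun t => (complex.Re (f t))%:E) \+
    (fun t => (complex.Re (g t))%:E)); first exact: integrableD.
  by apply/funext => t /=; rewrite -EFinD (congr1 (fun h => h t) eR).
rewrite (_ : (fun t => _) = (fun t => (complex.Im (f t))%:E) \+
    (fun t => (complex.Im (g t))%:E)); first exact: integrableD.
by apply/funext => t /=; rewrite -EFinD (congr1 (fun h => h t) eI).
Qed.

Lemma cintegralZ (a : C) f : cintegrable f ->
  cintegrable (fun t => a * f t) /\
  cintegral mu D (fun t => a * f t) = a * cintegral mu D f.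
Proof.
case: a => a b [f1 f2].
have i1 c (h : T -> R) : mu.-integrable D (EFin \o h) ->
   mu.-integrable D (EFin \o (fun t => c * h t)).
  by move=> ih; apply: eq_integrable (integrableZl mD c ih).
have eR : (fun t => complex.Re ((a +i* b)%C * f t)) =
    (fun t => a * complex.Re (f t) - b * complex.Im (f t)).
  by apply/funext => t; case: (f t).
have eI : (fun t => complex.Im ((a +i* b)%C * f t)) =
    (fun t => a * complex.Im (f t) + b * complex.Re (f t)).
  by apply/funext => t; case: (f t).
split; last first.
  rewrite /cintegral eR eI RintegralB ?RintegralD ?RintegralZl //; try exact: i1.
split.
  rewrite (_ : (fun t => _) = ((EFin \o (fun t => a * complex.Re (f t))%R) \-
    (EFin \o (fun t => b * complex.Im (f t))%R))%E).
    by apply: integrableB => //; exact: i1.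
  by apply/funext => t /=; rewrite -EFinB (congr1 (fun h => h t) eR).
rewrite (_ : (fun t => _) = ((EFin \o (fun t => a * complex.Im (f t))%R) \+
    (EFin \o (fun t => b * complex.Re (f t))%R))%E).
  by apply: integrableD => //; exact: i1.
by apply/funext => t /=; rewrite -EFinD (congr1 (fun h => h t) eI).
Qed.

(** The factor 2 comes from bounding real and imaginary parts separately. It is harmless:
    [stieltjes_bound] only needs some constant common to all measures. *)
Lemma cintegral_le f (M : R) : mu D = 1%E -> cintegrable f ->
  (forall t, D t -> nc (f t) <= M) -> nc (cintegral mu D f) <= 2 * M.
Proof.
move=> muD [f1 f2] fM; apply: le_trans (normc_le_ReIm _) _.
have iM : mu.-integrable D (EFin \o (fun=> M)).
  apply/integrableP; split; first exact: measurable_cst.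
  by rewrite /= integral_cst // muD mule1 ltry.
have intM : \int[mu]_(t in D) M = M by rewrite Rintegral_cst // muD /= mulr1.
have bd (h : T -> R) : mu.-integrable D (EFin \o h) ->
    (forall t, D t -> `|h t| <= nc (f t)) -> `|\int[mu]_(t in D) h t| <= M.
  move=> ih hf; apply: le_trans (le_normr_Rintegral mD ih) _.
  rewrite -intM; apply: le_Rintegral => //; first exact: integrable_norm ih.
  by move=> t Dt; apply: le_trans (hf t Dt) (fM t Dt).
rewrite mulr_natl mulr2n lerD //=.
  by apply: bd f1 _ => t _; exact: normc_Re.
by apply: bd f2 _ => t _; exact: normc_Im.
Qed.

End ComplexIntegral.

Lemma measurable_nonneg_axis : measurable (@nonneg_axis R).
Proof. exact: measurable_itv. Qed.

Lemma nonneg_axisE (x : R) : nonneg_axis x = (0 <= x) :> Prop.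
Proof. by rewrite /nonneg_axis /= in_itv /= andbT. Qed.

Definition cauchy_kernel (z : C) (x : R) : C := (x%:C%C - z)^-1.

Lemma cmeasurable_cauchy z : cmeasurable (cauchy_kernel z).
Proof.
have h1 : cmeasurable (fun x : R => x%:C%C).
  exact: (cmeasurable_real (@measurable_id _ R setT)).
exact: (cmeasurableV (cmeasurableD h1 (cmeasurable_cst R (- z)))).
Qed.

Lemma cintegrable_cauchy (v : probability R R) z : v nonneg_axis = 1%E ->
  cut_plane z -> cintegrable v nonneg_axis (cauchy_kernel z).
Proof.
move=> v1 hz; have [dl dl0 hdl] := cut_plane_dist hz.
apply: (@cintegrable_bounded _ _ _ _ measurable_nonneg_axis _ dl^-1).
- by rewrite [X in (X < _)%E]v1 ltry.
- exact: cmeasurable_cauchy.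
- move=> x; rewrite nonneg_axisE => x0; rewrite Normc.normcV lef_pV2 ?posrE //.
    exact: hdl.
  exact: lt_le_trans (hdl _ x0).
Qed.

Lemma in_stieltjes_bound (f : C -> C) : in_stieltjes f -> stieltjes_bound 2 f.
Proof.
move=> [v [v1 fE]] s M hs hM.
have [i1 i2] : cintegrable v nonneg_axis
     (fun x => \sum_(e <- s) e.1 * cauchy_kernel e.2 x) /\
    cintegral v nonneg_axis (fun x => \sum_(e <- s) e.1 * cauchy_kernel e.2 x)
      = \sum_(e <- s) e.1 * f e.2.
  elim: s hs {hM} => [|e s IH] hs.
    under eq_fun do rewrite big_nil.
    have ez : v.-integrable nonneg_axis (fun=> 0%:E : \bar R) by exact: integrable0.
    split; first by split.
    by rewrite big_nil /cintegral Rintegral_cst ?mul0r //; exact: measurable_nonneg_axis.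
  under eq_fun do rewrite big_cons.
  have [h1 h2] := IH (fun a as_ => hs a (@mem_behead _ (e :: s) a as_)).
  have he : cut_plane e.2 := hs e (mem_head _ _).
  have [h3 h4] := cintegralZ measurable_nonneg_axis e.1 (cintegrable_cauchy v1 he).
  have [h5 h6] := cintegralD measurable_nonneg_axis h3 h1.
  by split=> //; rewrite h6 h4 h2 big_cons fE.
rewrite -i2; apply: cintegral_le => //; first exact: measurable_nonneg_axis.
by move=> x; rewrite nonneg_axisE => /hM.
Qed.

Lemma cauchy_kernel_neg (x l : R) :
  cauchy_kernel (- x%:C%C) l = ((l + x)^-1)%:C%C.
Proof. by rewrite /cauchy_kernel opprK -rmorphD fmorphV. Qed.

Lemma cintegral_cauchy_neg (v : probability R R) (x : R) :
  cintegral v nonneg_axis (cauchy_kernel (- x%:C%C)) =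
  (\int[v]_(l in nonneg_axis) (l + x)^-1)%:C%C.
Proof.
rewrite /cintegral; congr (_ +i* _)%C.
  by apply: eq_Rintegral => l _; rewrite cauchy_kernel_neg.
under eq_Rintegral do rewrite cauchy_kernel_neg.
by rewrite Rintegral_cst ?mul0r //; exact: measurable_nonneg_axis.
Qed.

Lemma neg_cut_plane (x : R) : 0 < x -> cut_plane (- x%:C%C).
Proof. by move=> x0; apply: Re_lt0_cut; rewrite /= oppr_lt0. Qed.

Lemma in_stieltjes_neg (f : C -> C) (x : R) : in_stieltjes f -> 0 < x ->
  0 <= f (- x%:C%C).
Proof.
move=> [v [v1 fE]] x0; rewrite fE; last exact: neg_cut_plane.
rewrite (cintegral_cauchy_neg v x) ler0c; apply: Rintegral_ge0 => l.
by rewrite nonneg_axisE => l0; rewrite invr_ge0 addr_ge0 // ltW.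
Qed.

Lemma fin_stieltjes_neg m (f : C -> C) (x : R) : fin_stieltjes m f -> 0 < x ->
  0 <= f (- x%:C%C).
Proof.
move=> [s [h1 _ h3]] x0; rewrite h3; last exact: neg_cut_plane.
rewrite big_seq_cond; apply: sumr_ge0 => e /andP[/h1 [e1 e2] _].
rewrite -[X in _ * X]/(cauchy_kernel _ _) cauchy_kernel_neg -rmorphM ler0c.
by rewrite divr_ge0 // addr_ge0 // ltW.
Qed.

End StieltjesMeasures.

(** * Helly selection for Stieltjes transforms *)

Section HellySelection.
Variable R : realType.
Local Notation C := R[i].
Local Notation nc := (@Normc.normc R).

Section MeasureLayers.
Variables (v : probability R R) (F : R -> R).
Hypotheses (vF : forall y, v `]-oo, y]%classic = (F y)%:E)
  (Fneg : forall y, y < 0 -> F y = 0).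

Lemma nonneg_axis_full : v nonneg_axis = 1%E.
Proof.
have neg0 : v `]-oo, 0[%classic = 0%E.
  have -> : `]-oo, 0[%classic = \bigcup_n `]-oo, - n.+1%:R^-1]%classic :> set R.
    apply/seteqP; split=> [y|y [n _]] /=; rewrite !in_itv /=.
      move=> y0; exists (Num.bound (- y)^-1) => //=; rewrite in_itv /=.
      rewrite lerNr -[leRHS]invrK lef_pV2 ?posrE ?invr_gt0 ?oppr_gt0 ?ltr0n //.
      apply: ltW; apply: lt_trans (archi_boundP _) _; last by rewrite ltr_nat.
      by rewrite invr_ge0 oppr_ge0 ltW.
    by move=> yn; apply: le_lt_trans yn _; rewrite oppr_lt0 invr_gt0 ltr0n.
  apply: measure_negligible; first by apply: bigcupT_measurable => n; exact: measurable_itv.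
  apply: negligible_bigcup => n; apply/negligibleP; first exact: measurable_itv.
  by apply: etrans (vF _) _; rewrite Fneg // oppr_lt0 invr_gt0 ltr0n.
have -> : nonneg_axis = ~` `]-oo, 0[%classic :> set R.
  apply/seteqP; split=> y; rewrite nonneg_axisE /= in_itv /=.
    by move=> y0; apply/negP; rewrite -leNgt.
  by move/negP; rewrite -leNgt.
by rewrite probability_setC ?neg0 ?sube0 //; exact: measurable_itv.
Qed.

Let v_axisI y : v (nonneg_axis `&` `]-oo, y]%classic) = (F y)%:E.
Proof.
have mI : measurable (`]-oo, y]%classic : set R) by exact: measurable_itv.
have mA := @measurable_nonneg_axis R.
have z : v (`]-oo, y]%classic `&` ~` nonneg_axis) = 0%E.
  apply/eqP; rewrite eq_le measure_ge0 andbT.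
  have <- : v (~` nonneg_axis) = 0%E.
    by rewrite probability_setC // nonneg_axis_full subee.
  apply: le_measure; rewrite ?inE; last by move=> ? [].
    by apply: measurableI => //; exact: measurableC.
  exact: measurableC.
rewrite setIC -vF -[LHS]adde0 -z -measureU.
- by rewrite -setIUr setUv setIT.
- exact: measurableI.
- by apply: measurableI => //; exact: measurableC.
- by apply/seteqP; split=> // ? [[_ ?] []].
Qed.

(** The sandwich of [fin_cdf_layers] for the limit measure. Transforms of both kinds are then
    compared through distribution functions at the same N levels. *)
Lemma cdf_layers (x : R) N : 0 < x -> (0 < N)%N ->
  (x * N%:R)^-1 * \sum_(j < N) F (level x N j)
    <= \int[v]_(l in nonneg_axis) (l + x)^-1 <=
  (x * N%:R)^-1 * \sum_(j < N) F (level x N j) + (x * N%:R)^-1.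
Proof.
move=> x0 N0; have mA := @measurable_nonneg_axis R.
have vA := nonneg_axis_full.
have ik : v.-integrable nonneg_axis (EFin \o (fun l : R => (l + x)^-1)).
  have [i1 _] := cintegrable_cauchy vA (neg_cut_plane x0).
  apply: eq_integrable i1 => // l _.
  by rewrite cauchy_kernel_neg.
have iind y : v.-integrable nonneg_axis (EFin \o (fun l : R => (l <= y)%R%:R : R)) /\
   \int[v]_(l in nonneg_axis) ((l <= y)%R%:R : R) = F y.
  have mI : measurable (`]-oo, y]%classic : set R) by exact: measurable_itv.
  have e : (fun l : R => (l <= y)%R%:R : R) = \1_(`]-oo, y]%classic).
    apply/funext => l; rewrite indicE; congr (nat_of_bool _)%:R.
    by apply/idP/idP; rewrite inE /= in_itv.
  rewrite e; split.
    by apply: (@integrableS _ _ _ v setT) => //; exact: integrable_indic.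
  by rewrite /Rintegral integral_indic // setIC; exact: (congr1 fine (v_axisI y)).
pose S l : R := \sum_(j < N) (l <= level x N j)%R%:R.
have iS : v.-integrable nonneg_axis (EFin \o S).
  rewrite (_ : EFin \o S = fun l => (\sum_(j < N) ((l <= level x N j)%R%:R : R)%:E)%E).
    by apply: integrable_sum => // j _; have [] := iind (level x N j).
  by apply/funext => l /=; rewrite sumEFin.
have intS : \int[v]_(l in nonneg_axis) S l = \sum_(j < N) F (level x N j).
  rewrite /Rintegral (_ : (fun l => (S l)%:E) =
    fun l => (\sum_(j < N) ((l <= level x N j)%R%:R : R)%:E)%E); last first.
    by apply/funext => l /=; rewrite sumEFin.
  rewrite integral_sum //; last by move=> j; have [] := iind (level x N j).
  rewrite -sum_fine; last first.
    by move=> j _; apply: integrable_fin_num => //; have [] := iind (level x N j).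
  by apply: eq_bigr => j _; have [_] := iind (level x N j).
have iL : v.-integrable nonneg_axis (EFin \o layers x N).
  by apply: eq_integrable (integrableZl mA (x * N%:R)^-1 iS).
have intL : \int[v]_(l in nonneg_axis) layers x N l =
   (x * N%:R)^-1 * \sum_(j < N) F (level x N j).
  by rewrite -intS -RintegralZl.
rewrite -intL; apply/andP; split.
  apply: le_Rintegral => // l; rewrite nonneg_axisE => l0.
  by have /andP[] := layers_approx x0 l0 N0.
have ic : v.-integrable nonneg_axis (EFin \o (fun=> (x * N%:R)^-1)).
  exact: finite_measure_integrable_cst.
have intc : \int[v]_(l in nonneg_axis) (x * N%:R)^-1 = (x * N%:R)^-1.
  by rewrite Rintegral_cst // [X in _ * fine X]vA mulr1.
rewrite -[X in _ + X]intc -RintegralD //; apply: le_Rintegral => //.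
  by apply: eq_integrable (integrableD mA iL ic).
move=> l; rewrite nonneg_axisE => l0.
by have /andP[] := layers_approx x0 l0 N0.
Qed.
End MeasureLayers.

Lemma level_lt (x : R) N j : 0 < x -> (0 < N)%N -> level x N j.+1 < level x N j.
Proof.
move=> x0 N0; rewrite /level ltrD2r ltr_pM2l ?mulr_gt0 ?ltr0n //.
by rewrite ltf_pV2 ?posrE ?ltr0n // ltr_nat.
Qed.

Lemma fin_stieltjes_cdf (f : C -> C) : fin_stieltjes 1 f -> exists s : seq (R * R),
  [/\ forall e, e \in s -> 0 <= e.1 /\ 0 <= e.2, \sum_(e <- s) e.1 = 1
   & forall x, 0 < x -> f (- x%:C%C) = (\sum_(e <- s) e.1 / (e.2 + x))%:C%C].
Proof.
move=> [s [h1 h2 h3]]; exists s; split=> // x x0.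
rewrite h3; last exact: neg_cut_plane.
rewrite rmorph_sum /=; apply: eq_bigr => e _.
by rewrite -[X in _ * X]/(cauchy_kernel _ _) cauchy_kernel_neg -rmorphM.
Qed.

(* Tightness is expressed through the transforms: the bound below is the value
   at -x of the Dirac mass at c. *)
Lemma helly_stieltjes (U : set_system nat) (f : nat -> C -> C) (c : R) :
  UltraFilter U -> (forall k, fin_stieltjes 1 (f k)) -> 0 <= c ->
  (forall k x, 0 < x -> ((x + c)^-1)%:C%C <= f k (- x%:C%C)) ->
  exists g : C -> C, in_stieltjes g /\
    forall x : R, 0 < x -> cnull U (fun k => f k (- x%:C%C) - g (- x%:C%C)).
Proof.
move=> UU hf c0 tight.
have /choice [s hs] k := fin_stieltjes_cdf (hf k).
pose Fk k y := fin_cdf (s k) y.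
have Fk01 k y : 0 <= Fk k y <= 1 by have [h1 h2 _] := hs k; exact: fin_cdf01.
have /choice [G hG] y := ultra_lim UU (fun k => Fk01 k y).
have G01 y : 0 <= G y <= 1.
  apply/andP; split.
    apply: cvgr_to_ge (hG y) _; apply: filterE => k.
    by have /andP[] := Fk01 k y.
  apply: cvgr_to_le (hG y) _; apply: filterE => k.
  by have /andP[] := Fk01 k y.
have Gnd : {homo G : x y / x <= y}.
  move=> x y xy; apply: ler_cvg_to (hG x) (hG y) _; apply: filterE => k.
  by have [h1 h2 _] := hs k; exact: fin_cdf_nd.
have G0 y : 0 <= G y by have /andP[] := G01 y.
have Gneg y : y < 0 -> G y = 0.
  move=> y0; apply: cvg_unique (hG y) _ => //.
  rewrite (_ : (fun k => _) = fun=> 0); first exact: cvg_cst.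
  by apply/funext => k; have [h1 h2 _] := hs k; exact: fin_cdf_neg.
have Gtight y : 0 < y -> 1 - 2 * c / y <= G y.
  move=> y0; apply: cvgr_to_ge (hG y) _; apply: filterE => k.
  have [h1 h2 h3] := hs k; apply: fin_cdf_tight => //.
  by have := tight k y y0; rewrite h3 // lecR.
pose F := right_reg G.
have Fge y : G y <= F y by exact: right_reg_ge.
have Fle y r : y < r -> F y <= G r by exact: right_reg_le.
have F1 y : F y <= 1.
  by apply: le_trans (Fle y (y + 1) _) _; rewrite ?ltrDl //; have /andP[] := G01 (y + 1).
have F0 y : 0 <= F y by exact: le_trans (G0 y) (Fge y).
have Fneg y : y < 0 -> F y = 0.
  move=> y0; apply: le_anti; rewrite F0 andbT -(Gneg (y / 2)); last by lra.
  by apply: Fle; lra.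
have FNy : F @ -oo --> (0 : R).
  apply: cvg_near_cst; near=> y; apply: Fneg; near: y; exact: nbhs_ninfty_lt.
have Fy : F @ +oo --> (1 : R).
  apply/cvgrPdist_le => e e0; near=> y.
  have y0 : 0 < y by near: y; exact: nbhs_pinfty_gt.
  rewrite ger0_norm ?subr_ge0 // lerBlDl -lerBlDr.
  apply: le_trans (Fge y); apply: le_trans (Gtight y y0).
  rewrite lerD2l lerN2 ler_pdivrMr // -ler_pdivrMl //.
have [v vF] := probability_of_cdf (right_reg_nd G0) (right_reg_rc G0) FNy Fy.
exists (fun z => cintegral v nonneg_axis (cauchy_kernel z)); split.
  by exists v; split=> //; exact: (nonneg_axis_full vF Fneg).
move=> x x0 e e0.
(* The layer approximations and the passage from G to F each cost a multiple of q = 1/(x N). The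
   total stays within 4 q, so N is chosen to make this less than e. *)
pose N := (Num.bound (4 / (x * e))).+1.
have xe : 0 < x * e by rewrite mulr_gt0.
have N0 : (0 < N)%N by [].
have NR : 0 < N%:R :> R by rewrite ltr0n.
pose q := (x * N%:R)^-1.
have q0 : 0 < q by rewrite invr_gt0 mulr_gt0.
have qe : 4 * q < e.
  have : 4 / (x * e) < N%:R.
    apply: lt_trans (archi_boundP _) _; last by rewrite ltr_nat.
    by rewrite divr_ge0 // ltW.
  rewrite ltr_pdivrMr // mulrA (mulrC N%:R) => h.
  by rewrite /q ltr_pdivrMr ?mulr_gt0 // mulrC.
have FG : \sum_(j < N) G (level x N j) <= \sum_(j < N) F (level x N j) <=
   \sum_(j < N) G (level x N j) + 1.
  apply/andP; split; first by apply: ler_sum => j _.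
  have h1 : \sum_(j < N) F (level x N j) =
      F (level x N 0) + \sum_(j < N.-1) F (level x N j.+1).
    by rewrite [in LHS]big_ord_recl.
  have h2 : \sum_(j < N) G (level x N j) =
      \sum_(j < N.-1) G (level x N j) + G (level x N N.-1).
    by rewrite [in LHS]big_ord_recr.
  have h3 : \sum_(j < N.-1) F (level x N j.+1) <= \sum_(j < N.-1) G (level x N j).
    by apply: ler_sum => j _; apply: Fle; exact: level_lt.
  have := F1 (level x N 0); have := G0 (level x N N.-1); rewrite h1 h2; lra.
have sumcvg : cnull U (fun k => (\sum_(j < N) Fk k (level x N j) -
    \sum_(j < N) G (level x N j))%:C%C).
  rewrite (_ : (fun k => _) = fun k => \sum_(j < N)
     (Fk k (level x N j) - G (level x N j))%:C%C); last first.
    by apply/funext => k; rewrite -sumrB rmorph_sum.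
  apply: cnull_sum => j e1 e10.
  have /cvgrPdist_lt /(_ e1 e10) := hG (level x N j); apply: filterS => k.
  by rewrite normc_real distrC.
apply: filterS (sumcvg 1 ltr01) => k; rewrite normc_real ltr_norml => /andP[l1 l2].
have [h1 h2 h3] := hs k; rewrite h3 // cintegral_cauchy_neg -rmorphB normc_real.
have /andP[r1 r2] := fin_cdf_layers h1 h2 x0 N0.
have /andP[i1 i2] := cdf_layers vF Fneg x0 N0.
move: FG l1 l2 r1 r2 i1 i2; rewrite -/q -/(Fk k).
set A := \sum_(j < N) fin_cdf (s k) _; set B := \sum_(j < N) G _.
set D := \sum_(j < N) F _; rewrite -/A => /andP[f1 f2] l1 l2 r1 r2 i1 i2.
have e1 : q * B <= q * A + q by rewrite -[X in _ + X]mulr1 -mulrDr ler_pM2l //; lra.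
have e2 : q * A <= q * B + q by rewrite -[X in _ + X]mulr1 -mulrDr ler_pM2l //; lra.
have e3 : q * B <= q * D by rewrite ler_pM2l.
have e4 : q * D <= q * B + q by rewrite -[X in _ + X]mulr1 -mulrDr ler_pM2l.
by apply: le_lt_trans qe; rewrite ler_norml; apply/andP; split; lra.
Unshelve. all: by end_near.
Qed.

End HellySelection.

(** * Existence and uniqueness of the solution of the system *)

Section System.
Variable R : realType.
Local Notation C := R[i].
Local Notation nc := (@Normc.normc R).

(* One half of the fixed-point map: the row equations for the variance profile
   V, and the column equations for its transpose. *)
Definition smap (m k : nat) (V : 'I_m -> 'I_k -> R) (u : 'I_k -> C) (z : C)
    (i : 'I_m) : C :=
  -1 / (z * (1 + \sum_j (V i j)%:C%C * u j)).

Lemma normc_le1 (a : C) : 0 <= a -> 1 <= nc (1 + a).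
Proof.
move=> a0; rewrite -lecR -[(nc _)%:C%C]normcE ger0_norm ?addr_ge0 //.
by rewrite lerDl.
Qed.

(** For nonnegative a and b the moduli of 1 + a and 1 + b are at least 1, so only the factor 1/x
    survives. *)
Lemma inv_contract (x : R) (a b : C) : 0 < x -> 0 <= a -> 0 <= b ->
  nc (-1 / (- x%:C%C * (1 + a)) - -1 / (- x%:C%C * (1 + b)))
    <= x^-1 * nc (a - b).
Proof.
move=> x0 a0 b0.
have xn : x%:C%C != 0 :> C by rewrite fmorph_eq0 gt_eqF.
have an : 1 + a != 0 by rewrite gt_eqF // ltr_pwDl.
have bn : 1 + b != 0 by rewrite gt_eqF // ltr_pwDl.
have -> : -1 / (- x%:C%C * (1 + a)) - -1 / (- x%:C%C * (1 + b)) =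
   (x%:C%C)^-1 * ((b - a) * ((1 + a)^-1 * (1 + b)^-1)).
  by field; rewrite xn an bn.
rewrite Normc.normcM Normc.normcV normc_real gtr0_norm //.
rewrite ler_pM2l ?invr_gt0 // Normc.normcM normc_distC ler_piMr ?normc_ge0 //.
rewrite Normc.normcM !Normc.normcV mulr_ile1 ?invr_ge0 ?normc_ge0 //.
  by rewrite invf_le1 ?normc_le1 // (lt_le_trans ltr01) ?normc_le1.
by rewrite invf_le1 ?normc_le1 // (lt_le_trans ltr01) ?normc_le1.
Qed.

Section HalfMap.
Variables (m k : nat) (V : 'I_m -> 'I_k -> R) (W : R).
Hypotheses (V0 : forall i j, 0 <= V i j) (VW : forall j, \sum_i V i j <= W).

Lemma Vsum_ge0 (u : 'I_k -> C) i : (forall j, 0 <= u j) ->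
  0 <= \sum_j (V i j)%:C%C * u j.
Proof. by move=> u0; apply: sumr_ge0 => j _; rewrite mulr_ge0 // ler0c. Qed.

(** [e] is the defect of an approximate solution: it vanishes for the contraction property and is a
    random error for resolvents. The l1 norm turns the column sums of V into the Lipschitz constant
    and accepts defects that are small on average only. *)
Lemma smap_pert (x : R) (u u' : 'I_k -> C) (e : 'I_m -> C) : 0 < x ->
  (forall j, 0 <= u' j) ->
  (forall i, 0 <= \sum_j (V i j)%:C%C * u j + e i) ->
  \sum_i nc (-1 / (- x%:C%C * (1 + (\sum_j (V i j)%:C%C * u j + e i)))
     - smap V u' (- x%:C%C) i)
  <= x^-1 * (\sum_i nc (e i) + W * \sum_j nc (u j - u' j)).
Proof.
move=> x0 u'0 ue.
apply: le_trans (_ : \sum_i x^-1 * (nc (e i) + \sum_j V i j * nc (u j - u' j)) <= _).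
  apply: ler_sum => i _; rewrite /smap.
  apply: le_trans (inv_contract x0 (ue i) (Vsum_ge0 i u'0)) _.
  rewrite ler_pM2l ?invr_gt0 // addrAC -sumrB addrC.
  apply: le_trans (normc_triangle _ _) _; rewrite lerD2l.
  apply: le_trans (normc_sum _ _ _) _; apply: ler_sum => j _.
  by rewrite -mulrBr Normc.normcM normc_real ger0_norm.
rewrite -mulr_sumr ler_pM2l ?invr_gt0 // big_split lerD2l /=.
rewrite exchange_big /= mulr_sumr; apply: ler_sum => j _.
by rewrite -mulr_suml ler_wpM2r ?normc_ge0.
Qed.

Lemma smap_contract (x : R) (u u' : 'I_k -> C) : 0 < x ->
  (forall j, 0 <= u j) -> (forall j, 0 <= u' j) ->
  \sum_i nc (smap V u (- x%:C%C) i - smap V u' (- x%:C%C) i)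
  <= x^-1 * (W * \sum_j nc (u j - u' j)).
Proof.
move=> x0 u0 u'0; have := @smap_pert x u u' (fun=> 0) x0 u'0.
rewrite [X in _ * (X + _)]big1 ?add0r; last by move=> i _; exact: Normc.normc0.
move=> h; apply: le_trans (h _); last by move=> i; rewrite addr0 Vsum_ge0.
by apply: ler_sum => i _; rewrite addr0.
Qed.

Lemma smap_fin_stieltjes (u : 'I_k -> C -> C) i :
  (forall j, fin_stieltjes 1 (u j)) ->
  fin_stieltjes 1 (fun z => smap V (u ^~ z) z i).
Proof.
move=> hu; apply: (@fin_stieltjes_step _ (\sum_j V i j * 1)).
by apply: fin_stieltjes_sum => j; exact: fin_stieltjesZ.
Qed.

Lemma smap_eq (u : 'I_k -> C -> C) i z : (forall j, fin_stieltjes 1 (u j)) ->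
  cut_plane z ->
  smap V (u ^~ z) z i * (z * (1 + \sum_j (V i j)%:C%C * u j z)) = -1.
Proof.
move=> hu hz; rewrite /smap divfK // mulf_neq0 ?(cut_plane_neq0 hz) //.
have h : fin_stieltjes (\sum_j V i j * 1) (fun z => \sum_j (V i j)%:C%C * u j z).
  by apply: fin_stieltjes_sum => j; exact: fin_stieltjesZ.
exact: fin_stieltjes_neq h hz.
Qed.

End HalfMap.

Lemma fin_stieltjes_bound_neg (f : C -> C) (x : R) : fin_stieltjes 1 f -> 0 < x ->
  f (- x%:C%C) <= (x^-1)%:C%C.
Proof.
move=> /fin_stieltjes_cdf [s [h1 h2 h3]] x0; rewrite h3 // lecR.
rewrite -[leRHS]mul1r -h2 mulr_suml big_seq_cond [leRHS]big_seq_cond.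
apply: ler_sum => e /andP[/h1 [e1 e2] _]; rewrite ler_wpM2l //.
by rewrite lef_pV2 ?posrE ?lerDr // ltr_wpDl.
Qed.

Lemma stieltjes_bounded K (f : C -> C) z : stieltjes_bound K f -> cut_plane z ->
  exists B : R, nc (f z) <= B /\ forall g, stieltjes_bound K g -> nc (g z) <= B.
Proof.
move=> hf hz; have [dl dl0 hdl] := cut_plane_dist hz.
have h g : stieltjes_bound K g -> nc (g z) <= K * dl^-1.
  move=> hg; have := hg [:: (1, z)] dl^-1; rewrite big_seq1 mul1r; apply.
    by move=> e; rewrite inE => /eqP ->.
  move=> l l0; rewrite big_seq1 /= mul1r Normc.normcV lef_pV2 ?posrE ?hdl //.
  exact: lt_le_trans (hdl _ l0).
by exists (K * dl^-1); split; first exact: h.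
Qed.

(** Because x u_j <= 1, the denominator is at most x + c. This is the tightness hypothesis of
    [helly_stieltjes]. *)
Lemma smap_lower m k (V : 'I_m -> 'I_k -> R) (c x : R) (u : 'I_k -> C) i :
  (forall j, 0 <= V i j) -> \sum_j V i j <= c -> 0 < x ->
  (forall j, 0 <= u j) -> (forall j, u j <= (x^-1)%:C%C) ->
  ((x + c)^-1)%:C%C <= smap V u (- x%:C%C) i.
Proof.
move=> V0 Vc x0 u0 u1; rewrite /smap mulN1r mulNr invrN opprK.
have s0 : 0 <= \sum_j (V i j)%:C%C * u j.
  by apply: sumr_ge0 => j _; rewrite mulr_ge0 // ler0c.
have c0 : 0 <= c by apply: le_trans Vc; exact: sumr_ge0.
have xc : 0 < x + c by rewrite ltr_pwDl.
rewrite fmorphV lef_pV2 ?posrE ?ltcR //; last first.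
  by rewrite mulr_gt0 ?ltcR // ltr_pwDl.
rewrite rmorphD mulrDr mulr1 lerD2l.
apply: le_trans (_ : x%:C%C * \sum_j (V i j)%:C%C * (x^-1)%:C%C <= _).
  rewrite ler_pM2l ?ltcR //; apply: ler_sum => j _.
  by rewrite ler_wpM2l // ler0c.
rewrite -mulr_suml mulrCA -rmorphM divff ?gt_eqF // mulr1.
by rewrite -rmorph_sum lecR.
Qed.

Section Solution.
Variables (p n : nat) (V : 'I_p -> 'I_n -> R) (W : R).
Hypotheses (V0 : forall i j, 0 <= V i j) (VW : forall j, \sum_i V i j <= W)
  (VW' : forall i, \sum_j V i j <= W).
Let Vt (j : 'I_n) (i : 'I_p) := V i j.
Let Vt0 j i : 0 <= Vt j i. Proof. exact: V0. Qed.
Let VtW j : \sum_i Vt i j <= W. Proof. exact: VW'. Qed.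

Definition system_eq (t : 'I_p -> C -> C) (u : 'I_n -> C -> C) : Prop :=
  forall z, cut_plane z -> (forall i, t i z = smap V (u ^~ z) z i) /\
    (forall j, u j z = smap Vt (t ^~ z) z j).

(** The starting value -1/z is the transform of the Dirac mass at 0. *)
Fixpoint iterates (N : nat) : ('I_p -> C -> C) * ('I_n -> C -> C) :=
  if N is N'.+1 then
    let tu := iterates N' in
    (fun i z => smap V (tu.2 ^~ z) z i, fun j z => smap Vt (tu.1 ^~ z) z j)
  else (fun _ z => 1%:C%C / (0%:C%C - z), fun _ z => 1%:C%C / (0%:C%C - z)).

Lemma iterates_fin N : (forall i, fin_stieltjes 1 ((iterates N).1 i)) /\
  (forall j, fin_stieltjes 1 ((iterates N).2 j)).
Proof.
elim: N => [|N [h1 h2]] /=; last first.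
  by split=> i; apply: smap_fin_stieltjes.
have h : fin_stieltjes 1 (fun z : C => 1%:C%C / (0%:C%C - z)).
  exists [:: (1, 0)]; split.
  - by move=> e; rewrite inE => /eqP -> /=; split.
  - by rewrite big_seq1.
  - by move=> z _; rewrite big_seq1.
by split.
Qed.

Let gap (x : R) (a b : ('I_p -> C -> C) * ('I_n -> C -> C)) : R :=
  \sum_i nc (a.1 i (- x%:C%C) - b.1 i (- x%:C%C)) +
  \sum_j nc (a.2 j (- x%:C%C) - b.2 j (- x%:C%C)).

Let gap_ge0 x a b : 0 <= gap x a b.
Proof. by rewrite addr_ge0 // sumr_ge0 // => k _; exact: normc_ge0. Qed.

Let gap1 x a b i : nc (a.1 i (- x%:C%C) - b.1 i (- x%:C%C)) <= gap x a b.
Proof.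
rewrite /gap (bigD1 i) //= -addrA lerDl addr_ge0 // sumr_ge0 // => k _;
exact: normc_ge0.
Qed.

Let gap2 x a b j : nc (a.2 j (- x%:C%C) - b.2 j (- x%:C%C)) <= gap x a b.
Proof.
rewrite /gap (bigD1 j) //= addrCA lerDl addr_ge0 // sumr_ge0 // => k _;
exact: normc_ge0.
Qed.

Let gap_half x (t t' : 'I_p -> C) (u u' : 'I_n -> C) : 0 < x -> 2 * W <= x ->
  (forall i, 0 <= t i) -> (forall i, 0 <= t' i) ->
  (forall j, 0 <= u j) -> (forall j, 0 <= u' j) ->
  \sum_i nc (smap V u (- x%:C%C) i - smap V u' (- x%:C%C) i) +
  \sum_j nc (smap Vt t (- x%:C%C) j - smap Vt t' (- x%:C%C) j) <=
  2^-1 * (\sum_i nc (t i - t' i) + \sum_j nc (u j - u' j)).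
Proof.
move=> x0 Wx t0 t'0 u0 u'0.
have h1 := smap_contract V0 VW x0 u0 u'0.
have h2 := smap_contract Vt0 VtW x0 t0 t'0.
have xW : x^-1 * W <= 2^-1.
  by rewrite mulrC ler_pdivrMr // mulrC ler_pdivlMr // mulrC.
have a0 : 0 <= \sum_i nc (t i - t' i) by apply: sumr_ge0 => i _; exact: normc_ge0.
have b0 : 0 <= \sum_j nc (u j - u' j) by apply: sumr_ge0 => i _; exact: normc_ge0.
apply: le_trans (lerD h1 h2) _; rewrite !mulrA -mulrDr addrC.
by apply: ler_wpM2r => //; rewrite addr_ge0.
Qed.

Lemma iterates_gap x N : 0 < x -> 2 * W <= x ->
  gap x (iterates N.+1) (iterates N) <=
  2^-1 ^+ N * gap x (iterates 1) (iterates 0).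
Proof.
move=> x0 Wx; elim: N => [|N IH]; first by rewrite expr0 mul1r.
rewrite exprS -mulrA; apply: le_trans (_ : 2^-1 * gap x (iterates N.+1) (iterates N) <= _).
  have [h1 h2] := iterates_fin N.+1; have [h3 h4] := iterates_fin N.
  by apply: gap_half => // k; apply: fin_stieltjes_neg; eauto.
by rewrite ler_pM2l // invr_gt0.
Qed.


Lemma iterates_lower x N : 0 < x -> 0 <= W ->
  (forall i, ((x + W)^-1)%:C%C <= (iterates N).1 i (- x%:C%C)) /\
  (forall j, ((x + W)^-1)%:C%C <= (iterates N).2 j (- x%:C%C)).
Proof.
move=> x0 W0; case: N => [|N].
  have h : ((x + W)^-1)%:C%C <= 1%:C%C / (0%:C%C - (- x%:C%C)) :> C.
    rewrite opprK -rmorphD add0r rmorph1 mul1r -fmorphV lecR.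
    by rewrite lef_pV2 ?posrE ?lerDl // ltr_wpDr.
  by split.
have [h1 h2] := iterates_fin N.
split=> i; apply: smap_lower => //; try exact: VW; move=> k;
  by [exact: fin_stieltjes_neg | exact: fin_stieltjes_bound_neg].
Qed.

Definition mean k (f : 'I_k -> C -> C) (z : C) : C := k%:R^-1 * \sum_i f i z.

Lemma fin_stieltjes_mean k (f : 'I_k -> C -> C) : (0 < k)%N ->
  (forall i, fin_stieltjes 1 (f i)) -> fin_stieltjes 1 (mean f).
Proof.
move=> k0 hf; have := fin_stieltjes_sum hf.
move=> /(@fin_stieltjesZ _ _ _ k%:R^-1); rewrite invr_ge0 ler0n => /(_ isT).
rewrite sumr_const card_ord mulVf ?pnatr_eq0 -?lt0n //.
by apply: fin_stieltjes_ext => z _; rewrite fmorphV /= rmorph_nat.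
Qed.

(* The iterates are compact by Helly, and at -x they form a geometric sequence
   for x >= 2W; hence consecutive iterates have the same limits everywhere. *)
Theorem system_exists : (0 < p)%N -> (0 < n)%N ->
  exists (t : 'I_p -> C -> C) (u : 'I_n -> C -> C),
  [/\ (forall i, in_stieltjes (t i)) /\ (forall j, in_stieltjes (u j)),
      system_eq t u, in_stieltjes (mean t) & in_stieltjes (mean u)].
Proof.
move=> p0 n0.
have W0 : 0 <= W by apply: le_trans (VW' (Ordinal p0)); exact: sumr_ge0.
(* A single ultrafilter finer than the filter at infinity makes the limits of all p + n coordinates
   and of their means compatible. *)
have [U [UU infU]] := @ultraFilterLemma nat \oo _.
pose T N i := (iterates N).1 i; pose S N j := (iterates N).2 j.
have hT N i : fin_stieltjes 1 (T N i) by have [h _] := iterates_fin N; exact: h.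
have hS N j : fin_stieltjes 1 (S N j) by have [_ h] := iterates_fin N; exact: h.
have lim (f : nat -> C -> C) : (forall N, fin_stieltjes 1 (f N)) ->
   (forall N x, 0 < x -> ((x + W)^-1)%:C%C <= f N (- x%:C%C)) ->
   exists g : C -> C, in_stieltjes g /\
     forall z, cut_plane z -> cnull U (fun N => f N z - g z).
  move=> hf lf; have [g [hg fg]] := helly_stieltjes UU hf W0 lf.
  exists g; split=> //; apply: (@stieltjes_determined R _ U _
      (fun N z => f N z - g z) (1 + 2) _ 1) => [N|m i m1].
    exact: stieltjes_boundB (fin_stieltjes_bound (hf N)) (in_stieltjes_bound hg).
  by apply: fg; rewrite ltr_wpDr ?invr_ge0 ?ler0n // (lt_le_trans ltr01).
have /choice [t ht] i : exists g : C -> C, in_stieltjes g /\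
    forall z, cut_plane z -> cnull U (fun N => T N i z - g z).
  by apply: lim => // N x x0; have [h _] := iterates_lower N x0 W0; exact: h.
have /choice [u hu] j : exists g : C -> C, in_stieltjes g /\
    forall z, cut_plane z -> cnull U (fun N => S N j z - g z).
  by apply: lim => // N x x0; have [_ h] := iterates_lower N x0 W0; exact: h.
have geo x : 0 < x -> 2 * W <= x ->
    (2^-1 ^+ N * gap x (iterates 1) (iterates 0)) @[N --> \oo] --> (0 : R).
  move=> x0 Wx; rewrite -[X in _ --> X](mul0r (gap x (iterates 1) (iterates 0))).
  apply: cvgM; last exact: cvg_cst.
  apply: cvg_expr.
  by rewrite ger0_norm ?invr_ge0 // invf_lt1 // ltr1n.
have cU (f : nat -> C) : cnull \oo f -> cnull U f.
  by move=> hf e e0; apply: infU; exact: hf.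
have shift (f : nat -> C -> C) : (forall N, fin_stieltjes 1 (f N)) ->
   (forall N x, 0 < x -> 2 * W <= x -> nc (f N.+1 (- x%:C%C) - f N (- x%:C%C)) <=
      gap x (iterates N.+1) (iterates N)) ->
   forall z, cut_plane z -> cnull U (fun N => f N.+1 z - f N z).
  move=> hf fg; apply: (@stieltjes_determined R _ U _
      (fun N z => f N.+1 z - f N z) (1 + 1) _ (2 * W + 1)) => [N|m i m1].
    by apply: stieltjes_boundB; exact: fin_stieltjes_bound.
  have iv : (0 : R) <= i.+1%:R^-1 by rewrite invr_ge0 ler0n.
  have x0 : 0 < m%:R + i.+1%:R^-1 :> R by move: iv m1; move: (_^-1) (m%:R) => a b; lra.
  have Wx : 2 * W <= m%:R + i.+1%:R^-1 by move: iv m1; move: (_^-1) (m%:R) => a b; lra.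
  apply: cU; apply: (cnull_real _ (geo _ x0 Wx)) => N.
  by apply: le_trans (fg N _ x0 Wx) _; exact: iterates_gap.
have shiftT i z : cut_plane z -> cnull U (fun N => T N.+1 i z - T N i z).
  apply: (shift (fun N => T N i)) => // N x x0 Wx.
  exact: (gap1 x (iterates N.+1) (iterates N)).
have shiftS j z : cut_plane z -> cnull U (fun N => S N.+1 j z - S N j z).
  apply: (shift (fun N => S N j)) => // N x x0 Wx.
  exact: (gap2 x (iterates N.+1) (iterates N)).
(* The limit is taken in the equation multiplied out, A X = -1, so no lower bound on the
   denominators is required. The limit equation itself shows that X0 is nonzero. *)
have limit_eq (A : nat -> C) (a : C) m (Y : 'I_m -> R) (B : nat -> 'I_m -> C)
   (b : 'I_m -> C) z K : (forall N, nc (A N) <= K) ->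
   cnull U (fun N => A N.+1 - A N) -> cnull U (fun N => A N - a) ->
   (forall j, cnull U (fun N => B N j - b j)) ->
   (forall N, A N.+1 * (z * (1 + \sum_j (Y j)%:C%C * B N j)) = -1) ->
   a = -1 / (z * (1 + \sum_j (Y j)%:C%C * b j)).
  move=> AK AA Aa Bb E; pose X N := z * (1 + \sum_j (Y j)%:C%C * B N j).
  pose X0 := z * (1 + \sum_j (Y j)%:C%C * b j).
  have XX : cnull U (fun N => X N - X0).
    rewrite (_ : (fun N => _) =
      fun N => z * \sum_j (Y j)%:C%C * (B N j - b j)).
      by apply: cnullZ; apply: cnull_sum => j; exact: cnullZ.
    apply/funext => N; rewrite /X /X0 -mulrBr opprD addrACA subrr add0r -sumrB.
    by congr (_ * _); apply: eq_bigr => j _; rewrite mulrBr.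
  have h : cnull U (fun _ : nat => -1 - a * X0).
    rewrite (_ : (fun _ : nat => _) = fun N => A N.+1 * (X N - X0) +
        X0 * ((A N.+1 - A N) + (A N - a))); last first.
      by apply/funext => N; rewrite -(E N) -/(X N); ring.
    apply: cnullD; first by apply: (@cnullM _ _ _ _ _ _ K).
    by apply: cnullZ; exact: cnullD.
  have aX : -1 = a * X0 by apply/eqP; rewrite -subr_eq0; apply/eqP; exact: cnull_cst h.
  have X00 : X0 != 0.
    by apply/eqP => X00; move: aX; rewrite X00 mulr0 => /eqP; rewrite oppr_eq0 oner_eq0.
  by rewrite -/X0 aX mulfK.
have sys : system_eq t u.
  move=> z hz; split=> [i|j].
    have [B [_ hB]] := stieltjes_bounded (fin_stieltjes_bound (hT 0%N i)) hz.
    apply: (limit_eq (fun N => T N i z) _ _ (V i) (fun N j => S N j z) _ z B).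
    - by move=> N; apply: hB; exact: fin_stieltjes_bound.
    - exact: shiftT.
    - by have [_ h] := ht i; exact: h.
    - by move=> j; have [_] := hu j; apply.
    - by move=> N; exact: (smap_eq V0 i (hS N) hz).
  have [B [_ hB]] := stieltjes_bounded (fin_stieltjes_bound (hS 0%N j)) hz.
  apply: (limit_eq (fun N => S N j z) _ _ (Vt j) (fun N i => T N i z) _ z B).
  - by move=> N; apply: hB; exact: fin_stieltjes_bound.
  - exact: shiftS.
  - by have [_ h] := hu j; exact: h.
  - by move=> i; have [_] := ht i; apply.
  - by move=> N; exact: (smap_eq Vt0 j (hT N) hz).
(* Instead of averaging the limit measures, Helly is applied to the means of the iterates, and
   uniqueness of limits identifies the result. *)
have mean_lim k (f : nat -> 'I_k -> C -> C) (g : 'I_k -> C -> C) : (0 < k)%N ->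
   (forall N i, fin_stieltjes 1 (f N i)) ->
   (forall N i x, 0 < x -> ((x + W)^-1)%:C%C <= f N i (- x%:C%C)) ->
   (forall i z, cut_plane z -> cnull U (fun N => f N i z - g i z)) ->
   in_stieltjes (mean g).
  move=> k0 hf lf fg.
  have [h [[v [v1 hE]] mh]] : exists g : C -> C, in_stieltjes g /\
     forall z, cut_plane z -> cnull U (fun N => mean (f N) z - g z).
    apply: lim => [N|N x x0]; first exact: fin_stieltjes_mean.
    rewrite /mean mulrC ler_pdivlMr ?ltr0n // mulr_natr -[X in _ *+ X](card_ord k).
    by rewrite -sumr_const; apply: ler_sum => i _; exact: lf.
  exists v; split=> // z hz; rewrite -hE //.
  have mg : cnull U (fun N => mean (f N) z - mean g z).
    rewrite (_ : (fun N => _) = fun N => k%:R^-1 * \sum_i (f N i z - g i z)).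
      by apply: cnullZ; apply: cnull_sum => i; exact: fg.
    by apply/funext => N; rewrite /mean -mulrBr -sumrB.
  apply/eqP; rewrite -subr_eq0; apply/eqP; apply: (@cnull_cst _ _ U).
  rewrite (_ : (fun _ : nat => _) = fun N => (mean (f N) z - h z) +
      (-1) * (mean (f N) z - mean g z)).
    by apply: cnullD; [exact: mh | exact: cnullZ].
  by apply/funext => N; ring.
exists t, u; split=> //.
- by split=> [i|j]; [have [] := ht i | have [] := hu j].
- apply: (mean_lim _ T) => // [N i x x0|i z hz].
    by have [h _] := iterates_lower N x0 W0; exact: h.
  by have [_ h] := ht i; exact: h.
- apply: (mean_lim _ S) => // [N i x x0|i z hz].
    by have [_ h] := iterates_lower N x0 W0; exact: h.
  by have [_ h] := hu i; exact: h.
Qed.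

(** At -x with x >= 2W the l1 distance of two solutions is at most half of itself, hence 0. The
    identity principle, applied to a constant sequence, carries the equality to the cut plane. *)
Theorem system_unique (t t' : 'I_p -> C -> C) (u u' : 'I_n -> C -> C) :
  (forall i, in_stieltjes (t i)) -> (forall j, in_stieltjes (u j)) ->
  (forall i, in_stieltjes (t' i)) -> (forall j, in_stieltjes (u' j)) ->
  system_eq t u -> system_eq t' u' ->
  forall z, cut_plane z -> (forall i, t' i z = t i z) /\ (forall j, u' j z = u j z).
Proof.
move=> ht hu ht' hu' E E'.
have gap0 x : 0 < x -> 2 * W <= x -> gap x (t', u') (t, u) = 0.
  move=> x0 Wx; apply: le_anti; rewrite gap_ge0 andbT.
  have hz := neg_cut_plane x0; have [e1 e2] := E _ hz; have [e1' e2'] := E' _ hz.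
  have : gap x (t', u') (t, u) <= 2^-1 * gap x (t', u') (t, u).
    rewrite {1}/gap /=; under eq_bigr do rewrite e1 e1'.
    under [X in _ + X <= _]eq_bigr do rewrite e2 e2'.
    by apply: gap_half => // k; exact: in_stieltjes_neg.
  lra.
have uniq (f f' : C -> C) : in_stieltjes f -> in_stieltjes f' ->
   (forall x, 0 < x -> 2 * W <= x ->
      nc (f' (- x%:C%C) - f (- x%:C%C)) <= gap x (t', u') (t, u)) ->
   forall z, cut_plane z -> f' z = f z.
  move=> hf hf' h z hz; apply/eqP; rewrite -subr_eq0; apply/eqP.
  apply: (@cnull_cst _ nat \oo); move: z hz.
  apply: (@stieltjes_determined R _ \oo _
      (fun _ z => f' z - f z) (2 + 2) _ (2 * `|W| + 1)) => [N|m i m1].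
    exact: stieltjes_boundB (in_stieltjes_bound hf') (in_stieltjes_bound hf).
  have iv : (0 : R) <= i.+1%:R^-1 by rewrite invr_ge0 ler0n.
  have WW := ler_norm W; have W0 := normr_ge0 W.
  have x0 : 0 < m%:R + i.+1%:R^-1 :> R by move: iv m1; move: (_^-1) (m%:R) => a b; lra.
  have Wx : 2 * W <= m%:R + i.+1%:R^-1 by move: iv m1; move: (_^-1) (m%:R) => a b; lra.
  have := h _ x0 Wx; rewrite gap0 // => h0 e e0.
  by apply: nearW => _; exact: le_lt_trans h0 e0.
move=> z hz; split=> [i|j]; apply: uniq => // x x0 Wx.
  exact: (gap1 x (t', u') (t, u)).
exact: (gap2 x (t', u') (t, u)).
Qed.

End Solution.
End System.

(** * Independence of sigma-algebras and decoupled integration *)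

Section Decoupling.
Context d (Om : measurableType d) (R : realType) (P : probability Om R).
Local Open Scope ereal_scope.

Definition indep_systems (G1 G2 : set (set Om)) : Prop :=
  forall E F, G1 E -> G2 F -> P (E `&` F) = P E * P F.

(** For fixed F both sides are finite measures in E: P restricted to F, and P scaled by P F.
    Agreement on a generating class closed under intersection therefore extends to its
    sigma-algebra. *)
Let indep_systems_half (G1 G2 : set (set Om)) : G1 `<=` measurable ->
  G2 `<=` measurable -> setI_closed G1 -> G1 setT ->
  indep_systems G1 G2 -> indep_systems <<s G1 >> G2.
Proof.
move=> mG1 mG2 IG1 G1T ind E F GE GF; have mF := mG2 _ GF.
have PF : P F \is a fin_num by exact: fin_num_measure.
pose r : {nonneg R} := NngNum (fine_ge0 (measure_ge0 P F)).
have rE A : mscale r P A = P A * P F by rewrite /mscale /= fineK // muleC.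
rewrite -rE.
rewrite -[LHS]/(mrestr P mF E).
apply: (@g_sigma_algebra_measure_unique _ _ _ G1 mG1 (fun=> setT)) => //.
- by rewrite bigcup_const //; exists 0%N.
- by move=> A GA; apply: etrans (ind A F GA GF) _; exact: esym (rE A).
- move=> k; apply: le_lt_trans (_ : P setT < +oo); last by rewrite probability_setT ltry.
  by apply: le_measure; rewrite ?inE //; apply: measurableI.
Qed.

Lemma indep_systems_sigma (G1 G2 : set (set Om)) : G1 `<=` measurable ->
  G2 `<=` measurable -> setI_closed G1 -> setI_closed G2 -> G1 setT -> G2 setT ->
  indep_systems G1 G2 -> indep_systems <<s G1 >> <<s G2 >>.
Proof.
move=> m1 m2 I1 I2 T1 T2 ind.
have sm1 : <<s G1 >> `<=` measurable.
  by apply: smallest_sub => //; exact: sigma_algebra_measurable.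
have h : indep_systems G2 <<s G1 >>.
  by move=> E F hE hF; rewrite setIC muleC; apply: (indep_systems_half m1 m2).
move=> E F hE hF; rewrite setIC muleC.
exact: (indep_systems_half m2 sm1 I2 T2 h).
Qed.

(** Under independence the diagonal map o -> (o, o) has the product of its marginals as law on the
    two sub-sigma-algebras, and Tonelli applies. Resampling by o' takes the place of conditional
    expectation throughout. *)
Lemma decouple (G1 G2 : set (set Om)) : G1 `<=` measurable ->
  G2 `<=` measurable -> indep_systems <<s G1 >> <<s G2 >> ->
  forall Phi : g_sigma_algebraType G1 * g_sigma_algebraType G2 -> \bar R,
  measurable_fun setT Phi -> (forall x, 0 <= Phi x) ->
  \int[P]_o Phi (o, o) = \int[P]_o \int[P]_o' Phi (o, o').
Proof.
move=> m1 m2 ind Phi mPhi Phi0.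
have sm G : G `<=` measurable -> <<s G >> `<=` (measurable : set (set Om)).
  by move=> mG; apply: smallest_sub => //; exact: sigma_algebra_measurable.
pose T1 : measurableType _ := g_sigma_algebraType G1.
pose T2 : measurableType _ := g_sigma_algebraType G2.
have mi1 : measurable_fun setT (fun o : Om => o : T1).
  by move=> _ Y mY; rewrite setTI; exact: sm mY.
have mi2 : measurable_fun setT (fun o : Om => o : T2).
  by move=> _ Y mY; rewrite setTI; exact: sm mY.
have mD : measurable_fun setT (fun o : Om => (o, o) : T1 * T2).
  exact: measurable_fun_pair.
pose X1 : {mfun Om >-> T1} := HB.pack (fun o : Om => o : T1)
  (isMeasurableFun.Build _ _ _ _ _ mi1).
pose X2 : {mfun Om >-> T2} := HB.pack (fun o : Om => o : T2)
  (isMeasurableFun.Build _ _ _ _ _ mi2).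
pose XD : {mfun Om >-> (T1 * T2)%type} := HB.pack (fun o : Om => (o, o) : T1 * T2)
  (isMeasurableFun.Build _ _ _ _ _ mD).
pose P1 : probability T1 R := distribution P X1.
pose P2 : probability T2 R := distribution P X2.
have uniq A : measurable A -> (P1 \x P2)%E A = distribution P XD A.
  apply: product_measure_unique => B C mB mC.
  exact: ind mB mC.
have int2 (h : T2 -> \bar R) : measurable_fun setT h -> (forall x, 0 <= h x) ->
    \int[P2]_x h x = \int[P]_o h o.
  by move=> mh h0; rewrite /P2 /distribution ge0_integral_pushforward.
have int1 (h : T1 -> \bar R) : measurable_fun setT h -> (forall x, 0 <= h x) ->
    \int[P1]_x h x = \int[P]_o h o.
  by move=> mh h0; rewrite /P1 /distribution ge0_integral_pushforward.
transitivity (\int[distribution P XD]_x Phi x).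
  by rewrite /distribution ge0_integral_pushforward.
transitivity (\int[P1 \x P2]_x Phi x).
  by apply: eq_measure_integral => A mA _; exact/esym/uniq.
rewrite fubini_tonelli1 // int1.
- apply: eq_integral => o _; rewrite /fubini_F int2 //.
  exact: measurable_fun_pair2 mPhi.
- exact: measurable_fun_fubini_tonelli_F.
- by move=> x; apply: integral_ge0.
Qed.

End Decoupling.

(** * Expectations of bounded measurable functions *)

Section BoundedExpectation.
Context d (Om : measurableType d) (R : realType) (P : probability Om R).
Implicit Types f g : Om -> R.

Definition bmeas (f : Om -> R) : Prop :=
  measurable_fun setT f /\ exists B, forall o, `|f o| <= B.

Lemma bmeas_integrable f : bmeas f -> P.-integrable setT (EFin \o f).
Proof.
move=> [mf [B fB]]; apply: measurable_bounded_integrable => //.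
  by rewrite [X in (X < _)%E](@probability_setT _ _ _ P) ltry.
by exists B; split; [exact: num_real|move=> x Bx t _; exact: le_trans (fB t) (ltW Bx)].
Qed.

Lemma bmeas_cst (c : R) : bmeas (fun=> c).
Proof. by split; [exact: measurable_cst|exists `|c|]. Qed.

Lemma bmeasD f g : bmeas f -> bmeas g -> bmeas (fun o => f o + g o).
Proof.
move=> [mf [B fB]] [mg [B' gB]]; split; first exact: measurable_funD.
by exists (B + B') => o; apply: le_trans (ler_normD _ _) (lerD _ _).
Qed.

Lemma bmeasM f g : bmeas f -> bmeas g -> bmeas (fun o => f o * g o).
Proof.
move=> [mf [B fB]] [mg [B' gB]]; split; first exact: measurable_funM.
by exists (B * B') => o; rewrite normrM ler_pM.
Qed.

Lemma bmeasB f g : bmeas f -> bmeas g -> bmeas (fun o => f o - g o).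
Proof.
move=> [mf [B fB]] [mg [B' gB]]; split; first exact: measurable_funB.
by exists (B + B') => o; apply: le_trans (ler_normB _ _) (lerD _ _).
Qed.

Lemma bmeasX f k : bmeas f -> bmeas (fun o => f o ^+ k).
Proof.
move=> bf; elim: k => [|k IH]; first exact: bmeas_cst.
by under eq_fun do rewrite exprS; exact: bmeasM.
Qed.

Lemma bmean_cst (c : R) : \int[P]_o c = c.
Proof. by rewrite Rintegral_cst // [X in fine X](@probability_setT _ _ _ P) mulr1. Qed.

Lemma bmean_EFin f : bmeas f -> (\int[P]_o (f o)%:E)%E = (\int[P]_o f o)%:E.
Proof. by move=> bf; rewrite fineK // integrable_fin_num //; exact: bmeas_integrable. Qed.

Lemma bmeanD f g : bmeas f -> bmeas g ->
  \int[P]_o (f o + g o) = \int[P]_o f o + \int[P]_o g o.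
Proof. by move=> bf bg; rewrite RintegralD //; exact: bmeas_integrable. Qed.

Lemma bmeanB f g : bmeas f -> bmeas g ->
  \int[P]_o (f o - g o) = \int[P]_o f o - \int[P]_o g o.
Proof. by move=> bf bg; rewrite RintegralB //; exact: bmeas_integrable. Qed.

Lemma bmeanZ (c : R) f : bmeas f -> \int[P]_o (c * f o) = c * \int[P]_o f o.
Proof. by move=> bf; rewrite RintegralZl //; exact: bmeas_integrable. Qed.

Lemma bmean_le f g : bmeas f -> bmeas g -> (forall o, f o <= g o) ->
  \int[P]_o f o <= \int[P]_o g o.
Proof. by move=> bf bg fg; apply: le_Rintegral => //; exact: bmeas_integrable. Qed.

Lemma bmean_norm_le f (c : R) : bmeas f -> (forall o, `|f o| <= c) ->
  `|\int[P]_o f o| <= c.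
Proof.
move=> bf fc; rewrite ler_norml -{1}(bmean_cst (- c)) -{2}(bmean_cst c).
by apply/andP; split; apply: bmean_le => //; try exact: bmeas_cst;
  move=> o; have := fc o; rewrite ler_norml => /andP[].
Qed.

End BoundedExpectation.

(** * Martingale fourth-moment bound for functions of independent entries *)

Section Concentration.
Context d (Om : measurableType d) (R : realType) (P : probability Om R).
Context (I : finType).
Local Notation C := R[i].
Local Notation nc := (@Normc.normc R).
Implicit Types (a : I -> C) (J : {set I}) (f : (I -> C) -> R).

(* Measurability of a function of the entries, phrased without putting a
   sigma-algebra on the space of entries. *)
Definition good f : Prop :=
  forall d' (T : measurableType d') (A : T -> I -> C),
    (forall e, cmeasurable (fun t => A t e)) ->
    measurable_fun setT (fun t => f (A t)).

(** Averaging [f (mix J a (y o))] over o is the conditional expectation of f given that the entries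
    in J take the values a. *)
Definition mix J a a' : I -> C := fun e => if e \in J then a e else a' e.

(** Independence of the entries in the form in which it is used: each J comes with two independent
    sigma-algebras, one carrying the entries inside J and the other those outside. *)
Definition decoupled (Y : I -> Om -> C) : Prop :=
  forall J, exists G1 G2 : set (set Om),
    [/\ G1 `<=` measurable, G2 `<=` measurable,
      indep_systems P <<s G1 >> <<s G2 >>,
      forall e, e \in J -> cmeasurable (Y e : g_sigma_algebraType G1 -> C)
    & forall e, e \notin J -> cmeasurable (Y e : g_sigma_algebraType G2 -> C)].

Variable Y : I -> Om -> C.
Hypotheses (Ydec : decoupled Y) (Ymeas : forall e, cmeasurable (Y e)).
Local Notation y := (fun o e => Y e o).

Lemma cmeasurable_comp d1 d2 (T1 : measurableType d1) (T2 : measurableType d2)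
    (g : T2 -> C) (h : T1 -> T2) : cmeasurable g -> measurable_fun setT h ->
  cmeasurable (fun t => g (h t)).
Proof.
move=> [g1 g2] mh; split; first exact: (measurableT_comp g1 mh).
exact: (measurableT_comp g2 mh).
Qed.

Lemma decouple_mix J f : good f -> (forall a, 0 <= f a) ->
  (\int[P]_o (f (y o))%:E =
   \int[P]_o \int[P]_o' (f (mix J (y o) (y o')))%:E)%E.
Proof.
move=> gf f0; have [G1 [G2 [m1 m2 ind c1 c2]]] := Ydec J.
pose Phi (x : g_sigma_algebraType G1 * g_sigma_algebraType G2) :=
  (f (mix J (y x.1) (y x.2)))%:E.
have mPhi : measurable_fun setT Phi.
  apply/measurable_EFinP; apply: gf => e; rewrite /mix; case: (boolP (e \in J)) => eJ.
    exact: cmeasurable_comp (c1 e eJ) measurable_fst.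
  exact: cmeasurable_comp (c2 e eJ) measurable_snd.
have Phi0 x : (0 <= Phi x)%E by rewrite lee_fin.
apply: etrans (decouple m1 m2 ind mPhi Phi0).
apply: eq_integral => o _; rewrite /Phi /=; congr ((f _)%:E).
by apply/funext => e; rewrite /mix if_same.
Qed.

Lemma good_bmeas f (A : Om -> I -> C) (B : R) : good f ->
  (forall a, 0 <= f a <= B) -> (forall e, cmeasurable (fun o => A o e)) ->
  bmeas (fun o => f (A o)).
Proof.
move=> gf fB mA; split; first exact: gf.
by exists B => o; have /andP[h1 h2] := fB (A o); rewrite ger0_norm.
Qed.

Lemma mix_meas J a e : cmeasurable (fun o => mix J a (y o) e).
Proof. by rewrite /mix; case: (e \in J); [exact: cmeasurable_cst|exact: Ymeas]. Qed.

Lemma good_mix J f a : good f -> good (fun a' => f (mix J a a')).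
Proof.
move=> gf d' T A mA; by apply: gf => e; rewrite /mix; case: (e \in J).
Qed.

Lemma good_mean J f (B : R) : good f -> (forall a, 0 <= f a <= B) ->
  good (fun a => \int[P]_o f (mix J a (y o))).
Proof.
move=> gf fB d' T A mA.
have mF : measurable_fun setT
    (fun x : T * Om => (f (mix J (A x.1) (y x.2)))%:E).
  apply/measurable_EFinP; apply: gf => e; rewrite /mix; case: (boolP (e \in J)) => eJ.
    exact: cmeasurable_comp (mA e) measurable_fst.
  exact: cmeasurable_comp (Ymeas e) measurable_snd.
have F0 (x : T * Om) : (0 <= (f (mix J (A x.1) (y x.2)))%:E)%E.
  by rewrite lee_fin; have /andP[] := fB (mix J (A x.1) (y x.2)).
have := @measurable_fun_fubini_tonelli_F _ _ _ _ _ P _ mF F0.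
move=> mm; exact: (measurableT_comp (fine_measurable measurableT) mm).
Qed.

Lemma mix_integral_measurable J f : good f -> (forall a, 0 <= f a) ->
  measurable_fun setT (fun o => \int[P]_o' (f (mix J (y o) (y o')))%:E)%E.
Proof.
move=> gf f0.
have mF : measurable_fun setT
    (fun x : Om * Om => (f (mix J (y x.1) (y x.2)))%:E).
  apply/measurable_EFinP; apply: gf => e; rewrite /mix; case: (e \in J).
    exact: cmeasurable_comp (Ymeas e) measurable_fst.
  exact: cmeasurable_comp (Ymeas e) measurable_snd.
have F0 (x : Om * Om) : (0 <= (f (mix J (y x.1) (y x.2)))%:E)%E by rewrite lee_fin.
exact: (@measurable_fun_fubini_tonelli_F _ _ _ _ _ P _ mF F0).
Qed.

Lemma decouple_mean J f (B : R) : good f -> (forall a, 0 <= f a <= B) ->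
  \int[P]_o f (y o) = \int[P]_o (\int[P]_o' f (mix J (y o) (y o'))).
Proof.
move=> gf fB; have f0 a : 0 <= f a by have /andP[] := fB a.
rewrite [LHS]/Rintegral (decouple_mix J gf f0) /Rintegral; congr fine.
apply: eq_integral => o _.
by rewrite bmean_EFin //; apply: good_bmeas => // e; exact: mix_meas.
Qed.

Section Martingale.
Variables (N : nat) (rk : I -> nat) (f : (I -> C) -> R) (B c : R).
Hypotheses (rkN : forall e, (rk e < N)%N) (gf : good f)
  (fB : forall a, 0 <= f a <= B)
  (fc : forall k a a', (forall e, rk e != k -> a e = a' e) -> `|f a - f a'| <= c).

Let J k : {set I} := [set e | (rk e < k)%N].
(** The Doob martingale of f when the ranks are revealed in increasing order, as an explicit
    function of the entries. *)
Let g k a := \int[P]_o f (mix (J k) a (y o)).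
Let m := \int[P]_o f (y o).

Let gB k a : 0 <= g k a <= B.
Proof.
have b : bmeas (fun o => f (mix (J k) a (y o))).
  by apply: good_bmeas => // e; exact: mix_meas.
apply/andP; split.
  rewrite -[leLHS](bmean_cst P); apply: bmean_le => //; first exact: bmeas_cst.
  by move=> o; have /andP[] := fB (mix (J k) a (y o)).
rewrite -[leRHS](bmean_cst P); apply: bmean_le => //; first exact: bmeas_cst.
by move=> o; have /andP[] := fB (mix (J k) a (y o)).
Qed.

Let gg k : good (g k). Proof. exact: good_mean gf fB. Qed.

Let g_tower k a : g k a = \int[P]_o g k.+1 (mix (J k) a (y o)).
Proof.
rewrite {1}/g (@decouple_mean (J k.+1) (fun a' => f (mix (J k) a a')) B) //; last exact: good_mix.
rewrite /Rintegral; congr fine; apply: eq_integral => o _; congr (_%:E).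
rewrite /g /Rintegral; congr fine; apply: eq_integral => o' _; congr ((f _)%:E).
apply/funext => e; rewrite /mix !inE ltnS.
by case: (ltnP (rk e) k) => // h; rewrite (ltnW h).
Qed.

(** [g k.+1] reads its argument at ranks up to k only, so two arguments that agree below k differ
    for it at rank k alone. *)
Let g_lip k a a' : (forall e, (rk e < k)%N -> a e = a' e) ->
  `|g k.+1 a - g k.+1 a'| <= c.
Proof.
move=> aa'; rewrite /g -bmeanB; first last.
- by apply: good_bmeas => // e; exact: mix_meas.
- by apply: good_bmeas => // e; exact: mix_meas.
apply: bmean_norm_le.
  by apply: bmeasB; apply: good_bmeas => // e; exact: mix_meas.
move=> o; apply: (fc (k := k)) => e ek; rewrite /mix inE ltnS.
by case: leqP => // h; apply: aa'; rewrite ltn_neqAle ek h.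
Qed.

Let g0 a : g 0 a = m.
Proof.
by rewrite /g /m; congr Rintegral; apply/funext => o; congr f; apply/funext => e;
  rewrite /mix inE ltn0.
Qed.

Let gN a : g N a = f a.
Proof.
rewrite -[RHS](bmean_cst P); congr Rintegral; apply/funext => o; congr f.
by apply/funext => e; rewrite /mix inE rkN.
Qed.

Let c0 : 0 <= c.
Proof. by apply: le_trans (fc (k := 0) (a := fun=> 0) (a' := fun=> 0) _). Qed.

Let M r k := \int[P]_o (g k (y o) - m) ^+ r.

Let increment k a o : `|g k.+1 (mix (J k) a (y o)) - g k a| <= c.
Proof.
have b : bmeas (fun o => g k.+1 (mix (J k) a (y o))).
  by apply: good_bmeas (gg _) (gB _) _ => e; exact: mix_meas.
rewrite [X in _ - X]g_tower -[X in `|X - _|](bmean_cst P) -bmeanB //; last exact: bmeas_cst.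
apply: bmean_norm_le; first by apply: bmeasB => //; exact: bmeas_cst.
by move=> o'; apply: g_lip => e ek; rewrite /mix inE ek.
Qed.

Let m_le : 0 <= m <= B. Proof. by rewrite -(g0 (fun=> 0)). Qed.

Let pow_bound r k a : ~~ odd r -> 0 <= (g k a - m) ^+ r <= B ^+ r.
Proof.
move=> er; rewrite exprn_even_ge0 //=.
have B0 : 0 <= B by have /andP[h1 h2] := m_le; exact: le_trans h1 h2.
rewrite -[X in X <= _](ger0_norm (exprn_even_ge0 _ er)) normrX lerXn2r ?nnegrE //.
have /andP[h1 h2] := gB k a; have /andP[h3 h4] := m_le.
by rewrite ler_norml; apply/andP; split; lra.
Qed.

(** Decoupling along [J k] freezes the ranks below k, so the conditional moment only has to be
    bounded for a fixed a. *)
Let M_step r k (q : R -> R) : ~~ odd r ->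
  (forall a, \int[P]_o (g k.+1 (mix (J k) a (y o)) - m) ^+ r <= q (g k a - m)) ->
  bmeas (fun o => q (g k (y o) - m)) ->
  M r k.+1 <= \int[P]_o q (g k (y o) - m).
Proof.
move=> er hq bq; have gr : good (fun a => (g k.+1 a - m) ^+ r).
  move=> d' T A mA; apply: measurable_funX; apply: measurable_funB => //.
  exact: gg.
rewrite /M (@decouple_mean (J k) (fun a => (g k.+1 a - m) ^+ r) (B ^+ r)) //.
  have pb a : 0 <= (g k.+1 a - m) ^+ r <= B ^+ r by exact: pow_bound.
  apply: bmean_le => //.
  have gm := @good_mean (J k) (fun a => (g k.+1 a - m) ^+ r) (B ^+ r) gr pb.
  split; first exact: (gm _ _ (fun o e => Y e o) Ymeas).
  exists (B ^+ r) => o; apply: bmean_norm_le.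
    by apply: (good_bmeas gr pb) => e; exact: mix_meas.
  by move=> o'; have /andP[h1 h2] := pb (mix (J k) (y o) (y o')); rewrite ger0_norm.
by move=> a; exact: pow_bound.
Qed.

Let gmb k : bmeas (fun o => g k (y o) - m).
Proof.
apply: bmeasB; last exact: bmeas_cst.
by apply: good_bmeas (gg _) (gB _) _.
Qed.

Let second_moment k : M 2 k <= k%:R * c ^+ 2.
Proof.
elim: k => [|k IH].
  by rewrite /M mul0r; under eq_Rintegral do rewrite g0 subrr expr0n; rewrite bmean_cst.
apply: le_trans (@M_step 2 k (fun s => s ^+ 2 + c ^+ 2) _ _ _) _ => //.
- move=> a; set h := fun o => g k.+1 (mix (J k) a (y o)) - g k a.
  have bh : bmeas h.
    apply: bmeasB; last exact: bmeas_cst.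
    apply: good_bmeas (gg _) (gB _) _ => e.
    exact: mix_meas.
  have h0 : \int[P]_o h o = 0.
    rewrite bmeanB ?bmean_cst -?g_tower ?subrr //; last exact: bmeas_cst.
    by apply: good_bmeas (gg _) (gB _) _ => e; exact: mix_meas.
  set s := g k a - m.
  (* Adding the mean-zero term 2 s h reduces the comparison of integrals to a pointwise inequality.
     The fourth moment uses 4 s^3 h in the same way. *)
  have -> : s ^+ 2 + c ^+ 2 = \int[P]_o ((s ^+ 2 + c ^+ 2) + 2 * s * h o).
    by rewrite bmeanD ?bmeanZ ?h0 ?mulr0 ?addr0 ?bmean_cst //;
      [exact: bmeas_cst|apply: bmeasM => //; exact: bmeas_cst].
  apply: bmean_le.
  + apply: bmeasX; apply: bmeasB; last exact: bmeas_cst.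
    by apply: good_bmeas (gg _) (gB _) _ => e; exact: mix_meas.
  + by apply: bmeasD; [exact: bmeas_cst|apply: bmeasM => //; exact: bmeas_cst].
  + move=> o; have := increment k a o; rewrite -/(h o) => hc.
    have -> : g k.+1 (mix (J k) a (y o)) - m = s + h o by rewrite /h /s; ring.
    have : h o ^+ 2 <= c ^+ 2 by rewrite -real_normK ?num_real // lerXn2r ?nnegrE.
    have -> : (s + h o) ^+ 2 = s ^+ 2 + h o ^+ 2 + 2 * s * h o by ring.
    by rewrite lerD2r lerD2l.
- by apply: bmeasD; [exact: bmeasX|exact: bmeas_cst].
- rewrite bmeanD ?bmean_cst; [|exact: bmeasX|exact: bmeas_cst].
  by rewrite -natr1 mulrDl mul1r lerD2r.
Qed.

Let fourth_moment k : M 4 k <= 4 * k%:R ^+ 2 * c ^+ 4.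
Proof.
elim: k => [|k IH].
  rewrite /M expr0n mulr0 mul0r; under eq_Rintegral do rewrite g0 subrr expr0n.
  by rewrite bmean_cst.
(* In the expansion of (s + h)^4 with |h| <= c and h of mean 0, the bound 4 s h^3 <= 2 s^2 h^2 + 2
   h^4 gives the coefficients 6 + 2 = 8 and 2 + 1 = 3. Summing over k with the second moment stays
   below 4 k^2 c^4. *)
pose q s := s ^+ 4 + 8 * c ^+ 2 * s ^+ 2 + 3 * c ^+ 4.
have bq : bmeas (fun o => (g k (y o) - m) ^+ 4 + 8 * c ^+ 2 * (g k (y o) - m) ^+ 2).
  apply: bmeasD; first exact: bmeasX.
  by apply: bmeasM; [exact: bmeas_cst|exact: bmeasX].
apply: le_trans (@M_step 4 k q _ _ _) _ => //.
- move=> a; set h := fun o => g k.+1 (mix (J k) a (y o)) - g k a.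
  have bh : bmeas h.
    apply: bmeasB; last exact: bmeas_cst.
    apply: good_bmeas (gg _) (gB _) _ => e.
    exact: mix_meas.
  have h0 : \int[P]_o h o = 0.
    rewrite bmeanB ?bmean_cst -?g_tower ?subrr //; last exact: bmeas_cst.
    by apply: good_bmeas (gg _) (gB _) _ => e; exact: mix_meas.
  set s := g k a - m.
  have -> : q s = \int[P]_o (q s + 4 * s ^+ 3 * h o).
    by rewrite bmeanD ?bmeanZ ?h0 ?mulr0 ?addr0 ?bmean_cst //;
      [exact: bmeas_cst|apply: bmeasM => //; exact: bmeas_cst].
  apply: bmean_le.
  + apply: bmeasX; apply: bmeasB; last exact: bmeas_cst.
    by apply: good_bmeas (gg _) (gB _) _ => e; exact: mix_meas.
  + by apply: bmeasD; [exact: bmeas_cst|apply: bmeasM => //; exact: bmeas_cst].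
  + move=> o; have := increment k a o; rewrite -/(h o) => hc.
    have -> : g k.+1 (mix (J k) a (y o)) - m = s + h o by rewrite /h /s; ring.
    have hc2 : h o ^+ 2 <= c ^+ 2 by rewrite -real_normK ?num_real // lerXn2r ?nnegrE.
    have hc4 : h o ^+ 4 <= c ^+ 4.
      by rewrite -[4%N]/(2 * 2)%N !exprM lerXn2r ?nnegrE ?sqr_ge0.
    have sh2 : s ^+ 2 * h o ^+ 2 <= s ^+ 2 * c ^+ 2 by rewrite ler_wpM2l ?sqr_ge0.
    have h42 : h o ^+ 4 <= c ^+ 2 * h o ^+ 2.
      have -> : h o ^+ 4 = h o ^+ 2 * h o ^+ 2 by ring.
      by rewrite ler_wpM2r ?sqr_ge0.
    have sh3 : 2 * (s * h o ^+ 3) <= s ^+ 2 * h o ^+ 2 + h o ^+ 4.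
      by have := sqr_ge0 (s * h o - h o ^+ 2); rewrite sqrrB; nra.
    have -> : (s + h o) ^+ 4 = s ^+ 4 + 4 * s ^+ 3 * h o + 6 * (s ^+ 2 * h o ^+ 2)
       + 4 * (s * h o ^+ 3) + h o ^+ 4 by ring.
    rewrite /q; lra.
- by apply: bmeasD; [exact: bq|exact: bmeas_cst].
- rewrite /q bmeanD ?bmean_cst //; last exact: bmeas_cst.
  rewrite bmeanD ?bmeanZ; try exact: bmeasX; last first.
    by apply: bmeasM; [exact: bmeas_cst|exact: bmeasX].
  have := ler_wpM2l (mulr_ge0 (ler0n R 8) (sqr_ge0 c)) (second_moment k).
  move: IH; rewrite -/(M 4 k) -/(M 2 k) -(natr1 k); set s := k%:R => IH h.
  have -> : 4 * (s + 1) ^+ 2 * c ^+ 4 = 4 * s ^+ 2 * c ^+ 4 +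
     8 * c ^+ 2 * (s * c ^+ 2) + 4 * c ^+ 4 by ring.
  have : 0 <= c ^+ 4 by rewrite exprn_ge0.
  lra.
Qed.

(** For c of order 1/N this is of order N^-2, hence summable; second moments would give only 1/N. *)
Lemma concentration :
  \int[P]_o (f (y o) - \int[P]_o f (y o)) ^+ 4 <= 4 * N%:R ^+ 2 * c ^+ 4.
Proof.
apply: le_trans (fourth_moment N); rewrite /M.
by under [leRHS]eq_Rintegral do rewrite gN.
Qed.

End Martingale.
End Concentration.

(** * Second moment of a quadratic form in independent entries *)

Section QuadraticForms.
Context d (Om : measurableType d) (R : realType) (P : probability Om R).
Context (I : finType).
Local Notation C := R[i].
Local Notation nc := (@Normc.normc R).

Definition centered (X : Om -> C) (v kappa : R) : Prop :=
  [/\ P.-integrable setT (EFin \o (fun o => complex.Re (X o))) /\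
        \int[P]_o complex.Re (X o) = 0,
      P.-integrable setT (EFin \o (fun o => complex.Im (X o))) /\
        \int[P]_o complex.Im (X o) = 0,
      P.-integrable setT (EFin \o (fun o => nc (X o) ^+ 2)) /\
        \int[P]_o (nc (X o) ^+ 2) = v
    & P.-integrable setT (EFin \o (fun o => nc (X o) ^+ 4)) /\
        \int[P]_o (nc (X o) ^+ 4) <= kappa].

Let iZ (c : R) (h : Om -> R) : P.-integrable setT (EFin \o h) ->
  P.-integrable setT (EFin \o (fun o => c * h o)).
Proof. by move=> ih; apply: eq_integrable (integrableZl measurableT c ih). Qed.

Let iD (h h' : Om -> R) : P.-integrable setT (EFin \o h) ->
  P.-integrable setT (EFin \o h') ->
  P.-integrable setT (EFin \o (fun o => h o + h' o)).
Proof. by move=> ih ih'; apply: eq_integrable (integrableD measurableT ih ih'). Qed.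

(** The shape of a centered quadratic form after one further entry X. The three new terms are
    centered, so their cross terms with S vanish, and the square of a sum of three terms costs the
    factor 3. *)
Lemma one_variable (X : Om -> C) (v kappa : R) (S l l' al : C) :
  cmeasurable X -> centered X v kappa ->
  (\int[P]_o (nc (S + X o * l + (X o)^* * l' + al * (nc (X o) ^+ 2 - v)%:C%C)
      ^+ 2)%:E <=
   (nc S ^+ 2 + 3 * (v * nc l ^+ 2 + v * nc l' ^+ 2 + kappa * nc al ^+ 2))%:E)%E.
Proof.
move=> mX [[i1 e1] [i2 e2] [i3 e3] [i4 e4]].
pose b1 := 2 * (complex.Re S * (complex.Re l + complex.Re l') +
                complex.Im S * (complex.Im l + complex.Im l')).
pose b2 := 2 * (complex.Re S * (complex.Im l' - complex.Im l) +
                complex.Im S * (complex.Re l - complex.Re l')).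
pose b3 := 2 * (complex.Re S * complex.Re al + complex.Im S * complex.Im al).
pose L := nc l ^+ 2 + nc l' ^+ 2.
pose A := nc al ^+ 2.
(* A pointwise majorant that is affine in Re X, Im X, |X|^2 and |X|^4, so its mean follows from the
   moments of X. *)
pose H o := (nc S ^+ 2 - b3 * v + 3 * A * v ^+ 2) + (b1 * complex.Re (X o) +
  (b2 * complex.Im (X o) + ((b3 + 3 * L - 6 * A * v) * nc (X o) ^+ 2 +
   3 * A * nc (X o) ^+ 4))).
have ic (c : R) : P.-integrable setT (EFin \o (fun=> c)).
  exact: finite_measure_integrable_cst.
have lin (c0 c1 c2 c3 c4 : R) : let h o := c0 + (c1 * complex.Re (X o) +
    (c2 * complex.Im (X o) + (c3 * nc (X o) ^+ 2 + c4 * nc (X o) ^+ 4))) in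
    P.-integrable setT (EFin \o h) /\
    \int[P]_o h o = c0 + c3 * v + c4 * \int[P]_o (nc (X o) ^+ 4).
  split; first by do !(apply: iD || apply: iZ).
  do 4 (rewrite RintegralD //; try by do !(apply: iD || apply: iZ)).
  by rewrite !RintegralZl // e1 e2 e3 bmean_cst !mulr0 !add0r addrA.
have [iH HE] := lin (nc S ^+ 2 - b3 * v + 3 * A * v ^+ 2) b1 b2
  (b3 + 3 * L - 6 * A * v) (3 * A).
have intH : \int[P]_o H o <= nc S ^+ 2 + 3 * (v * nc l ^+ 2 + v * nc l' ^+ 2 +
    kappa * nc al ^+ 2).
  rewrite /H HE.
  have A0 : 0 <= A by exact: sqr_ge0.
  have := ler_wpM2l A0 e4; have := mulr_ge0 A0 (sqr_ge0 v).
  rewrite -/A /L; move: (\int[P]_o (nc (X o) ^+ 4)) => E4; lra.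
apply: le_trans (_ : (\int[P]_o (H o)%:E <= _)%E); last first.
  by rewrite -[X in (X <= _)%E]fineK ?integrable_fin_num // lee_fin.
apply: ge0_le_integral => //.
- by move=> o _; rewrite lee_fin sqr_ge0.
- apply/measurable_EFinP; apply: measurable_normc2.
  apply: cmeasurableD; [apply: cmeasurableD; [apply: cmeasurableD|]|].
  + exact: cmeasurable_cst.
  + by apply: cmeasurableM => //; exact: cmeasurable_cst.
  + by apply: cmeasurableM; [exact: cmeasurable_conj|exact: cmeasurable_cst].
  + apply: cmeasurableM; first exact: cmeasurable_cst.
    apply: cmeasurable_real; apply: measurable_funB => //.
    exact: measurable_normc2.
- exact: measurable_int iH.
move=> o _; rewrite lee_fin.
set t := nc (X o) ^+ 2 - v.
set D := X o * l + (X o)^* * l' + al * t%:C%C.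
have -> : S + X o * l + (X o)^* * l' + al * t%:C%C = S + D by rewrite /D !addrA.
have D2 : nc D ^+ 2 <= 3 * (nc (X o) ^+ 2 * L + A * t ^+ 2).
  have hD : nc D <= nc (X o) * nc l + nc (X o) * nc l' + nc al * `|t|.
    apply: le_trans (normc_triangle _ _) _; apply: lerD.
      apply: le_trans (normc_triangle _ _) _; rewrite !Normc.normcM.
      by rewrite lerD2l; case: (X o) => a b /=; rewrite sqrrN.
    by rewrite Normc.normcM normc_real.
  set p1 := nc (X o) * nc l in hD; set p2 := nc (X o) * nc l' in hD.
  set p3 := nc al * `|t| in hD.
  have -> : nc (X o) ^+ 2 * L + A * t ^+ 2 = p1 ^+ 2 + p2 ^+ 2 + p3 ^+ 2.
    by rewrite /L /A /p1 /p2 /p3 !exprMn real_normK ?num_real // mulrDr.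
  have pp : 0 <= p1 + p2 + p3 by exact: le_trans (normc_ge0 _) hD.
  have : nc D ^+ 2 <= (p1 + p2 + p3) ^+ 2 by rewrite lerXn2r ?nnegrE ?normc_ge0.
  have := sqr_ge0 (p1 - p2); have := sqr_ge0 (p1 - p3); have := sqr_ge0 (p2 - p3).
  by rewrite !sqrrB !sqrrD; lra.
have SD : nc (S + D) ^+ 2 = nc S ^+ 2 +
   (b1 * complex.Re (X o) + b2 * complex.Im (X o) + b3 * t) + nc D ^+ 2.
  rewrite !normc_sq /D /b1 /b2 /b3; move: (t) => t'.
  case: (S) => s1 s2; case: (X o) => x1 x2.
  case: (l) => l1 l2; case: (l') => l1' l2'; case: (al) => a1 a2 /=.
  by ring.
rewrite SD; apply: le_trans (lerD (lexx _) D2) _; rewrite /H /t; lra.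
Qed.


Let integral_affine (f g h : Om -> R) (c1 c2 c3 F G H : R) :
  measurable_fun setT f -> measurable_fun setT g -> measurable_fun setT h ->
  (forall o, 0 <= f o) -> (forall o, 0 <= g o) -> (forall o, 0 <= h o) ->
  0 <= c1 -> 0 <= c2 -> 0 <= c3 ->
  (\int[P]_o (f o)%:E <= F%:E)%E -> (\int[P]_o (g o)%:E <= G%:E)%E ->
  (\int[P]_o (h o)%:E <= H%:E)%E ->
  (\int[P]_o (f o + c1 * g o + c2 * h o + c3)%:E <=
     (F + c1 * G + c2 * H + c3)%:E)%E.
Proof.
move=> mf mg mh f0 g0 h0 c10 c20 c30 hf hg hh.
have mc c (k : Om -> R) : measurable_fun setT k -> measurable_fun setT (fun o => c * k o).
  by move=> mk; apply: measurable_funM => //; exact: measurable_cst.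
have addE (k k' : Om -> R) : measurable_fun setT k -> measurable_fun setT k' ->
   (forall o, 0 <= k o) -> (forall o, 0 <= k' o) ->
   (\int[P]_o (k o + k' o)%:E = \int[P]_o (k o)%:E + \int[P]_o (k' o)%:E)%E.
  move=> mk mk' k0 k'0; rewrite -ge0_integralD //.
  - by move=> o _; rewrite lee_fin.
  - exact/measurable_EFinP.
  - by move=> o _; rewrite lee_fin.
  - exact/measurable_EFinP.
have mcst : measurable_fun setT (fun _ : Om => c3) by exact: measurable_cst.
have m1 := mc c1 g mg; have m2 := mc c2 h mh.
have p1 o : 0 <= c1 * g o by exact: mulr_ge0.
have p2 o : 0 <= c2 * h o by exact: mulr_ge0.
have m12 : measurable_fun setT (fun o => f o + c1 * g o) by exact: measurable_funD.
have m123 : measurable_fun setT (fun o => f o + c1 * g o + c2 * h o).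
  exact: measurable_funD.
rewrite addE //; last by move=> o; rewrite !addr_ge0.
rewrite addE //; last by move=> o; rewrite !addr_ge0.
rewrite addE //.
have scale c (k : Om -> R) K : measurable_fun setT k -> (forall o, 0 <= k o) ->
   0 <= c -> (\int[P]_o (k o)%:E <= K%:E)%E ->
   (\int[P]_o (c * k o)%:E <= (c * K)%:E)%E.
  move=> mk k0 c0 hk; under eq_integral do rewrite EFinM.
  rewrite ge0_integralZl_EFin //; last exact/measurable_EFinP.
    by rewrite EFinM lee_wpmul2l // lee_fin.
  by move=> o _; rewrite lee_fin.
rewrite !EFinD; apply: leeD; last first.
  by rewrite integral_cst //= [X in (_ * X)%E](@probability_setT _ _ _ P) mule1.
by apply: leeD; [apply: leeD => //|]; exact: scale.
Qed.

Variable Y : I -> Om -> C.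
Hypotheses (Ydec : decoupled P Y) (Ymeas : forall e, cmeasurable (Y e)).
Local Notation y := (fun o e => Y e o).

Variables (N : nat) (L : nat -> I) (v : nat -> R) (vb kappa : R).
Hypotheses (Linj : forall j k, (j < N)%N -> (k < N)%N -> L j = L k -> j = k)
  (Ycent : forall j, (j < N)%N -> centered (Y (L j)) (v j) kappa)
  (v_le : forall j, (j < N)%N -> v j <= vb).

Let J k : {set I} := [set e | [exists j : 'I_k, L j == e]].

Let mix_old k j a a' : (j < k)%N -> mix (J k) a a' (L j) = a (L j) :> C.
Proof.
move=> jk; rewrite /mix inE ifT //; apply/existsP; exists (Ordinal jk).
exact: eqxx.
Qed.

Let mix_new k a a' : (k < N)%N -> mix (J k) a a' (L k) = a' (L k) :> C.
Proof.
move=> kN; rewrite /mix inE ifF //; apply/existsP => -[j /eqP jk].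
have /eqP := Linj (ltn_trans (ltn_ord j) kN) kN jk.
by rewrite ltn_eqF.
Qed.

Let vb0 : (0 < N)%N -> 0 <= vb.
Proof.
move=> N0; have [_ _ [_ h] _] := Ycent N0; apply: le_trans (v_le N0).
by rewrite -h; apply: Rintegral_ge0 => o _; exact: sqr_ge0.
Qed.

Let kappa0 : (0 < N)%N -> 0 <= kappa.
Proof.
move=> N0; have [_ _ _ [_ h]] := Ycent N0; apply: le_trans h.
by apply: Rintegral_ge0 => o _; rewrite exprn_ge0 // normc_ge0.
Qed.

Let step k (Q Q' : (I -> C) -> C) (l l' : (I -> C) -> C) (al : C) (q b b' : R) :
  (k < N)%N -> good (fun a => nc (Q' a) ^+ 2) ->
  cmeasurable (fun t : Om => Q (y t)) -> cmeasurable (fun t : Om => l (y t)) ->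
  cmeasurable (fun t : Om => l' (y t)) ->
  (forall o o', Q' (mix (J k) (y o) (y o')) =
     Q (y o) + Y (L k) o' * l (y o) + (Y (L k) o')^* * l' (y o) +
     al * (nc (Y (L k) o') ^+ 2 - v k)%:C%C) ->
  (\int[P]_o (nc (Q (y o)) ^+ 2)%:E <= q%:E)%E ->
  (\int[P]_o (nc (l (y o)) ^+ 2)%:E <= b%:E)%E ->
  (\int[P]_o (nc (l' (y o)) ^+ 2)%:E <= b'%:E)%E ->
  (\int[P]_o (nc (Q' (y o)) ^+ 2)%:E <=
    (q + (3 * vb) * b + (3 * vb) * b' + 3 * (kappa * nc al ^+ 2))%:E)%E.
Proof.
move=> kN gQ mQ ml ml' hQ' hq hb hb'.
have N0 : (0 < N)%N by exact: leq_ltn_trans kN.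
have v3 : 0 <= 3 * vb by exact: mulr_ge0 (ler0n _ 3) (vb0 N0).
have k3 : 0 <= 3 * (kappa * nc al ^+ 2) by apply: mulr_ge0 => //; apply: mulr_ge0 (kappa0 N0) (sqr_ge0 _).
rewrite (decouple_mix Ydec (J k) gQ (fun a => sqr_ge0 _)).
apply: le_trans (integral_affine (measurable_normc2 mQ) (measurable_normc2 ml)
  (measurable_normc2 ml') (fun o => sqr_ge0 _) (fun o => sqr_ge0 _)
  (fun o => sqr_ge0 _) v3 v3 k3 hq hb hb').
apply: ge0_le_integral => //.
- by move=> o _; apply: integral_ge0 => o' _; rewrite lee_fin sqr_ge0.
- exact: (mix_integral_measurable P Ymeas (J k) gQ (fun a => sqr_ge0 _)).
- apply/measurable_EFinP; apply: measurable_funD; last exact: measurable_cst.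
  apply: measurable_funD; [apply: measurable_funD|].
  + exact: measurable_normc2.
  + by apply: measurable_funM; [exact: measurable_cst|exact: measurable_normc2].
  + by apply: measurable_funM; [exact: measurable_cst|exact: measurable_normc2].
move=> o _; under eq_integral do rewrite hQ'.
apply: le_trans (one_variable _ _ _ _ (Ymeas (L k)) (Ycent kN)) _.
rewrite lee_fin.
have := ler_wpM2r (sqr_ge0 (nc (l (y o)))) (v_le kN).
have := ler_wpM2r (sqr_ge0 (nc (l' (y o)))) (v_le kN).
lra.
Qed.

Let linear_form (al : nat -> C) k : (k <= N)%N ->
  (\int[P]_o (nc (\sum_(j < k) al j * Y (L j) o) ^+ 2)%:E <=
   (3 * vb * \sum_(j < k) nc (al j) ^+ 2)%:E)%E.
Proof.
elim: k => [|k IH] kN.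
  under eq_integral do rewrite big_ord0 Normc.normc0 expr0n.
  by rewrite integral0 big_ord0 mulr0.
have mlin m : good (fun a => nc (\sum_(j < m) al j * a (L j)) ^+ 2).
  move=> d' T A mA; apply: measurable_normc2; apply: cmeasurable_sum => j.
  by apply: cmeasurableM => //; exact: cmeasurable_cst.
have mY m : cmeasurable (fun o => \sum_(j < m) al j * Y (L j) o).
  by apply: cmeasurable_sum => j; apply: cmeasurableM => //; exact: cmeasurable_cst.
have nn (z : C) (r : R) : nc z ^+ 2 = r ->
    (\int[P]_o (nc z ^+ 2)%:E <= r%:E)%E.
  by move=> ->; rewrite integral_cst // [X in (_ * X)%E](@probability_setT _ _ _ P) mule1.
have := @step k (fun a => \sum_(j < k) al j * a (L j))
  (fun a => \sum_(j < k.+1) al j * a (L j)) (fun=> al k) (fun=> 0) 0 _ (nc (al k) ^+ 2) 0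
  kN (mlin _) (mY k) (cmeasurable_cst _ _) (cmeasurable_cst _ _) _ (IH (ltnW kN)) (nn _ _ erefl) _.
rewrite Normc.normc0 expr0n !mulr0 !addr0 => h.
rewrite big_ord_recr mulrDr; apply: h.
  move=> o o'; rewrite big_ord_recr /= mix_new // !(mulr0, mul0r, addr0).
  congr (_ + _); last exact: mulrC.
  by apply: eq_bigr => j _; rewrite mix_old.
by rewrite integral_cst // mul0e.
Qed.

Section Quadratic.
Variables (A : nat -> nat -> C) (rho : R).
Hypotheses (Arow : forall k, (k < N)%N -> \sum_(l < k.+1) nc (A k l) ^+ 2 <= rho)
  (Acol : forall k, (k < N)%N -> \sum_(l < k.+1) nc (A l k) ^+ 2 <= rho).

(** The centered form in the first k entries. Passing from k to k + 1 adds exactly the terms treated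
    by [one_variable], whose coefficients are linear forms in the earlier entries. *)
Definition qform k (a : I -> C) : C :=
  \sum_(j < k) \sum_(l < k) a (L j) * A j l * (a (L l))^* -
  \sum_(j < k) (v j)%:C%C * A j j.

Let qformS k a : qform k.+1 a = qform k a +
  a (L k) * (\sum_(l < k) A k l * (a (L l))^*) +
  (a (L k))^* * (\sum_(j < k) a (L j) * A j k) +
  A k k * (nc (a (L k)) ^+ 2 - v k)%:C%C.
Proof.
rewrite /qform big_ord_recr /= [X in _ - X]big_ord_recr /=.
under eq_bigr do rewrite big_ord_recr /=.
rewrite big_split /= [X in _ + X - _]big_ord_recr /=.
have -> : \sum_(l < k) a (L k) * A k l * (a (L l))^* =
   a (L k) * \sum_(l < k) A k l * (a (L l))^*.
  by rewrite mulr_sumr; apply: eq_bigr => l _; rewrite mulrA.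
have -> : \sum_(j < k) a (L j) * A j k * (a (L k))^* =
   (a (L k))^* * \sum_(j < k) a (L j) * A j k.
  by rewrite mulr_sumr; apply: eq_bigr => j _; rewrite mulrC.
have -> : a (L k) * A k k * (a (L k))^* = A k k * (nc (a (L k)) ^+ 2)%:C%C.
  by rewrite mulrAC -normCK mulrC normcE -rmorphXn.
rewrite rmorphB /=; ring.
Qed.

Lemma qform_good k d' (T : measurableType d') (a : T -> I -> C) :
  (forall e, cmeasurable (fun t => a t e)) -> cmeasurable (fun t => qform k (a t)).
Proof.
move=> ma; apply: cmeasurableD; last first.
  by apply: cmeasurable_cst.
apply: cmeasurable_sum => j; apply: cmeasurable_sum => l.
apply: cmeasurableM; last exact: cmeasurable_conj.
by apply: cmeasurableM => //; exact: cmeasurable_cst.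
Qed.

(** Each new index brings two linear forms with second moment at most 3 vb rho, each multiplied by 3
    vb, which makes 18 vb^2 rho. The diagonal term adds 3 kappa rho. *)
Lemma qform_second_moment k : (k <= N)%N ->
  (\int[P]_o (nc (qform k (y o)) ^+ 2)%:E <=
    (k%:R * (rho * (18 * vb ^+ 2 + 3 * kappa)))%:E)%E.
Proof.
elim: k => [|k IH] kN.
  rewrite /qform; under eq_integral do rewrite !big_ord0 subr0 Normc.normc0 expr0n.
  by rewrite integral0 mul0r.
have N0 : (0 < N)%N by exact: leq_ltn_trans kN.
have vb0' := vb0 N0; have kappa0' := kappa0 N0.
have gq : good (fun a => nc (qform k.+1 a) ^+ 2).
  by move=> d' T a ma; apply: measurable_normc2; exact: qform_good.
have mq : cmeasurable (fun o => qform k (y o)) by exact: qform_good.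
have ml : cmeasurable (fun o => \sum_(l < k) A k l * (Y (L l) o)^*).
  apply: cmeasurable_sum => l; apply: cmeasurableM; first exact: cmeasurable_cst.
  exact: cmeasurable_conj.
have ml' : cmeasurable (fun o => \sum_(j < k) Y (L j) o * A j k).
  by apply: cmeasurable_sum => l; apply: cmeasurableM => //; exact: cmeasurable_cst.
have bl' : (\int[P]_o (nc (\sum_(j < k) Y (L j) o * A j k) ^+ 2)%:E <=
    (3 * vb * rho)%:E)%E.
  under eq_integral do under eq_bigr do rewrite mulrC.
  apply: le_trans (linear_form (fun j => A j k) (ltnW kN)) _; rewrite lee_fin.
  rewrite ler_wpM2l ?mulr_ge0 //; apply: le_trans (Acol kN).
  by rewrite big_ord_recr /= lerDl sqr_ge0.
have bl : (\int[P]_o (nc (\sum_(l < k) A k l * (Y (L l) o)^*) ^+ 2)%:E <=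
    (3 * vb * rho)%:E)%E.
  have e o : nc (\sum_(l < k) A k l * (Y (L l) o)^*) =
      nc (\sum_(l < k) (A k l)^* * Y (L l) o).
    have nJ (z : C) : nc z^* = nc z by case: z => a b /=; rewrite sqrrN.
    rewrite -nJ rmorph_sum; congr nc; apply: eq_bigr => l _.
    by rewrite rmorphM /= conjCK.
  under eq_integral do rewrite e.
  apply: le_trans (linear_form (fun l => (A k l)^*) (ltnW kN)) _; rewrite lee_fin.
  rewrite ler_wpM2l ?mulr_ge0 //; apply: le_trans (Arow kN).
  rewrite big_ord_recr /= -[leLHS]addr0; apply: lerD; last exact: sqr_ge0.
  apply: ler_sum => l _; have nJ (z : C) : nc z^* = nc z by case: z => a b /=; rewrite sqrrN.
  by rewrite nJ.
have akk : nc (A k k) ^+ 2 <= rho.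
  apply: le_trans (Arow kN); rewrite big_ord_recr /= lerDr sumr_ge0 // => l _.
  exact: sqr_ge0.
have hS := @step k (qform k) (qform k.+1) (fun a => \sum_(l < k) A k l * (a (L l))^*)
  (fun a => \sum_(j < k) a (L j) * A j k) (A k k) _ _ _ kN gq mq ml ml' _ (IH (ltnW kN)) bl bl'.
apply: le_trans (hS _) _.
  move=> o o'; rewrite qformS mix_new //.
  congr (_ + _ * _ + _ * _ + _).
  - rewrite /qform; congr (_ - _); apply: eq_bigr => j _; apply: eq_bigr => l _.
    by rewrite !mix_old.
  - by apply: eq_bigr => l _; rewrite mix_old.
  - by apply: eq_bigr => l _; rewrite mix_old.
rewrite lee_fin -(natr1 k).
have := ler_wpM2l kappa0' akk.
move: (nc (A k k) ^+ 2) => r h.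
have -> : (k%:R + 1) * (rho * (18 * vb ^+ 2 + 3 * kappa)) =
  k%:R * (rho * (18 * vb ^+ 2 + 3 * kappa)) + 3 * vb * (3 * vb * rho) +
  3 * vb * (3 * vb * rho) + 3 * (kappa * rho) by ring.
by rewrite lerD2l ler_pM2l.
Qed.

End Quadratic.
End QuadraticForms.

(** * The thinned entries: independence and moments *)

Section Model.
Context d (Om : measurableType d) (R : realType) (P : probability Om R).
Local Notation C := R[i].
Local Notation nc := (@Normc.normc R).

Section Cylinders.
Context d' (T : measurableType d') (I : finType) (X : I -> Om -> T).

Definition cylinder (J : {set I}) (A : I -> set T) : set Om :=
  [set o | forall e, e \in J -> A e (X e o)].

Lemma cylinder_sigma J A : (forall e, measurable (A e)) ->
  family_sigma X (cylinder J A).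
Proof.
move=> mA; rewrite /family_sigma; set G := [set E | _].
have -> : cylinder J A = \bigcap_(e in [set` J]) (X e @^-1` A e).
  by apply/seteqP; split=> o h e; exact: h.
apply: (@fin_bigcap_measurable _ (g_sigma_algebraType G)); first exact: finite_finset.
by move=> e _; apply: sub_sigma_algebra; exists e, (A e).
Qed.

Lemma cylinder_measurable J A : (forall e, measurable_fun setT (X e)) ->
  (forall e, measurable (A e)) -> measurable (cylinder J A).
Proof.
move=> mX mA; have := cylinder_sigma J mA; apply: smallest_sub.
  exact: sigma_algebra_measurable.
by move=> _ [e [B [mB ->]]]; rewrite -[X in measurable X]setTI; exact: mX.
Qed.

Lemma cylinder_indep (J J' : {set I}) (A A' : I -> set T) :
  independent_family P X -> (forall e, e \in J -> e \notin J') ->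
  (forall e, measurable (A e)) -> (forall e, measurable (A' e)) ->
  P (cylinder J A `&` cylinder J' A') = (P (cylinder J A) * P (cylinder J' A'))%E.
Proof.
move=> ind dJ mA mA'; pose A2 e := if e \in J then A e else A' e.
have mA2 e : measurable (A2 e) by rewrite /A2; case: ifP.
have A2J e : e \in J -> A2 e = A e by rewrite /A2 => ->.
have A2J' e : e \in J' -> A2 e = A' e.
  by move=> eJ'; rewrite /A2 ifF //; apply: contraTF eJ' => /dJ.
have -> : cylinder J A `&` cylinder J' A' = cylinder (J :|: J') A2.
  apply/seteqP; split=> o.
    move=> [h h'] e; rewrite inE => /orP[eJ|eJ]; first by rewrite A2J //; exact: h.
    by rewrite A2J' //; exact: h'.
  move=> h; split=> e eJ; [rewrite -A2J //|rewrite -A2J' //];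
  by apply: h; rewrite inE eJ ?orbT.
rewrite /cylinder !ind // (eq_bigl [predU J & J']); last by move=> e; rewrite !inE.
rewrite bigU /=; last first.
  by apply/pred0P => e /=; apply/negbTE/negP => /andP[/dJ /negP].
by congr (_ * _)%E; apply: eq_bigr => e eJ; [rewrite A2J|rewrite A2J'].
Qed.

End Cylinders.

Context (I : finType) (b : I -> Om -> bool) (w : I -> Om -> C).
Hypotheses (bm : forall e, measurable_fun setT (b e))
  (wm : forall e, measurable_fun setT (@complex_pair R \o w e))
  (b_ind : independent_family P b)
  (w_ind : independent_family P (fun e => @complex_pair R \o w e))
  (bw_ind : independent_families P b (fun e => @complex_pair R \o w e)).
Local Notation pw := (fun e => @complex_pair R \o w e).

(** Rectangles in the variables [b e] and [w e] for e in J: a class closed under intersection on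
    which independence is checked directly before being extended to the generated sigma-algebra. *)
Definition rect (J : {set I}) : set (set Om) :=
  [set E | exists (B : I -> set bool) (A : I -> set (R * R)),
     (forall e, measurable (A e)) /\ E = cylinder b J B `&` cylinder pw J A].

Lemma rect_measurable J : rect J `<=` measurable.
Proof.
by move=> _ [B [A [mA ->]]]; apply: measurableI; exact: cylinder_measurable.
Qed.

Lemma rect_setI J : setI_closed (rect J).
Proof.
move=> _ _ [B [A [mA ->]]] [B' [A' [mA' ->]]].
exists (fun e => B e `&` B' e), (fun e => A e `&` A' e); split.
  by move=> e; exact: measurableI.
apply/seteqP; split=> o.
  by move=> [[h1 h2] [h3 h4]]; split=> e eJ; split; [exact: h1|exact: h3|exact: h2|exact: h4].
by move=> [h1 h2]; split; split=> e eJ; [have [] := h1 e eJ|have [] := h2 e eJ|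
  have [] := h1 e eJ|have [] := h2 e eJ].
Qed.

Lemma rect_setT J : rect J setT.
Proof.
exists (fun=> setT), (fun=> setT); split=> //.
by apply/seteqP; split=> o.
Qed.

(** The probability is split between b and w, then between J and J' within each family, and the four
    factors are regrouped by index set. *)
Lemma rect_indep (J J' : {set I}) : (forall e, e \in J -> e \notin J') ->
  indep_systems P (rect J) (rect J').
Proof.
move=> dJ _ _ [B [A [mA ->]]] [B' [A' [mA' ->]]].
have mB (D : I -> set bool) e : measurable (D e) by [].
have bw (E F : set Om) : family_sigma b E -> family_sigma pw F ->
  P (E `&` F) = (P E * P F)%E by exact: bw_ind.
have sb J0 (D : I -> set bool) : family_sigma b (cylinder b J0 D).
  exact: (@cylinder_sigma _ _ I b J0 D (mB D)).
have sw J0 (D : I -> set (R * R)) : (forall e, measurable (D e)) ->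
    family_sigma pw (cylinder pw J0 D).
  by move=> mD; exact: (@cylinder_sigma _ _ I pw J0 D mD).
have sI (G : set (set Om)) (E F : set Om) : <<s G >> E -> <<s G >> F ->
    <<s G >> (E `&` F).
  by move=> hE hF; exact: (@measurableI _ (g_sigma_algebraType G)).
rewrite setIACA bw; first last.
- by apply: sI; exact: sw.
- by apply: sI; exact: sb.
rewrite (cylinder_indep b_ind dJ (mB B) (mB B')) (cylinder_indep w_ind dJ mA mA').
rewrite (bw _ _ (sb _ _) (sw _ _ mA)) (bw _ _ (sb _ _) (sw _ _ mA')).
exact: muleACA.
Qed.

Lemma rect_b (J : {set I}) e : e \in J -> measurable_fun setT (b e : g_sigma_algebraType (rect J) -> bool).
Proof.
move=> eJ _ Y _; rewrite setTI; apply: sub_sigma_algebra.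
exists (fun e' => if e' == e then Y else setT), (fun=> setT); split=> //.
apply/seteqP; split=> o /=.
  by move=> Yo; split=> // e' _; case: eqP => [->|].
by move=> [h _]; have := h e eJ; rewrite eqxx.
Qed.

Lemma rect_w (J : {set I}) e : e \in J -> cmeasurable (w e : g_sigma_algebraType (rect J) -> C).
Proof.
move=> eJ; have m : measurable_fun setT (pw e : g_sigma_algebraType (rect J) -> R * R).
  move=> _ Y mY; rewrite setTI; apply: sub_sigma_algebra.
  exists (fun=> setT), (fun e' => if e' == e then Y else setT); split=> [e'|].
    by case: ifP.
  apply/seteqP; split=> o /=.
    by move=> Yo; split=> // e' _; case: eqP => [->|].
  by move=> [_ h]; have := h e eJ; rewrite eqxx.
by split; [exact: (measurableT_comp measurable_fst m)|exact: (measurableT_comp measurable_snd m)].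
Qed.

Variable a : R.
Definition entry (e : I) (o : Om) : C := (a * (b e o)%:R)%:C%C * w e o.

Let cmeas_entry d' (T : measurableType d') (beta : T -> bool) (om : T -> C) :
  measurable_fun setT beta -> cmeasurable om ->
  cmeasurable (fun t => (a * (beta t)%:R)%:C%C * om t).
Proof.
move=> mb mo; apply: cmeasurableM => //; apply: cmeasurable_real.
apply: measurable_funM; first exact: measurable_cst.
have mr : measurable_fun setT (fun x : bool => x%:R : R) by [].
exact: measurableT_comp mr mb.
Qed.

Lemma entry_decoupled : decoupled P entry.
Proof.
move=> J; exists (rect J), (rect (~: J)); split.
- exact: rect_measurable.
- exact: rect_measurable.
- apply: indep_systems_sigma; try exact: rect_measurable;
    try exact: rect_setI; try exact: rect_setT.
  by apply: rect_indep => e eJ; rewrite inE eJ.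
- by move=> e eJ; apply: cmeas_entry; [exact: rect_b|exact: rect_w].
- by move=> e eJ; apply: cmeas_entry; [apply: rect_b|apply: rect_w]; rewrite inE.
Qed.

Lemma w_measurable e : cmeasurable (w e).
Proof.
by split; [exact: (measurableT_comp measurable_fst (wm e))|
  exact: (measurableT_comp measurable_snd (wm e))].
Qed.

Lemma entry_measurable e : cmeasurable (entry e).
Proof. by apply: cmeas_entry; [exact: bm|exact: w_measurable]. Qed.

Section Moments.
Variables (e : I) (s : R).
Hypothesis Pb : P [set o | b e o = true] = s%:E.

Let s0 : 0 <= s. Proof. by rewrite -lee_fin -Pb. Qed.

Let Gw := [set E : set Om | exists i (A : set (R * R)),
  measurable A /\ E = pw i @^-1` A].

(** [h] lives on the sigma-algebra of the w's, so decoupling it from the b's leaves the probability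
    of success as a factor. *)
Lemma thinned_mean (h : g_sigma_algebraType Gw -> R) : measurable_fun setT h ->
  (forall o, 0 <= h o) ->
  (\int[P]_o ((b e o)%:R * h o)%:E = s%:E * \int[P]_o (h o)%:E)%E.
Proof.
move=> mh h0; pose Gb := [set E : set Om | exists i (A : set bool),
  measurable A /\ E = b i @^-1` A].
have mGb : Gb `<=` measurable.
  by move=> _ [i [A [mA ->]]]; rewrite -[X in measurable X]setTI; exact: bm.
have mGw : Gw `<=` measurable.
  by move=> _ [i [A [mA ->]]]; rewrite -[X in measurable X]setTI; exact: wm.
have mb : measurable_fun setT (b e : g_sigma_algebraType Gb -> bool).
  by move=> _ Y mY; rewrite setTI; apply: sub_sigma_algebra; exists e, Y.
have mr : measurable_fun setT (fun x : bool => x%:R : R) by [].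
pose Phi (x : g_sigma_algebraType Gb * g_sigma_algebraType Gw) :=
  ((b e x.1)%:R * h x.2)%:E.
have mPhi : measurable_fun setT Phi.
  apply/measurable_EFinP; apply: measurable_funM.
    exact: (measurableT_comp mr (measurableT_comp mb measurable_fst)).
  exact: (measurableT_comp mh measurable_snd).
have Phi0 x : (0 <= Phi x)%E by rewrite lee_fin mulr_ge0 // ler0n.
have := decouple mGb mGw bw_ind mPhi Phi0; rewrite /Phi /= => ->.
have mhP : measurable_fun setT (h : Om -> R).
  move=> mT Y mY; have := mh measurableT Y mY; rewrite !setTI.
  exact: (smallest_sub (@sigma_algebra_measurable _ Om) mGw).
have h0' : (0 <= \int[P]_o (h o)%:E)%E by apply: integral_ge0 => o _; rewrite lee_fin.
have inner o : (\int[P]_o' ((b e o)%:R * h o')%:E =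
    ((b e o)%:R)%:E * \int[P]_o' (h o')%:E)%E.
  under eq_integral do rewrite EFinM.
  rewrite ge0_integralZl_EFin //; last exact/measurable_EFinP.
  by move=> o' _; rewrite lee_fin.
under eq_integral do rewrite inner.
have bm' : measurable_fun setT (fun o => ((b e o)%:R : R)%:E).
  by apply/measurable_EFinP; exact: (measurableT_comp mr (bm e)).
rewrite (ge0_integralZr _ _ bm') //.
congr (_ * _)%E; rewrite -Pb.
have mE : measurable [set o | b e o = true].
  have m1 : measurable [set true] by [].
  by have := bm e measurableT m1; rewrite setTI.
rewrite -[X in _ = P X]setIT -integral_indic //; apply: eq_integral => o _.
rewrite indicE; congr ((nat_of_bool _)%:R)%:E.
by apply/idP/idP => [bo|/set_mem //]; exact: mem_set.
Qed.

Variables (sg2 K4 : R).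
Hypotheses (w1 : cintegral P setT (w e) = 0)
  (w2 : (\int[P]_o (nc (w e o) ^+ 2)%:E = sg2%:E)%E)
  (w4 : (\int[P]_o (nc (w e o) ^+ 4)%:E <= K4%:E)%E).

Let cw : cmeasurable (w e : g_sigma_algebraType Gw -> C).
Proof.
have m : measurable_fun setT (pw e : g_sigma_algebraType Gw -> R * R).
  by move=> _ Y mY; rewrite setTI; apply: sub_sigma_algebra; exists e, Y.
by split; [exact: (measurableT_comp measurable_fst m)|exact: (measurableT_comp measurable_snd m)].
Qed.

Let nonneg_integrable (f : Om -> R) (F : R) : measurable_fun setT f ->
  (forall o, 0 <= f o) -> (\int[P]_o (f o)%:E <= F%:E)%E ->
  P.-integrable setT (EFin \o f) /\ (\int[P]_o f o)%:E = (\int[P]_o (f o)%:E)%E.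
Proof.
move=> mf f0 fF; have i : P.-integrable setT (EFin \o f).
  apply/integrableP; split; first exact/measurable_EFinP.
  apply: le_lt_trans (ltry F); apply: le_trans fF.
  by rewrite le_eqVlt; apply/orP; left; apply/eqP; apply: eq_integral => o _;
    rewrite /= ger0_norm.
by split=> //; rewrite fineK // integrable_fin_num.
Qed.

Let nc_entry o : nc (entry e o) = `|a| * ((b e o)%:R * nc (w e o)).
Proof.
rewrite /entry Normc.normcM normc_real normrM -mulrA; congr (_ * (_ * _)).
by rewrite ger0_norm // ler0n.
Qed.

Let bexp (o : Om) k : ((b e o)%:R : R) ^+ k.+1 = (b e o)%:R.
Proof. by case: (b e o); rewrite ?expr1n // expr0n. Qed.

Let even_moment k (F : R) : (\int[P]_o (nc (w e o) ^+ k.+1)%:E <= F%:E)%E ->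
  P.-integrable setT (EFin \o (fun o => nc (entry e o) ^+ k.+1)) /\
  (\int[P]_o (nc (entry e o) ^+ k.+1))%:E =
    ((`|a| ^+ k.+1 * s)%:E * \int[P]_o (nc (w e o) ^+ k.+1)%:E)%E.
Proof.
move=> hF.
have mw : measurable_fun setT
    ((fun o => nc (w e o) ^+ k.+1) : g_sigma_algebraType Gw -> R).
  by apply: measurable_funX; exact: measurable_normc.
have w0 o : 0 <= nc (w e o) ^+ k.+1 by rewrite exprn_ge0 // normc_ge0.
have E : (\int[P]_o (nc (entry e o) ^+ k.+1)%:E =
    (`|a| ^+ k.+1 * s)%:E * \int[P]_o (nc (w e o) ^+ k.+1)%:E)%E.
  under eq_integral do rewrite nc_entry exprMn exprMn bexp EFinM.
  rewrite ge0_integralZl_EFin //; first last.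
  - apply/measurable_EFinP; apply: measurable_funM; last first.
      by apply: measurable_funX; apply: measurable_normc; exact: w_measurable.
    have mr : measurable_fun setT (fun x : bool => x%:R : R) by [].
    exact: (measurableT_comp mr (bm e)).
  - by move=> o _; rewrite lee_fin mulr_ge0.
  by rewrite (thinned_mean mw w0) EFinM muleA.
have mE : measurable_fun setT (fun o => nc (entry e o) ^+ k.+1).
  by apply: measurable_funX; apply: measurable_normc; exact: entry_measurable.
have e0 o : 0 <= nc (entry e o) ^+ k.+1 by rewrite exprn_ge0 // normc_ge0.
have [|i ->] := nonneg_integrable (F := `|a| ^+ k.+1 * s * F) mE e0.
  rewrite E [leRHS]EFinM; apply: lee_wpmul2l => //.
  by rewrite lee_fin mulr_ge0 // exprn_ge0.
by split.
Qed.

(** [thinned_mean] is about nonnegative functions, so h is split into its positive and negative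
    parts, both integrable because r <= 1 + r^2. *)
Let component (h : C -> R) : (forall z, `|h z| <= nc z) ->
  (forall (r : R) z, h (r%:C%C * z) = r * h z) ->
  measurable_fun setT ((fun o => h (w e o)) : g_sigma_algebraType Gw -> R) ->
  \int[P]_o h (w e o) = 0 ->
  P.-integrable setT (EFin \o (fun o => h (entry e o))) /\
  \int[P]_o h (entry e o) = 0.
Proof.
move=> hn hM mh h1.
have mhP : measurable_fun setT (fun o => h (w e o)).
  have mGw : Gw `<=` measurable.
    by move=> _ [i [A [mA ->]]]; rewrite -[X in measurable X]setTI; exact: wm.
  move=> mT Y mY; have := mh measurableT Y mY; rewrite !setTI.
  exact: (smallest_sub (@sigma_algebra_measurable _ Om) mGw).
have half (g : R -> R) : measurable_fun setT g -> (forall t, 0 <= g t <= `|t|) ->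
   P.-integrable setT (EFin \o (fun o => g (h (w e o)))) /\
   P.-integrable setT (EFin \o (fun o => (b e o)%:R * g (h (w e o)))) /\
   \int[P]_o ((b e o)%:R * g (h (w e o))) = s * \int[P]_o g (h (w e o)).
  move=> mg g0.
  have g0' o : 0 <= g (h (w e o)) by have /andP[] := g0 (h (w e o)).
  have mgw := measurableT_comp mg mhP.
  have mr : measurable_fun setT (fun x : bool => x%:R : R) by [].
  have mbg : measurable_fun setT (fun o => (b e o)%:R * g (h (w e o))).
    by apply: measurable_funM => //; exact: (measurableT_comp mr (bm e)).
  have gF : (\int[P]_o (g (h (w e o)))%:E <= (1 + sg2)%:E)%E.
    apply: le_trans (_ : (\int[P]_o (1 + nc (w e o) ^+ 2)%:E <= _)%E).
      apply: ge0_le_integral => //.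
      - by move=> o _; rewrite lee_fin.
      - exact/measurable_EFinP.
      - apply/measurable_EFinP; apply: measurable_funD; first exact: measurable_cst.
        by apply: measurable_normc2; exact: w_measurable.
      move=> o _; rewrite lee_fin; have /andP[_ h3] := g0 (h (w e o)).
      apply: le_trans h3 _; apply: le_trans (hn _) _.
      by have := sqr_ge0 (nc (w e o) - 2^-1); rewrite sqrrB; lra.
    under eq_integral do rewrite EFinD.
    rewrite ge0_integralD //; first last.
    - apply/measurable_EFinP; apply: measurable_normc2; exact: w_measurable.
    - by move=> o _; rewrite lee_fin sqr_ge0.
    by rewrite w2 integral_cst //= [X in (_ * X + _)%E](@probability_setT _ _ _ P) mule1.
  have [i1 e1] := nonneg_integrable mgw g0' gF.
  have tm := @thinned_mean (fun o => g (h (w e o))) (measurableT_comp mg mh) g0'.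
  have bgF : (\int[P]_o ((b e o)%:R * g (h (w e o)))%:E <= (s * (1 + sg2))%:E)%E.
    by rewrite tm [leRHS]EFinM; apply: lee_wpmul2l => //; rewrite lee_fin.
  have bg0 o : 0 <= (b e o)%:R * g (h (w e o)) by rewrite mulr_ge0 // ler0n.
  have [i2 e2] := nonneg_integrable mbg bg0 bgF.
  split=> //; split=> //.
  by apply: EFin_inj; rewrite e2 tm -e1.
have [i1 [i2 e1]] := half (fun t => Num.max t 0)
  (measurable_maxr (@measurable_id _ _ _) (@measurable_cst _ _ _ _ _ _)) (fun t => ltac:(
     by rewrite le_max lexx orbT /= ge_max normr_ge0 ler_norm)).
have [j1 [j2 e2]] := half (fun t => Num.max (- t) 0)
  (measurable_maxr (measurable_funN (@measurable_id _ _ _)) (@measurable_cst _ _ _ _ _ _)) (fun t => ltac:(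
     by rewrite le_max lexx orbT /= ge_max normr_ge0 -normrN ler_norm)).
have tE (t : R) : t = Num.max t 0 - Num.max (- t) 0.
  by case: (lerP t 0) => ?; [rewrite (max_idPl _)|rewrite (max_idPr _)]; lra.
have hE : (fun o => h (entry e o)) = fun o =>
   a * ((b e o)%:R * Num.max (h (w e o)) 0 - (b e o)%:R * Num.max (- h (w e o)) 0).
  by apply/funext => o; rewrite /entry hM -mulrBr -tE mulrA.
have iB : P.-integrable setT (EFin \o (fun o => (b e o)%:R * Num.max (h (w e o)) 0
   - (b e o)%:R * Num.max (- h (w e o)) 0)).
  by apply: eq_integrable (integrableB measurableT i2 j2).
rewrite hE; split.
  by apply: eq_integrable (integrableZl measurableT a iB).
rewrite RintegralZl // RintegralB // e1 e2 -mulrBr -RintegralB //.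
under eq_Rintegral do rewrite -tE.
by rewrite h1 !mulr0.
Qed.

(** A Bernoulli variable equals its positive powers, so all moments receive the same factor s. With
    a^2 = 1/q^2 and s = q^2/n, the variance is of order 1/n but the fourth moment only of order 1/(n
    q^2). *)
Lemma entry_centered : centered P (entry e) (a ^+ 2 * s * sg2) (a ^+ 4 * s * K4).
Proof.
move: w1; rewrite /cintegral => -[r1 r2]; have [m1 m2] := cw.
split.
- apply: component => // [z|r z]; first exact: normc_Re.
  by case: z => x1 x2 /=; rewrite mul0r subr0.
- apply: component => // [z|r z]; first exact: normc_Im.
  by case: z => x1 x2 /=; rewrite mul0r addr0.
- have [|i E] := @even_moment 1 sg2; first by rewrite w2.
  by split=> //; apply: EFin_inj; rewrite E w2 -EFinM real_normK ?num_real.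
- have [i E] := @even_moment 3 K4 w4; split=> //.
  rewrite -lee_fin E [leRHS]EFinM.
  have -> : `|a| ^+ 4 = a ^+ 4 by rewrite -normrX ger0_norm // exprn_even_ge0.
  by apply: lee_wpmul2l => //; rewrite lee_fin mulr_ge0 // exprn_even_ge0.
Qed.

End Moments.
End Model.

(** * Error in the Schur complement of one row *)

Section FixedSize.
Context d (Om : measurableType d) (R : realType) (P : probability Om R).
Local Notation C := R[i].
Local Notation nc := (@Normc.normc R).

Lemma normc_conj (z : C) : nc z^* = nc z.
Proof. by case: z => a b /=; rewrite sqrrN. Qed.

Definition mxof (p n : nat) (a : 'I_p * 'I_n -> C) : 'M[C]_(p, n) :=
  \matrix_(i, j) a (i, j).

(** The entries of the adjoint matrix, through which every estimate on rows is transferred to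
    columns. *)
Definition adj_index (p n : nat) (Y : 'I_p * 'I_n -> Om -> C)
    (e : 'I_n * 'I_p) (o : Om) : C := (Y (e.2, e.1) o)^*.

Lemma adj_decoupled p n (Y : 'I_p * 'I_n -> Om -> C) :
  decoupled P Y -> decoupled P (adj_index Y).
Proof.
move=> dY J; pose J' : {set 'I_p * 'I_n} := [set e | (e.2, e.1) \in J]%SET.
have [G1 [G2 [m1 m2 ind c1 c2]]] := dY J'.
exists G1, G2; split=> // -[j i] eJ; apply: cmeasurable_conj.
  by apply: c1; rewrite inE.
by apply: c2; rewrite inE.
Qed.

Lemma centered_conj (X : Om -> C) v k : centered P X v k ->
  centered P (fun o => (X o)^*) v k.
Proof.
move=> [[i1 e1] [i2 e2] h3 h4]; split.
- have -> : (fun o => complex.Re (X o)^*) = (fun o => complex.Re (X o)).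
    by apply/funext => o; case: (X o).
  by [].
- have -> : (fun o => complex.Im (X o)^*) = (fun o => -1 * complex.Im (X o)).
    by apply/funext => o; case: (X o) => a b /=; rewrite mulN1r.
  split; first by apply: eq_integrable (integrableZl measurableT (-1) i2).
  by rewrite RintegralZl // e2 mulr0.
- by under eq_fun do rewrite normc_conj.
- by under eq_fun do rewrite normc_conj.
Qed.

Section RowError.
Variables (p n : nat) (Y : 'I_p * 'I_n -> Om -> C) (V : 'I_p -> 'I_n -> R) (vb kappa x : R).
Hypotheses (Ydec : decoupled P Y) (Ymeas : forall e, cmeasurable (Y e))
  (Ycent : forall i j, centered P (Y (i, j)) (V i j) kappa)
  (Vvb : forall i j, V i j <= vb) (V0 : forall i j, 0 <= V i j)
  (n0 : (0 < n)%N) (x0 : 0 < x).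
Local Notation z := (- x%:C%C : C).

Let xC : 0 < x%:C%C :> C. Proof. by rewrite ltcR. Qed.
Let zP : ~~ (0 <= z). Proof. exact: oppr_pos_nge0. Qed.

(** For independent centered entries with variances V, the subtracted sum is the conditional mean of
    the row form given the other rows. *)
Definition row_err (i : 'I_p) (a : 'I_p * 'I_n -> C) : C :=
  row_form (mxof a) z i - \sum_j (V i j)%:C%C *
    invmx ((zero_row (mxof a) i)^t* *m zero_row (mxof a) i - z%:M) j j.

Lemma mxof_measurable (m k : nat) d' (T : measurableType d') (A : T -> 'I_m * 'I_k -> C) :
  (forall e, cmeasurable (fun t => A t e)) -> mx_measurable (fun t => mxof (A t)).
Proof. by move=> mA i j; under eq_fun do rewrite mxE. Qed.

Let zero_row_inv_measurable d' (T : measurableType d') (A : T -> 'I_p * 'I_n -> C) i :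
  (forall e, cmeasurable (fun t => A t e)) ->
  mx_measurable (fun t => invmx ((zero_row (mxof (A t)) i)^t* *m
     zero_row (mxof (A t)) i - z%:M)).
Proof.
move=> mA; apply: mx_measurable_inv => [t|]; first exact: gram_unitmxC.
have mz : mx_measurable (fun t => zero_row (mxof (A t)) i).
  move=> k l; under eq_fun do rewrite mxE; case: (k == i).
    exact: cmeasurable_cst.
  by under eq_fun do rewrite mxE.
move=> k l; under eq_fun do rewrite mxE [X in _ + X]mxE.
apply: cmeasurableD; last exact: cmeasurable_cst.
exact: (mx_measurable_mul (mx_measurable_trC mz) mz).
Qed.

Lemma row_err_measurable d' (T : measurableType d') (A : T -> 'I_p * 'I_n -> C) i :
  (forall e, cmeasurable (fun t => A t e)) -> cmeasurable (fun t => row_err i (A t)).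
Proof.
move=> mA; have mi := zero_row_inv_measurable i mA.
have mr : mx_measurable (fun t => row i (mxof (A t))).
  by move=> k l; under eq_fun do rewrite !mxE.
apply: cmeasurableD.
  exact: (mx_measurable_mul (mx_measurable_mul mr mi) (mx_measurable_trC mr)).
apply: cmeasurableN; apply: cmeasurable_sum => j.
by apply: cmeasurableM; [exact: cmeasurable_cst|exact: mi].
Qed.

(** With the other rows frozen, the resolvent is deterministic with rows and columns of squared l2
    norm at most 1/x^2, and the error is a [qform] in the entries of row i. *)
Lemma row_error i :
  (\int[P]_o (nc (row_err i (fun e => Y e o)) ^+ 2)%:E <=
    (n%:R * (x^-1 ^+ 2 * (18 * vb ^+ 2 + 3 * kappa)))%:E)%E.
Proof.
pose J : {set 'I_p * 'I_n} := [set e | e.1 != i]%SET.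
have gf : good (fun a => nc (row_err i a) ^+ 2).
  by move=> d' T A mA; apply: measurable_normc2; exact: row_err_measurable.
rewrite (decouple_mix Ydec J gf (fun a => sqr_ge0 _)).
set K := n%:R * _.
apply: le_trans (_ : (\int[P]_o K%:E <= _)%E); last first.
  by rewrite integral_cst // [X in (_ * X)%E](@probability_setT _ _ _ P) mule1.
apply: ge0_le_integral => //.
- by move=> o _; apply: integral_ge0 => o' _; rewrite lee_fin sqr_ge0.
- exact: (mix_integral_measurable P Ymeas J gf (fun a => sqr_ge0 _)).
move=> o _; pose M := mxof (fun e => Y e o).
pose H := invmx ((zero_row M i)^t* *m zero_row M i - z%:M).
(* [qform] is indexed by natural numbers. The default [j0] is returned only from n on, where the
   sums never reach. *)
pose j0 : 'I_n := Ordinal n0; pose io k : 'I_n := insubd j0 k.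
have ioE (k : 'I_n) : io k = k by rewrite /io valKd.
pose A k l := H (io k) (io l); pose L k := (i, io k).
have Linj k l : (k < n)%N -> (l < n)%N -> L k = L l -> k = l.
  by move=> kn ln [] /(congr1 val); rewrite !val_insubd kn ln.
have Hnorm k : \sum_l nc (H k l) ^+ 2 <= x^-1 ^+ 2.
  rewrite -lecR rmorph_sum rmorphXn fmorphV /=.
  apply: le_trans (resolvent_row_norm_le xC (zero_row M i) k).
  rewrite le_eqVlt; apply/orP; left; apply/eqP; apply: eq_bigr => l _.
  by rewrite rmorphXn.
have Hsym k l : nc (H k l) = nc (H l k).
  have := congr1 (fun B : 'M[C]_n => B k l) (resolvent_herm xC (zero_row M i)).
  by rewrite !mxE -/H => <-; rewrite normc_conj.
have widen (g : 'I_n -> R) k : (forall l, 0 <= g l) -> (k < n)%N ->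
    \sum_(l < k.+1) g (io l) <= \sum_l g l.
  move=> g0 kn; rewrite -[leRHS](eq_bigr _ (fun l _ => congr1 g (ioE l))).
  rewrite (big_ord_widen n (fun l => g (io l))) //.
  by rewrite [leRHS](bigID (fun l : 'I_n => (l < k.+1)%N)) /= lerDl sumr_ge0.
have Arow k : (k < n)%N -> \sum_(l < k.+1) nc (A k l) ^+ 2 <= x^-1 ^+ 2.
  move=> kn; apply: le_trans (Hnorm (io k)).
  by apply: (widen (fun l => nc (H (io k) l) ^+ 2)) => // l; exact: sqr_ge0.
have Acol k : (k < n)%N -> \sum_(l < k.+1) nc (A l k) ^+ 2 <= x^-1 ^+ 2.
  move=> kn; under eq_bigr do rewrite /A Hsym; exact: Arow.
have cent k : (k < n)%N -> centered P (Y (L k)) (V i (io k)) kappa.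
  by move=> _; exact: Ycent.
have := qform_second_moment Ydec Ymeas Linj cent (fun k _ => Vvb i (io k)) Arow Acol (leqnn n).
apply: le_trans; rewrite le_eqVlt; apply/orP; left; apply/eqP.
apply: eq_integral => o' _; congr ((nc _ ^+ 2)%:E).
have zE : zero_row (mxof (mix J (fun e => Y e o) (fun e => Y e o'))) i = zero_row M i.
  by apply/matrixP => k l; rewrite !mxE; case: eqP => // /eqP ki; rewrite /mix inE /= ki.
rewrite /row_err /row_form zE -/H /qform; congr (_ - _); last first.
  by apply: eq_bigr => j _; rewrite /A ioE.
rewrite mxE exchange_big /=; apply: eq_bigr => l _.
rewrite mxE mulr_suml; apply: eq_bigr => j _.
by rewrite !mxE /L /A !ioE /mix !inE /= eqxx.
Qed.

End RowError.
End FixedSize.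

(** * Comparison of the resolvent diagonal with the exact solution *)

Section Stability.
Context (R : realType).
Local Notation C := R[i].
Local Notation nc := (@Normc.normc R).

Definition adj_fun (p n : nat) (a : 'I_p * 'I_n -> C) (e : 'I_n * 'I_p) : C :=
  (a (e.2, e.1))^*.

Lemma mxof_adj_fun p n (a : 'I_p * 'I_n -> C) : mxof (adj_fun a) = (mxof a)^t*.
Proof. by apply/matrixP => i j; rewrite !mxE. Qed.

Lemma normc_le_pos (D : C) (y : R) : 0 <= D -> D <= y%:C%C -> nc D <= y.
Proof. by move=> D0 Dy; rewrite -lecR -normcE ger0_norm. Qed.

Section OneSide.
Variables (p n : nat) (V : 'I_p -> 'I_n -> R) (W vb x : R).
Hypotheses (V0 : forall i j, 0 <= V i j) (VW : forall j, \sum_i V i j <= W)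
  (vb0 : 0 <= vb) (Vvb : forall i j, V i j <= vb) (x0 : 0 < x).
Local Notation z := (- x%:C%C : C).
Variables (a : 'I_p * 'I_n -> C) (u : 'I_n -> C).
Hypothesis u0 : forall j, 0 <= u j.
Local Notation M := (mxof a).

Let xC : 0 < x%:C%C :> C. Proof. by rewrite ltcR. Qed.

(** The defect of row i is [row_err] plus the effect of replacing the reduced resolvent by the full
    one. The latter is at most vb / x, since the diagonal differences are nonnegative with sum at
    most 1/x. *)
Lemma row_stability :
  \sum_i nc (invmx (M *m M^t* - z%:M) i i - smap V u z i) <=
  x^-1 * (\sum_i nc (row_err V x i a) + p%:R * (vb / x) +
          W * \sum_j nc (invmx (M^t* *m M - z%:M) j j - u j)).
Proof.
pose g j := invmx (M^t* *m M - z%:M) j j.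
pose e i := row_form M z i - \sum_j (V i j)%:C%C * g j.
have eq i : \sum_j (V i j)%:C%C * g j + e i = row_form M z i.
  by rewrite addrC subrK.
have ee i : nc (e i) <= nc (row_err V x i a) + vb / x.
  pose H j := invmx ((zero_row M i)^t* *m zero_row M i - z%:M) j j.
  have gH j : 0 <= H j - g j by rewrite subr_ge0; exact: resolvent_zero_row_ge.
  have -> : e i = row_err V x i a + \sum_j (V i j)%:C%C * (H j - g j).
    under eq_bigr do rewrite mulrBr.
    by rewrite sumrB /row_err /e /H addrA subrK.
  apply: le_trans (normc_triangle _ _) _; rewrite lerD2l; apply: normc_le_pos.
    by apply: sumr_ge0 => j _; rewrite mulr_ge0 // lecR.
  apply: le_trans (_ : \sum_j vb%:C%C * (H j - g j) <= _).
    by apply: ler_sum => j _; rewrite ler_wpM2r // lecR.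
  rewrite -mulr_sumr rmorphM /= ler_wpM2l ?lecR // sumrB fmorphV.
  by rewrite lerBlDr addrC; exact: (resolvent_zero_row_trace xC M i).
have h : forall i, 0 <= \sum_j (V i j)%:C%C * g j + e i.
  by move=> i; rewrite eq; exact: row_form_ge0.
have := smap_pert V0 VW x0 u0 h.
have -> : \sum_i nc (-1 / (z * (1 + (\sum_j (V i j)%:C%C * g j + e i))) - smap V u z i)
   = \sum_i nc (invmx (M *m M^t* - z%:M) i i - smap V u z i).
  apply: eq_bigr => i _; congr (nc (_ - _)).
  rewrite resolvent_diag ?oppr_pos_nge0 // eq invfM mulrA mulN1r //.
move=> /le_trans; apply; rewrite ler_pM2l ?invr_gt0 // lerD2r.
apply: le_trans (ler_sum _ (fun i _ => ee i)) _.
by rewrite big_split /= sumr_const card_ord mulr_natl.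
Qed.

End OneSide.

(** [row_stability] for the matrix and for its adjoint bounds each of the two l1 distances by its
    own error plus W/x times the other distance. As W/x <= 1/2, the distances are absorbed on the
    left. *)
Lemma diag_stability (p n : nat) (V : 'I_p -> 'I_n -> R) (W vb x : R)
    (a : 'I_p * 'I_n -> C) (t : 'I_p -> C) (u : 'I_n -> C) :
  (forall i j, 0 <= V i j) -> (forall j, \sum_i V i j <= W) ->
  (forall i, \sum_j V i j <= W) -> 0 <= vb -> (forall i j, V i j <= vb) ->
  0 < x -> W + W <= x -> (forall i, 0 <= t i) -> (forall j, 0 <= u j) ->
  let z := - x%:C%C : C in
  (forall i, t i = smap V u z i) -> (forall j, u j = smap (fun j i => V i j) t z j) ->
  \sum_i nc (invmx (mxof a *m (mxof a)^t* - z%:M) i i - t i) <=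
  2 * x^-1 * ((\sum_i nc (row_err V x i a) + p%:R * (vb / x)) +
    (\sum_j nc (row_err (fun j i => V i j) x j (adj_fun a)) + n%:R * (vb / x))).
Proof.
move=> V0 VW VW' vb0 Vvb x0 Wx t0 u0 z tE uE.
pose E1 := \sum_i nc (row_err V x i a) + p%:R * (vb / x).
pose E2 := \sum_j nc (row_err (fun j i => V i j) x j (adj_fun a)) + n%:R * (vb / x).
pose S := \sum_i nc (invmx (mxof a *m (mxof a)^t* - z%:M) i i - t i).
pose S' := \sum_j nc (invmx ((mxof a)^t* *m mxof a - z%:M) j j - u j).
have h1 : S <= x^-1 * (E1 + W * S').
  apply: le_trans (row_stability V0 VW vb0 Vvb x0 a u0).
  by rewrite le_eqVlt; apply/orP; left; apply/eqP; apply: eq_bigr => i _; rewrite tE.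
have h2 : S' <= x^-1 * (E2 + W * S).
  have := row_stability (fun j i => V0 i j) VW' vb0 (fun j i => Vvb i j) x0 (adj_fun a) t0.
  rewrite mxof_adj_fun trmxCK; apply: le_trans.
  by rewrite le_eqVlt; apply/orP; left; apply/eqP; apply: eq_bigr => i _; rewrite uE.
rewrite -/z -/S -/E1 -/E2.
have E10 : 0 <= E1.
  rewrite addr_ge0 ?sumr_ge0 // => [i _|]; first exact: normc_ge0.
  by rewrite mulr_ge0 // divr_ge0 // ltW.
have E20 : 0 <= E2.
  rewrite addr_ge0 ?sumr_ge0 // => [i _|]; first exact: normc_ge0.
  by rewrite mulr_ge0 // divr_ge0 // ltW.
have S0 : 0 <= S by apply: sumr_ge0 => i _; exact: normc_ge0.
have S'0 : 0 <= S' by apply: sumr_ge0 => i _; exact: normc_ge0.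
have y0 : 0 <= x^-1 by rewrite invr_ge0 ltW.
have yW : x^-1 * W <= 2^-1.
  by rewrite mulrC ler_pdivrMr //; lra.
have k1 := mulr_ge0 y0 E10; have k2 := mulr_ge0 y0 E20.
have w1 := ler_wpM2r S'0 yW; have w2 := ler_wpM2r S0 yW.
clearbody E1 E2 S S'; rewrite !mulrDr !mulrA in h1 h2 *.
rewrite -!(mulrA 2).
move: h1 h2 k1 k2 w1 w2.
move: (x^-1 * W * S') (x^-1 * W * S) (x^-1 * E1) (x^-1 * E2) => A B D E; lra.
Qed.

End Stability.

(** * Concentration and bias of the normalized trace *)

Section ResolventTrace.
Context d (Om : measurableType d) (R : realType) (P : probability Om R).
Local Notation C := R[i].
Local Notation nc := (@Normc.normc R).

Lemma ge0_complex (w : C) : 0 <= w -> w = (complex.Re w)%:C%C.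
Proof. by case: w => a b; rewrite lecE /= => /andP[/eqP->]. Qed.

Variables (p n : nat) (x : R).
Hypotheses (p0 : (0 < p)%N) (x0 : 0 < x).
Local Notation z := (- x%:C%C : C).

Definition trace_stat (a : 'I_p * 'I_n -> C) : R :=
  complex.Re (norm_trace_resolvent (mxof a *m (mxof a)^t*) z).

Lemma trace_statE a :
  norm_trace_resolvent (mxof a *m (mxof a)^t*) z = (trace_stat a)%:C%C.
Proof. exact/ge0_complex/(fin_stieltjes_neg (fin_stieltjes_trace _ p0)). Qed.

Lemma trace_stat_bound a : 0 <= trace_stat a <= x^-1.
Proof.
rewrite -!lecR -trace_statE (fin_stieltjes_neg (fin_stieltjes_trace _ p0)) //=.
exact: fin_stieltjes_bound_neg (fin_stieltjes_trace _ p0) x0.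
Qed.

Let zP : ~~ (0 <= z). Proof. by apply: oppr_pos_nge0; rewrite ltcR. Qed.

Lemma trace_stat_good : good trace_stat.
Proof.
move=> d' T A mA; have mM : mx_measurable (fun t => mxof (A t)) by exact: mxof_measurable.
suff [] : cmeasurable (fun t => norm_trace_resolvent (mxof (A t) *m (mxof (A t))^t*) z) by [].
apply: cmeasurableM; first exact: cmeasurable_cst.
apply: cmeasurable_sum => i; apply: mx_measurable_inv => [t|]; first exact: gram_unitmx.
move=> k l; under eq_fun do rewrite mxE [X in _ + X]mxE.
apply: cmeasurableD; last exact: cmeasurable_cst.
exact: (mx_measurable_mul mM (mx_measurable_trC mM)).
Qed.

(** By [resolvent_trace] the traces for the two Gram matrices differ by a constant, which cancels,
    and for Y^* Y a change of one row costs at most 1/x. This is the constant [c] of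
    [concentration], with the row number as rank. *)
Lemma trace_stat_change (k : nat) (a a' : 'I_p * 'I_n -> C) :
  (forall e, val e.1 != k -> a e = a' e) -> `|trace_stat a - trace_stat a'| <= (p%:R * x)^-1.
Proof.
move=> aa'; case: (ltnP k p) => kp; last first.
  have -> : a = a'.
    by apply/funext => e; apply: aa'; rewrite ltn_eqF // (leq_trans (ltn_ord _)).
  by rewrite subrr normr0 invr_ge0 mulr_ge0 ?ler0n // ltW.
have xC : 0 < x%:C%C :> C by rewrite ltcR.
rewrite -lecR -normc_real -normcE rmorphB /= -!trace_statE /norm_trace_resolvent.
rewrite -mulrBr normrM !resolvent_trace // opprD addrACA subrr addr0.
rewrite invfM rmorphM /= fmorphV rmorph_nat normfV.
rewrite [`|p%:R|]ger0_norm ?ler0n // ler_wpM2l ?invr_ge0 ?ler0n // fmorphV.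
apply: (@resolvent_trace_row_change _ _ _ _ xC _ _ (Ordinal kp)) => i' j ne.
by rewrite !mxE aa'.
Qed.

Variable Y : 'I_p * 'I_n -> Om -> C.
Hypotheses (Ydec : decoupled P Y) (Ymeas : forall e, cmeasurable (Y e)).
Local Notation F := (fun o => trace_stat (fun e => Y e o)).

Lemma trace_stat_bmeas : bmeas F.
Proof. exact: good_bmeas trace_stat_good trace_stat_bound Ymeas. Qed.

Lemma trace_concentration :
  \int[P]_o (F o - \int[P]_o F o) ^+ 4 <= 4 * p%:R ^+ 2 * (p%:R * x)^-1 ^+ 4.
Proof.
apply: (concentration Ydec Ymeas (rk := fun e => val e.1)
  _ trace_stat_good trace_stat_bound trace_stat_change).
by move=> e /=.
Qed.

Let integral_sum_le (k : nat) (f : 'I_k -> Om -> R) (D : R) :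
  (forall i, measurable_fun setT (f i)) -> (forall i o, 0 <= f i o) ->
  (forall i, (\int[P]_o (f i o)%:E <= D%:E)%E) ->
  (\int[P]_o (\sum_i f i o)%:E <= (k%:R * D)%:E)%E.
Proof.
move=> mf f0 fD; under eq_integral do rewrite -sumEFin.
rewrite ge0_integral_sum //; last 2 first.
- by move=> i; exact/measurable_EFinP.
- by move=> i o _; rewrite lee_fin.
apply: le_trans (lee_sum _ (fun i _ => fD i)) _.
by rewrite sumEFin sumr_const card_ord mulr_natl.
Qed.

Variables (V : 'I_p -> 'I_n -> R) (W vb kappa : R).
Hypotheses (Ycent : forall i j, centered P (Y (i, j)) (V i j) kappa)
  (V0 : forall i j, 0 <= V i j) (VW : forall j, \sum_i V i j <= W)
  (VW' : forall i, \sum_j V i j <= W) (vb0 : 0 <= vb) (Vvb : forall i j, V i j <= vb)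
  (n0 : (0 < n)%N) (Wx : W + W <= x).
Variables (t : 'I_p -> C) (u : 'I_n -> C).
Hypotheses (t0 : forall i, 0 <= t i) (u0 : forall j, 0 <= u j)
  (tE : forall i, t i = smap V u z i) (uE : forall j, u j = smap (fun j i => V i j) t z j).

Let m0 : R := complex.Re (p%:R^-1 * \sum_i t i).

Lemma trace_bias (eta : R) : 0 < eta ->
  `|\int[P]_o F o - m0| <= 2 * (p%:R * x)^-1 * ((p%:R + n%:R) * (eta + vb / x) +
     2 * p%:R * n%:R * (x^-1 ^+ 2 * (18 * vb ^+ 2 + 3 * kappa)) / eta).
Proof.
move=> eta0; set Q := 18 * _ + _.
have m0E : p%:R^-1 * \sum_i t i = m0%:C%C.
  by apply: ge0_complex; rewrite mulr_ge0 ?invr_ge0 ?ler0n ?sumr_ge0.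
pose r i o := nc (row_err V x i (fun e => Y e o)) ^+ 2.
pose r' j o := nc (row_err (fun j i => V i j) x j (fun e => adj_index Y e o)) ^+ 2.
pose c1 := 2 * (p%:R * x)^-1.
have c10 : 0 <= c1 by rewrite mulr_ge0 // invr_ge0 mulr_ge0 ?ler0n // ltW.
(* The errors enter linearly but only their second moments are known. The free parameter eta bridges
   the two and is fixed only when n tends to infinity. *)
have amgm (s : R) : s <= eta + s ^+ 2 / eta.
  rewrite -(ler_pM2r eta0) mulrDl divfK ?gt_eqF //.
  by have := sqr_ge0 (s - eta); have := sqr_ge0 s; have := sqr_ge0 eta; rewrite sqrrB; lra.
have bound o : `|F o - m0| <= c1 * (p%:R + n%:R) * (eta + vb / x) +
    c1 / eta * (\sum_i r i o + \sum_j r' j o).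
  rewrite -lecR -normc_real -normcE rmorphB /= -trace_statE -m0E.
  rewrite /norm_trace_resolvent -mulrBr /mxtrace -sumrB normrM normfV.
  rewrite [`|p%:R|]ger0_norm ?ler0n // normcE -[p%:R](rmorph_nat (@real_complex R)).
  rewrite -fmorphV -rmorphM lecR; apply: le_trans (ler_wpM2l _ (normc_sum _ _ _)) _.
    by rewrite invr_ge0 ler0n.
  have := diag_stability (fun e => Y e o) V0 VW VW' vb0 Vvb x0 Wx t0 u0 tE uE.
  move=> /(ler_wpM2l (_ : 0 <= p%:R^-1)) h; apply: le_trans (h _) _.
    by rewrite invr_ge0 ler0n.
  have -> : forall E : R, p%:R^-1 * (2 * x^-1 * E) = c1 * E.
    by move=> E; rewrite /c1 invfM; ring.
  apply: le_trans (_ : c1 * ((p%:R + n%:R) * (eta + vb / x) +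
    eta^-1 * (\sum_i r i o + \sum_j r' j o)) <= _); last first.
    by rewrite mulrDr (mulrA c1) (mulrA c1).
  apply: ler_wpM2l => //.
  have h1 : \sum_i nc (row_err V x i (fun e => Y e o)) <= p%:R * eta + eta^-1 * \sum_i r i o.
    apply: le_trans (ler_sum _ (fun i _ => amgm _)) _.
    by rewrite big_split /= sumr_const card_ord -[eta *+ _]mulr_natl -mulr_suml [X in _ + X]mulrC.
  have h2 : \sum_j nc (row_err (fun j i => V i j) x j (adj_fun (fun e => Y e o))) <=
      n%:R * eta + eta^-1 * \sum_j r' j o.
    apply: le_trans (ler_sum _ (fun i _ => amgm _)) _.
    by rewrite big_split /= sumr_const card_ord -[eta *+ _]mulr_natl -mulr_suml [X in _ + X]mulrC.
  move: h1 h2; rewrite [X in _ -> _ -> _ <= _ + X]mulrDr.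
  move: (\sum_i nc _) (\sum_j nc _) (eta^-1 * \sum_i _) (eta^-1 * \sum_j _) (vb / x).
  by move=> A B D E G; rewrite mulrDl !mulrDr; lra.
have mY' e : cmeasurable (adj_index Y e) by exact: cmeasurable_conj.
have Rr : (\int[P]_o (\sum_i r i o)%:E <= (p%:R * (n%:R * (x^-1 ^+ 2 * Q)))%:E)%E.
  apply: integral_sum_le => [i|i o|i]; last exact: row_error.
    by apply: measurable_normc2; exact: row_err_measurable.
  exact: sqr_ge0.
have Rr' : (\int[P]_o (\sum_j r' j o)%:E <= (n%:R * (p%:R * (x^-1 ^+ 2 * Q)))%:E)%E.
  apply: integral_sum_le => [i|i o|i].
  - by apply: measurable_normc2; exact: row_err_measurable.
  - exact: sqr_ge0.
  apply: row_error => //; first exact: adj_decoupled.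
  by move=> j k; apply: centered_conj.
have mr : measurable_fun setT (fun o => \sum_i r i o).
  by apply: measurable_sum => i; apply: measurable_normc2; exact: row_err_measurable.
have mr' : measurable_fun setT (fun o => \sum_j r' j o).
  by apply: measurable_sum => i; apply: measurable_normc2; exact: row_err_measurable.
have r0 o : 0 <= \sum_i r i o by apply: sumr_ge0 => i _; exact: sqr_ge0.
have r'0 o : 0 <= \sum_i r' i o by apply: sumr_ge0 => i _; exact: sqr_ge0.
have bF : bmeas (fun o => F o - m0) by apply: bmeasB; [exact: trace_stat_bmeas|exact: bmeas_cst].
rewrite -[m0](bmean_cst P) -bmeanB; [|exact: trace_stat_bmeas|exact: bmeas_cst].
rewrite -lee_fin -abse_EFin -(bmean_EFin P bF).
apply: le_trans (le_abse_integral _ _ _) _ => //; first by apply/measurable_EFinP; case: bF.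
have c2 : 0 <= c1 * (p%:R + n%:R) * (eta + vb / x).
  apply: mulr_ge0; first by apply: mulr_ge0 => //; rewrite addr_ge0 ?ler0n.
  by rewrite addr_ge0 ?divr_ge0 // ltW.
have c3 : 0 <= c1 / eta by rewrite divr_ge0 // ltW.
apply: le_trans (_ : (\int[P]_o ((c1 * (p%:R + n%:R) * (eta + vb / x))%:E +
    ((c1 / eta)%:E * ((\sum_i r i o)%:E + (\sum_j r' j o)%:E))) <= _)%E).
  apply: ge0_le_integral => //.
  - by apply: measurableT_comp => //; apply/measurable_EFinP; case: bF.
  - apply: emeasurable_funD => //; apply: emeasurable_funM => //.
    by apply: emeasurable_funD; exact/measurable_EFinP.
  by move=> o _; have := bound o; rewrite -lee_fin EFinD EFinM [X in (_ * X)%E]EFinD.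
have mrr : measurable_fun setT (fun o => (\sum_i r i o)%:E + (\sum_j r' j o)%:E)%E.
  by apply: emeasurable_funD; exact/measurable_EFinP.
have rr0 o : (0 <= (\sum_i r i o)%:E + (\sum_j r' j o)%:E)%E.
  by rewrite adde_ge0 // lee_fin.
rewrite ge0_integralD //; last 2 first.
- by move=> o _; rewrite mule_ge0 // lee_fin.
- by apply: emeasurable_funM.
rewrite integral_cst // [X in (_ * X + _)%E](@probability_setT _ _ _ P) mule1.
rewrite ge0_integralZl_EFin // ge0_integralD //; last 4 first.
- by move=> o _; rewrite lee_fin.
- exact/measurable_EFinP.
- by move=> o _; rewrite lee_fin.
- exact/measurable_EFinP.
apply: le_trans (leeD (lexx _) (lee_wpmul2l _ (leeD Rr Rr'))) _; first by rewrite lee_fin.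
rewrite -(EFinD (p%:R * _)) -EFinM -EFinD lee_fin -/c1 le_eqVlt; apply/orP; left; apply/eqP.
by ring.
Qed.

End ResolventTrace.

(** * Almost sure convergence from summable fourth moments *)

Section AlmostSure.
Context d (Om : measurableType d) (R : realType) (P : probability Om R).

Let telescoped (m : nat) :
  \sum_(k < m) (k.+1%:R^-1 - k.+2%:R^-1) = 1 - m.+1%:R^-1 :> R.
Proof.
elim: m => [|m IH]; first by rewrite big_ord0 invr1 subrr.
by rewrite big_ord_recr /= IH addrA subrK.
Qed.

(** The bounds telescope to at most B, so the series of fourth powers is integrable. It is then
    finite almost everywhere, and its terms tend to 0. *)
Lemma ae_null (g : nat -> Om -> R) (B : R) : 0 <= B ->
  (forall k, bmeas (g k)) ->
  (forall k, \int[P]_o (g k o ^+ 4) <= B * (k.+1%:R^-1 - k.+2%:R^-1)) ->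
  {ae P, forall o, g k o @[k --> \oo] --> (0 : R)}.
Proof.
move=> B0 bg hg; pose h k o := (g k o ^+ 4)%:E.
have h0 k o : (0 <= h k o)%E by rewrite lee_fin exprn_even_ge0.
have mh k : measurable_fun setT (h k).
  by apply/measurable_EFinP; case: (bmeasX 4 (bg k)).
pose S o := (\sum_(k <oo) h k o)%E.
have S0 o : (0 <= S o)%E by apply: nneseries_ge0.
have mS : measurable_fun setT S by apply: ge0_emeasurable_sum.
have intS : (\int[P]_o S o <= B%:E)%E.
  rewrite integral_nneseries //; apply: lime_le.
    by apply: is_cvg_nneseries => k _ _; exact: integral_ge0.
  near=> m; rewrite big_mkord.
  apply: le_trans (_ : (\sum_(k < m) (B * (k.+1%:R^-1 - k.+2%:R^-1))%:E <= _)%E).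
    by apply: lee_sum => k _; rewrite (bmean_EFin P (bmeasX 4 (bg k))) lee_fin.
  rewrite sumEFin -mulr_sumr telescoped lee_fin; apply: ler_piMr => //.
have iS : P.-integrable setT S.
  apply/integrableP; split=> //; apply: le_lt_trans (ltry B).
  by under eq_integral do rewrite gee0_abs //.
have := integrable_ae measurableT iS; apply: filterS => o /(_ I) So.
pose u k : R := g k o ^+ 4.
have u0 k : 0 <= u k by exact: exprn_even_ge0.
have cu : cvgn (series u).
  apply: nondecreasing_is_cvgn.
    by apply: nondecreasing_series => k _ _; exact: u0.
  exists (fine (S o)) => _ [m _ <-]; rewrite -lee_fin fineK // /series /= -sumEFin.
  by apply: nneseries_lim_ge => k _ _; exact: h0.
have := cvg_series_cvg_0 cu => /cvgr0Pnorm_lt uc.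
apply/cvgr0Pnorm_lt => e e0; have := uc (e ^+ 4) (exprn_gt0 4 e0).
apply: filterS => k; rewrite /u ger0_norm ?exprn_even_ge0 // => ue.
rewrite -(ltr_pXn2r (n := 4)) ?nnegrE ?normr_ge0 ?ltW //.
by rewrite -normrX ger0_norm // exprn_even_ge0.
Unshelve. all: by end_near.
Qed.

End AlmostSure.

(** * The system in terms of the variance profile *)

Section Profile.
Context (R : realType).
Local Notation C := R[i].

Definition profile (p n : nat) (sigma : 'M[R]_(p, n)) (i : 'I_p) (j : 'I_n) : R :=
  sigma i j ^+ 2 / n%:R.

Lemma solves_systemE (p n : nat) (sigma : 'M[R]_(p, n)) t u :
  solves_system sigma t u <-> system_eq (profile sigma) t u.
Proof.
have tr1 (f g : 'I_n -> C) : \tr (diag_mx (\row_j f j) *m diag_mx (\row_j g j)) =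
    \sum_j f j * g j.
  by rewrite mulmx_diag mxtrace_diag; apply: eq_bigr => j _; rewrite !mxE.
have tr2 (f g : 'I_p -> C) : \tr (diag_mx (\row_j f j) *m diag_mx (\row_j g j)) =
    \sum_j f j * g j.
  by rewrite mulmx_diag mxtrace_diag; apply: eq_bigr => j _; rewrite !mxE.
have pE i j : (profile sigma i j)%:C%C = n%:R^-1 * (sigma i j ^+ 2)%:C%C.
  by rewrite /profile mulrC rmorphM /= fmorphV rmorph_nat.
have e1 i z : n%:R^-1 * \tr (Sigma_row sigma i *m diag_fun u z) =
    \sum_j (profile sigma i j)%:C%C * u j z.
  by rewrite tr1 mulr_sumr; apply: eq_bigr => j _; rewrite pE mulrA.
have e2 j z : n%:R^-1 * \tr (Sigma_col sigma j *m diag_fun t z) =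
    \sum_i (profile sigma i j)%:C%C * t i z.
  by rewrite tr2 mulr_sumr; apply: eq_bigr => i _; rewrite pE mulrA.
split=> h z zc; have [h1 h2] := h z zc; split=> k;
  by [rewrite h1 e1|rewrite h2 e2|rewrite e1 -h1|rewrite e2 -h2].
Qed.

Lemma norm_traceE k (t : 'I_k -> C -> C) : norm_trace t = mean t.
Proof.
apply/funext => z; rewrite /norm_trace /mean mxtrace_diag; congr (_ * _).
by apply: eq_bigr => i _; rewrite mxE.
Qed.

(* At z = -x all denominators are positive, so that each equation of the
   system can be multiplied out. *)
Lemma system_trace (p n : nat) (V : 'I_p -> 'I_n -> R) (x : R) (t : 'I_p -> C) (u : 'I_n -> C) :
  let z := - x%:C%C : C in
  (forall i j, 0 <= V i j) -> 0 < x -> (forall i, 0 <= t i) -> (forall j, 0 <= u j) ->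
  (forall i, t i = smap V u z i) -> (forall j, u j = smap (fun j i => V i j) t z j) ->
  \sum_i t i = \sum_j u j - z^-1 * (p%:R - n%:R).
Proof.
move=> z V0 x0 t0 u0 tE uE.
have z0 : z != 0 by rewrite oppr_eq0 gt_eqF // ltcR.
have row (m k : nat) (V' : 'I_m -> 'I_k -> R) (f : 'I_m -> C) (g : 'I_k -> C) i :
    (forall i j, 0 <= V' i j) -> (forall j, 0 <= g j) -> f i = smap V' g z i ->
    f i + \sum_j (V' i j)%:C%C * g j * f i = - z^-1.
  move=> V'0 g0 ->; rewrite -mulr_suml; set s := \sum_j _.
  have s0 : 0 <= s by apply: sumr_ge0 => j _; rewrite mulr_ge0 // lecR.
  rewrite -{1}[smap _ _ _ _]mul1r -mulrDl /smap -/s mulN1r mulrN invfM mulrCA mulfV ?mulr1 //.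
  by rewrite gt_eqF // ltr_pwDl.
have h1 : \sum_i (t i + \sum_j (V i j)%:C%C * u j * t i) = - z^-1 * p%:R.
  by rewrite (eq_bigr _ (fun i _ => row _ _ V t u i V0 u0 (tE i))) sumr_const card_ord mulr_natr.
have h2 : \sum_j (u j + \sum_i (V i j)%:C%C * t i * u j) = - z^-1 * n%:R.
  rewrite (eq_bigr _ (fun j _ => row _ _ (fun j i => V i j) u t j (fun j i => V0 i j) t0 (uE j))).
  by rewrite sumr_const card_ord mulr_natr.
move: h1 h2; rewrite !big_split /= [X in _ -> _ + X = _ -> _]exchange_big /=.
under [X in _ -> _ + X = _ -> _]eq_bigr do under eq_bigr do rewrite mulrAC.
(* The double sum of V i j u_j t_i occurs in the summed row equations and in the summed column
   equations, so it cancels in the difference. *)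
set T := \sum_i \sum_j _; rewrite mulrBr => h1 h2.
have -> : \sum_i t i = (\sum_i t i + T) - T by rewrite addrK.
have -> : \sum_i u i = (\sum_i u i + T) - T by rewrite addrK.
by rewrite h1 h2; ring.
Qed.

End Profile.

(** * Asymptotics along the sequence of models *)

Section Sequence.
Context (R : realType) (d : measure_display) (Om : measurableType d)
  (P : probability Om R) (p : nat -> nat) (c : R).
Local Notation C := R[i].
Local Notation nc := (@Normc.normc R).
Hypotheses (hc : 0 < c) (hp : forall n : nat, (0 < n)%N -> (0 < p n)%N)
  (hpn : (fun n : nat => (p n)%:R / n%:R : R) @ \oo --> c).
Variables (w : forall n : nat, 'I_(p n) -> 'I_n -> Om -> C)
  (b : forall n : nat, 'I_(p n) -> 'I_n -> Om -> bool)
  (sigma : forall n : nat, 'M[R]_(p n, n)) (s q : nat -> R).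
Arguments w : clear implicits.
Arguments b : clear implicits.
Hypotheses (hw_meas : forall n i j, measurable_fun setT (@complex_pair R \o w n i j))
  (hw_indep : forall n, independent_family P
     (fun ij : 'I_(p n) * 'I_n => @complex_pair R \o w n ij.1 ij.2))
  (hw_mean : forall n i j, cintegral P setT (w n i j) = 0)
  (hw_var : forall n i j,
     'E_P[fun o => (nc (w n i j o) ^+ 2)%R]%E = (sigma n i j ^+ 2)%:E).
Variables (eps K : R).
Hypotheses (heps : 0 < eps)
  (hw_moment : forall n i j,
     ('E_P[fun o => (nc (w n i j o) `^ (4 + eps))%R] <= K%:E)%E).
Variable sigma_max : R.
Hypotheses (hsigma : forall n i j, `|sigma n i j| <= sigma_max)
  (hb_meas : forall n i j, measurable_fun setT (b n i j))
  (hb_bernoulli : forall n i j, P [set o | b n i j o = true] = (s n)%:E)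
  (hb_indep : forall n, independent_family P
     (fun ij : 'I_(p n) * 'I_n => b n ij.1 ij.2))
  (hbw_indep : forall n, independent_families P
     (fun ij : 'I_(p n) * 'I_n => b n ij.1 ij.2)
     (fun ij : 'I_(p n) * 'I_n => @complex_pair R \o w n ij.1 ij.2))
  (hs : forall n, (0 < n)%N -> s n = q n ^+ 2 / n%:R).
Variable phi : R.
Hypotheses (hphi : 0 < phi)
  (hq : forall n, (0 < n)%N -> n%:R `^ phi <= q n <= n%:R `^ (2^-1)).

Let S2 : R := sigma_max ^+ 2.
Let S20 : 0 <= S2. Proof. exact: sqr_ge0. Qed.

Let a (n : nat) : R := (Num.sqrt (n%:R * s n))^-1.
Let y (n : nat) : 'I_(p n) * 'I_n -> Om -> C :=
  entry (fun e => b n e.1 e.2) (fun e => w n e.1 e.2) (a n).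
Let V (n : nat) := profile (sigma n).
Arguments y : clear implicits.
Arguments V : clear implicits.
Let vb (n : nat) : R := S2 / n%:R.
Let kappa (n : nat) : R := (n%:R * q n ^+ 2)^-1 * (1 + K).

Let mxof_y n o : mxof (fun e => y n e o) =
  sparse_matrix (s n) (fun i j => b n i j o) (fun i j => w n i j o).
Proof. by apply/matrixP => i j; rewrite !mxE. Qed.

Let y_decoupled n : decoupled P (y n).
Proof.
exact: (entry_decoupled (fun e => hb_meas e.1 e.2) (fun e => hw_meas e.1 e.2)
  (@hb_indep n) (@hw_indep n) (@hbw_indep n)).
Qed.

Let y_measurable n e : cmeasurable (y n e).
Proof.
exact: (entry_measurable (fun e => hb_meas e.1 e.2) (fun e => hw_meas e.1 e.2)).
Qed.

Let q0 n : (0 < n)%N -> 0 < q n.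
Proof.
move=> n0; have /andP[h _] := hq n0; apply: lt_le_trans h.
by rewrite powR_gt0 // ltr0n.
Qed.

Let fourth_moment n i j : (\int[P]_o (nc (w n i j o) ^+ 4)%:E <= (1 + K)%:E)%E.
Proof.
have mw : measurable_fun setT (fun o => nc (w n i j o)).
  by apply: measurable_normc; exact: (w_measurable (fun e => @hw_meas n e.1 e.2) (i, j)).
have mp : measurable_fun setT (fun o => nc (w n i j o) `^ (4 + eps)).
  exact: (measurableT_comp (measurable_powR (4 + eps)) mw).
(* The bound r^4 <= 1 + r^(4 + eps) is the origin of the constant 1 + K; the 1 covers r <= 1. *)
apply: le_trans (_ : (\int[P]_o (1 + nc (w n i j o) `^ (4 + eps))%:E <= _)%E).
  apply: ge0_le_integral => //.
  - by move=> o _; rewrite lee_fin exprn_ge0 // normc_ge0.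
  - by apply/measurable_EFinP; exact: measurable_funX.
  - by apply/measurable_EFinP; apply: measurable_funD => //; exact: measurable_cst.
  move=> o _; rewrite lee_fin; set r := nc _.
  have r0 : 0 <= r by exact: normc_ge0.
  case: (leP r 1) => r1.
    by apply: le_trans (exprn_ile1 4 r0 r1) _; rewrite lerDl powR_ge0.
  apply: le_trans (_ : r `^ (4 + eps) <= _); last by rewrite lerDr.
  by rewrite -powR_mulrn // ler_powR // ?lerDl ltW.
under eq_integral do rewrite EFinD.
rewrite ge0_integralD //; last 2 first.
- by move=> o _; rewrite lee_fin powR_ge0.
- exact/measurable_EFinP.
rewrite integral_cst // [X in (_ * X + _)%E](@probability_setT _ _ _ P) mule1 EFinD leeD2l //.
by have := hw_moment i j; rewrite unlock.
Qed.

Let ns n : (0 < n)%N -> n%:R * s n = q n ^+ 2.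
Proof. by move=> n0; rewrite hs // mulrCA divff ?mulr1 // pnatr_eq0 -lt0n. Qed.

Let a2 n : (0 < n)%N -> a n ^+ 2 = (q n ^+ 2)^-1.
Proof. by move=> n0; rewrite /a exprVn ns // sqrtr_sqr real_normK ?num_real. Qed.

Let y_centered n i j : (0 < n)%N -> centered P (y n (i, j)) (V n i j) (kappa n).
Proof.
move=> n0.
have w2 : (\int[P]_o (nc (w n i j o) ^+ 2)%:E = (sigma n i j ^+ 2)%:E)%E.
  by have := hw_var i j; rewrite unlock.
have := @entry_centered _ _ _ P _ (fun e => b n e.1 e.2) (fun e => w n e.1 e.2)
  (fun e => @hb_meas n e.1 e.2) (fun e => @hw_meas n e.1 e.2)
  (@hbw_indep n) (a n) (i, j) (s n) (hb_bernoulli i j) _ _ (hw_mean i j) w2 (fourth_moment i j).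
have qn : q n != 0 by rewrite gt_eqF // q0.
have nn : n%:R != 0 :> R by rewrite pnatr_eq0 -lt0n.
rewrite (_ : 4%N = (2 * 2)%N) // exprM a2 // hs //.
congr (centered P _ _ _); rewrite /V /profile /kappa; field; by rewrite ?nn ?qn.
Qed.

Let V0 n i j : 0 <= V n i j.
Proof. by rewrite /V /profile divr_ge0 // ?sqr_ge0 // ler0n. Qed.

Let Vvb n i j : V n i j <= vb n.
Proof.
rewrite /V /profile /vb ler_wpM2r ?invr_ge0 ?ler0n // -[sigma n i j ^+ 2]real_normK ?num_real //.
by rewrite lerXn2r ?nnegrE // (le_trans _ (hsigma i j)).
Qed.

Let vb0 n : 0 <= vb n. Proof. by rewrite divr_ge0 // ler0n. Qed.

(** Column sums of the profile are at most S2 p/n and row sums at most S2. One constant covers both,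
    and it is eventually at most S2 (c + 2), whence the threshold on x below. *)
Let W n : R := S2 * ((p n)%:R / n%:R + 1).

Let VW n : (0 < n)%N -> forall j, \sum_i V n i j <= W n.
Proof.
move=> n0 j; apply: le_trans (ler_sum _ (fun i _ => Vvb i j)) _.
rewrite sumr_const card_ord -[leLHS]mulr_natr /vb /W mulrAC -mulrA ler_wpM2l // lerDl.
exact: ler01.
Qed.

Let VW' n : (0 < n)%N -> forall i, \sum_j V n i j <= W n.
Proof.
move=> n0 i; apply: le_trans (ler_sum _ (fun j _ => Vvb i j)) _.
rewrite sumr_const card_ord -[leLHS]mulr_natr /vb /W divfK ?pnatr_eq0 -?lt0n //.
by rewrite ler_peMr // lerDr divr_ge0 // ler0n.
Qed.

Lemma stieltjes_solution_exists n : exists tu : ('I_(p n) -> C -> C) * ('I_n -> C -> C),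
  (0 < n)%N -> [/\ stieltjes_solution (sigma n) tu.1 tu.2,
    (forall t' u', stieltjes_solution (sigma n) t' u' -> forall z, cut_plane z ->
       (forall i, t' i z = tu.1 i z) /\ (forall j, u' j z = tu.2 j z)),
    in_stieltjes (norm_trace tu.1) & in_stieltjes (norm_trace tu.2)].
Proof.
case: (posnP n) => [n0|n0].
  by exists (fun _ _ => 0, fun _ _ => 0); rewrite n0.
have [t [u [[ht hu] tu mt mu]]] := system_exists (@V0 n) (VW n0) (VW' n0) (hp n0) n0.
exists (t, u) => _; rewrite !norm_traceE; split=> //=.
  by split=> //; apply/solves_systemE.
move=> t' u' [ht' hu' /solves_systemE tu'] z.
exact: (system_unique (@V0 n) (VW n0) (VW' n0) ht hu ht' hu' tu tu').
Qed.

Lemma q_cvg : (q n)^-1 @[n --> \oo] --> (0 : R).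
Proof.
apply/cvgr0Pnorm_lt => e e0.
near=> n; have n0 : (0 < n)%N by near: n; exists 1%N.
rewrite ger0_norm ?invr_ge0 ?ltW ?q0 // invf_plt ?posrE ?q0 //.
have /andP[h _] := hq n0; apply: lt_le_trans h.
have -> : e^-1 = (e^-1 `^ phi^-1) `^ phi.
  by rewrite -powRrM mulVf ?gt_eqF // powRr1 // invr_ge0 ltW.
apply: gt0_ltr_powR => //; rewrite ?nnegrE ?powR_ge0 ?ler0n //.
by near: n; exact: nbhs_infty_gtr.
Unshelve. all: by end_near.
Qed.

Let ratio_near : \forall n \near \oo, [/\ (0 < n)%N,
  (p n)%:R / n%:R <= c + 1 & c / 2 <= (p n)%:R / n%:R].
Proof.
near=> n; split; first by near: n; exists 1%N.
- by near: n; apply: (cvgr_le c hpn); rewrite ltrDl.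
- by near: n; apply: (cvgr_ge c hpn); rewrite ltr_pdivrMr // ltr_pMr // ltr1n.
Unshelve. all: by end_near.
Qed.

Let invn_cvg : n%:R^-1 @[n --> \oo] --> (0 : R).
Proof.
apply/cvgr0Pnorm_lt => e e0; near=> n.
have n0 : (0 < n)%N by near: n; exists 1%N.
rewrite ger0_norm ?invr_ge0 ?ler0n // invf_plt ?posrE ?ltr0n //.
by near: n; exact: nbhs_infty_gtr.
Unshelve. all: by end_near.
Qed.

Variables (t : forall n, 'I_(p n) -> C -> C) (u : forall n, 'I_n -> C -> C).
Arguments t : clear implicits.
Arguments u : clear implicits.
Hypothesis tu : forall n, (0 < n)%N -> stieltjes_solution (sigma n) (t n) (u n).

Section RealPoint.
Variable x : R.
Hypotheses (x0 : 0 < x) (hx : S2 * (c + 2) + S2 * (c + 2) <= x).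
Local Notation z := (- x%:C%C : C).

Let F n o := trace_stat x (fun e => y n e o).
Let m0 n : R := complex.Re ((p n)%:R^-1 * \sum_i t n i z).

Let bias_cvg : \int[P]_o F n o - m0 n @[n --> \oo] --> (0 : R).
Proof.
have y0 : 0 <= x^-1 by rewrite invr_ge0 ltW.
(* When vb/x <= eta, the variance term is at most eta^2 and n/p <= 2/c, the bound of [trace_bias] is
   at most A eta. *)
pose A := 2 * x^-1 * ((1 + 2 / c) * 2 + 2 * x^-1 ^+ 2).
have A0 : 0 <= A.
  rewrite /A mulr_ge0 ?mulr_ge0 // addr_ge0 // mulr_ge0 ?exprn_ge0 //.
  by rewrite addr_ge0 // divr_ge0 // ltW.
apply/cvgr0Pnorm_lt => e e0; pose eta := e / (A + 1).
have A1 : 0 < A + 1 by rewrite ltr_wpDl.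
have eta0 : 0 < eta by rewrite divr_gt0.
have Aeta : A * eta < e.
  by rewrite /eta mulrCA gtr_pMr // ltr_pdivrMr // mul1r ltrDl.
have dcvg : S2 * x^-1 * n%:R^-1 @[n --> \oo] --> (0 : R).
  by rewrite -(mulr0 (S2 * x^-1)); apply: cvgMr invn_cvg.
have Qcvg : 18 * S2 ^+ 2 * n%:R^-1 + 3 * (1 + K) * ((q n)^-1 * (q n)^-1)
    @[n --> \oo] --> (0 : R).
  rewrite (_ : 0 = 18 * S2 ^+ 2 * 0 + 3 * (1 + K) * (0 * 0)); last by rewrite !mulr0 addr0.
  apply: cvgD; first exact: cvgMr invn_cvg.
  by apply: cvgMr; apply: cvgM; exact: q_cvg.
near=> n.
have [n0 pn pn'] : [/\ (0 < n)%N, (p n)%:R / n%:R <= c + 1 & c / 2 <= (p n)%:R / n%:R].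
  by near: n; exact: ratio_near.
have d1 : S2 * x^-1 * n%:R^-1 <= eta by near: n; exact: (cvgr_le 0 dcvg).
(* [trace_bias] divides this variance term by eta, hence the square. *)
have d2 : 18 * S2 ^+ 2 * n%:R^-1 + 3 * (1 + K) * ((q n)^-1 * (q n)^-1) <= eta ^+ 2.
  by near: n; apply: (cvgr_le 0 Qcvg); exact: exprn_gt0.
have Wx : W n + W n <= x.
  by apply: le_trans hx; apply: lerD; rewrite /W ler_wpM2l //; lra.
have [ht hu /solves_systemE sys] := tu n0.
have [tE uE] := sys z (neg_cut_plane x0).
have t0 i : 0 <= t n i z by exact: in_stieltjes_neg.
have u0 j : 0 <= u n j z by exact: in_stieltjes_neg.
have := trace_bias (hp n0) x0 (@y_decoupled n) (@y_measurable n)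
  (fun i j => y_centered i j n0) (@V0 n) (VW n0) (VW' n0) (vb0 n) (@Vvb n) n0 Wx
  t0 u0 tE uE eta0.
rewrite -/(m0 n) -/(F n) => /le_lt_trans; apply; apply: le_lt_trans Aeta.
have pnz : (p n)%:R != 0 :> R by rewrite pnatr_eq0 -lt0n hp.
have nnz : n%:R != 0 :> R by rewrite pnatr_eq0 -lt0n.
have xnz : x != 0 by rewrite gt_eqF.
have ez : eta != 0 by rewrite gt_eqF.
have qz : q n != 0 by rewrite gt_eqF // q0.
set L := (X in X <= _) in d2.
have -> : 2 * ((p n)%:R * x)^-1 * (((p n)%:R + n%:R) * (eta + vb n / x) +
     2 * (p n)%:R * n%:R * (x^-1 ^+ 2 * (18 * vb n ^+ 2 + 3 * kappa n)) / eta) =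
   2 * x^-1 * ((1 + ((p n)%:R / n%:R)^-1) * (eta + S2 * x^-1 * n%:R^-1) +
     2 * x^-1 ^+ 2 * (L / eta)).
  rewrite /L /vb /kappa; field.
  by rewrite pnz nnz xnz ez qz.
rewrite /A -[leRHS]mulrA ler_wpM2l // ?mulr_ge0 // [leRHS]mulrDl; apply: lerD; last first.
  rewrite ler_wpM2l ?mulr_ge0 ?exprn_ge0 // ler_pdivrMr //.
have p0' : 0 < (p n)%:R / n%:R :> R by rewrite divr_gt0 ?ltr0n ?hp.
rewrite -[leRHS]mulrA; apply: ler_pM.
- by rewrite addr_ge0 // invr_ge0 ltW.
- apply: addr_ge0; first exact: ltW.
  by apply: mulr_ge0; [exact: mulr_ge0|rewrite invr_ge0 ler0n].
- by rewrite lerD2l -[2 / c]invf_div lef_pV2 ?posrE ?(divr_gt0 hc).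
- by lra.
Unshelve. all: by end_near.
Qed.

Let deviation_cvg : {ae P, forall o, F n o - \int[P]_o F n o @[n --> \oo] --> (0 : R)}.
Proof.
have [N _ hN] := ratio_near.
pose N1 := N.+1.
pose g k o := F (k + N1) o - \int[P]_o F (k + N1) o.
have kN k : [/\ (0 < k + N1)%N, (p (k + N1))%:R / (k + N1)%:R <= c + 1 :> R
    & c / 2 <= (p (k + N1))%:R / (k + N1)%:R].
  by apply: hN => /=; rewrite addnS leqW // leq_addl.
have y0 : 0 <= x^-1 by rewrite invr_ge0 ltW.
have bF k : bmeas (F (k + N1)).
  by have [n0 _ _] := kN k; exact: (trace_stat_bmeas (hp n0) x0 (@y_measurable _)).
have bg k : bmeas (g k) by apply: bmeasB => //; exact: bmeas_cst.
(* In 32 = 4 * 4 * 2 the factors come from [concentration], from p >= (c/2) (k+1) squared, and from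
   1/(2 l^2) <= 1/(l (l + 1)) with l = k + 1. *)
have B0 : 0 <= 32 * (c^-1 ^+ 2 * x^-1 ^+ 4).
  by rewrite mulr_ge0 // mulr_ge0 ?exprn_ge0 // invr_ge0 ltW.
have gM k : \int[P]_o (g k o ^+ 4) <= 32 * (c^-1 ^+ 2 * x^-1 ^+ 4) *
    (k.+1%:R^-1 - k.+2%:R^-1).
  have [n0 _ pn] := kN k.
  apply: le_trans (trace_concentration (hp n0) x0 (@y_decoupled _) (@y_measurable _)) _.
  have k0 : 0 < k.+1%:R :> R by rewrite ltr0n.
  have kn : k.+1%:R <= (k + N1)%:R :> R by rewrite ler_nat addnS ltnS leq_addr.
  have nn0 : 0 < (k + N1)%:R :> R by rewrite ltr0n.
  have pk : c / 2 * k.+1%:R <= (p (k + N1))%:R.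
    rewrite ler_pdivlMr // in pn; apply: le_trans pn; rewrite ler_wpM2l //.
    by rewrite divr_ge0 // ltW.
  have c20 : 0 < c / 2 * k.+1%:R by rewrite mulr_gt0 // divr_gt0.
  have pp0 : 0 < (p (k + N1))%:R :> R by exact: lt_le_trans pk.
  set r := (p (k + N1))%:R in pk pp0 *; set l := k.+1%:R in pk k0 c20 *.
  have -> : k.+2%:R = l + 1 by rewrite /l [k.+2%:R]mulrS addrC.
  have -> : 4 * r ^+ 2 * (r * x)^-1 ^+ 4 = 4 * x^-1 ^+ 4 * r^-1 ^+ 2.
    by field; rewrite !gt_eqF.
  have l1 : 1 <= l by rewrite /l ler1n.
  have rl : r^-1 ^+ 2 <= (2 / (c * l)) ^+ 2.
    rewrite lerXn2r ?nnegrE ?invr_ge0 ?(ltW pp0) //.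
      by rewrite divr_ge0 // mulr_ge0 ?ltW.
    rewrite (_ : 2 / (c * l) = (c / 2 * l)^-1) ?lef_pV2 ?posrE //.
    by field; rewrite !gt_eqF.
  apply: le_trans (ler_wpM2l _ rl) _; first by rewrite mulr_ge0 // exprn_ge0.
  have l10 : 0 < l + 1 by rewrite addr_gt0.
  have -> : 4 * x^-1 ^+ 4 * (2 / (c * l)) ^+ 2 =
      32 * (c^-1 ^+ 2 * x^-1 ^+ 4) * (2^-1 * l^-1 ^+ 2).
    by field; rewrite !gt_eqF.
  have -> : l^-1 - (l + 1)^-1 = (l * (l + 1))^-1 by field; rewrite !gt_eqF.
  rewrite ler_wpM2l // exprVn -invfM lef_pV2 ?posrE ?mulr_gt0 // ?exprn_gt0 //.
  by rewrite expr2; nra.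
by have := ae_null B0 bg gM; apply: filterS => o h; rewrite -(cvg_shiftn N1).
Qed.

Lemma trace_cvg : {ae P, forall o, F n o - m0 n @[n --> \oo] --> (0 : R)}.
Proof.
move: deviation_cvg; apply: filterS => o h.
rewrite (_ : (fun n => _) = fun n => (F n o - \int[P]_o F n o) + (\int[P]_o F n o - m0 n)).
  by rewrite -[0]addr0; exact: cvgD h bias_cvg.
by apply/funext => n; rewrite addrA subrK.
Qed.

End RealPoint.

Hypotheses (tm : forall n, (0 < n)%N -> in_stieltjes (norm_trace (t n)))
  (um : forall n, (0 < n)%N -> in_stieltjes (norm_trace (u n))).

Let Y n o : 'M[C]_(p n, n) :=
  sparse_matrix (s n) (fun i j => b n i j o) (fun i j => w n i j o).
Let X0 : R := S2 * (c + 2) + S2 * (c + 2).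
(** The points -[pt m i] are those required by [stieltjes_determined]. They are countably many, so
    one null set serves them all. *)
Let pt (m i : nat) : R := m%:R + i.+1%:R^-1.

Let pt0 m i : 0 < pt m i.
Proof. by rewrite /pt ltr_wpDl ?ler0n // invr_gt0 ltr0n. Qed.

Let dev x n o : R := trace_stat x (fun e => y n e o) -
  complex.Re ((p n)%:R^-1 * \sum_i t n i (- x%:C%C)).

Let devE x n o : 0 < x -> (0 < n)%N ->
  norm_trace_resolvent (Y n o *m (Y n o)^t*) (- x%:C%C) - norm_trace (t n) (- x%:C%C) =
  (dev x n o)%:C%C.
Proof.
move=> x0 n0; rewrite /dev rmorphB /= -(trace_statE (hp n0) x0) mxof_y norm_traceE.
congr (_ - _); apply: ge0_complex; have [ht _ _] := tu n0.
rewrite mulr_ge0 ?invr_ge0 ?ler0n // sumr_ge0 // => i _; exact: in_stieltjes_neg.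
Qed.

(** Passing from Y Y^* to Y^* Y adds the same deterministic term to the trace of the resolvent and,
    by [system_trace], to the solution. The companion deviation is thus exactly p/n times the first,
    and needs no estimate of its own. *)
Let co_devE x n o : 0 < x -> (0 < n)%N ->
  norm_trace_resolvent ((Y n o)^t* *m Y n o) (- x%:C%C) - norm_trace (u n) (- x%:C%C) =
  ((p n)%:R / n%:R * dev x n o)%:C%C.
Proof.
move=> x0 n0; have [ht hu /solves_systemE sys] := tu n0.
have [tE uE] := sys _ (neg_cut_plane x0).
have t0 i : 0 <= t n i (- x%:C%C) by exact: in_stieltjes_neg.
have u0 j : 0 <= u n j (- x%:C%C) by exact: in_stieltjes_neg.
have st := system_trace (@V0 n) x0 t0 u0 tE uE.
have zP : ~~ (0 <= - x%:C%C :> C) by apply: oppr_pos_nge0; rewrite ltcR.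
have := resolvent_trace (Y n o) zP.
rewrite rmorphM /= -devE // !norm_traceE /mean /norm_trace_resolvent st => ->.
have pz : (p n)%:R != 0 :> C by rewrite pnatr_eq0 -lt0n hp.
have nz : n%:R != 0 :> C by rewrite pnatr_eq0 -lt0n.
rewrite rmorphM /= fmorphV !rmorph_nat -!mulrBr opprD addrACA subrr addr0.
by rewrite [RHS]mulrA; congr (_ * _); rewrite mulrAC mulfV // mul1r.
Qed.

Let ae_points : {ae P, forall o, forall m i : nat, X0 <= m%:R ->
  dev (pt m i) n o @[n --> \oo] --> (0 : R)}.
Proof.
apply: ae_foralln => m; apply: ae_foralln => i.
case: (lerP X0 m%:R) => h; last by apply: aeW => o.
have hx : X0 <= pt m i by rewrite (le_trans h) // lerDl invr_ge0 ler0n.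
by move: (trace_cvg (pt0 m i) hx); apply: filterS => o ? _.
Qed.

Lemma resolvents_cvg : {ae P, forall o : Om, forall z : C, cut_plane z ->
  ((fun n => norm_trace_resolvent (Y n o *m (Y n o)^t*) z - norm_trace (t n) z) @ \oo
     --> (0 : C^o)) /\
  ((fun n => norm_trace_resolvent ((Y n o)^t* *m Y n o) z - norm_trace (u n) z) @ \oo
     --> (0 : C^o))}.
Proof.
move: ae_points; apply: filterS => o h z zc.
have shift (r : nat -> R) : r n @[n --> \oo] --> (0 : R) ->
    `|r n.+1| @[n --> \oo] --> (0 : R).
  move=> rc; have : `|r n| @[n --> \oo] --> (0 : R).
    by rewrite -(normr0 R); exact: cvg_norm.
  by rewrite -cvg_shiftS.
(* The identity principle needs a bound for every index, while the model is constrained only for n >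
   0. The sequences are therefore shifted by one. *)
have unshift (r : nat -> C) : cnull \oo (fun n => r n.+1) -> cnull \oo r.
  by move=> rc e /rc [N _ hN]; exists N.+1 => // -[|k] //= kN; exact: hN.
split; apply/cnullP; apply: unshift.
  apply: (@stieltjes_determined _ _ _ _ (fun n z => norm_trace_resolvent
    (Y n.+1 o *m (Y n.+1 o)^t*) z - norm_trace (t n.+1) z) (1 + 2) _ X0 _ _ zc).
    move=> n; apply: stieltjes_boundB; last exact: in_stieltjes_bound (tm _).
    exact: fin_stieltjes_bound (fin_stieltjes_trace _ (hp _)).
  move=> m i mX; apply: (cnull_real _ (shift _ (h m i mX))) => n.
  by rewrite devE // normc_real.
apply: (@stieltjes_determined _ _ _ _ (fun n z => norm_trace_resolvent
  ((Y n.+1 o)^t* *m Y n.+1 o) z - norm_trace (u n.+1) z) (1 + 2) _ X0 _ _ zc).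
  move=> n; apply: stieltjes_boundB; last exact: in_stieltjes_bound (um _).
  rewrite -{2}(trmxCK (Y n.+1 o)).
  exact: fin_stieltjes_bound (fin_stieltjes_trace _ _).
move=> m i mX.
have hM : (p n)%:R / n%:R * dev (pt m i) n o @[n --> \oo] --> (0 : R).
  by rewrite -(mulr0 c); exact: (cvgM hpn (h m i mX)).
apply: (cnull_real _ (shift _ hM)) => n.
by rewrite co_devE // normc_real.
Qed.

End Sequence.

Theorem theorem3p1 (R : realType) (d : measure_display)
  (Om : measurableType d) (P : probability Om R)
  (p : nat -> nat) (c : R) (hc : 0 < c)
  (hp : forall n : nat, (0 < n)%N -> (0 < p n)%N)
  (hpn : (fun n : nat => (p n)%:R / n%:R : R) @ \oo --> c)
  (w : forall n : nat, 'I_(p n) -> 'I_n -> Om -> R[i])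
  (b : forall n : nat, 'I_(p n) -> 'I_n -> Om -> bool)
  (sigma : forall n : nat, 'M[R]_(p n, n))
  (s q : nat -> R)
  (hw_meas : forall n i j, measurable_fun setT (@complex_pair R \o w n i j))
  (hw_indep : forall n, independent_family P
     (fun ij : 'I_(p n) * 'I_n => @complex_pair R \o w n ij.1 ij.2))
  (hw_mean : forall n i j, cintegral P setT (w n i j) = 0)
  (hw_var : forall n i j,
     'E_P[fun o => (Normc.normc (w n i j o) ^+ 2)%R]%E =
       (sigma n i j ^+ 2)%:E)
  (hw_real_or_complex : forall n i j,
     (forall o, complex.Im (w n i j o) = 0) \/
     cintegral P setT (fun o => w n i j o ^+ 2) = 0)
  (eps K : R) (heps : 0 < eps)
  (hw_moment : forall n i j,
     ('E_P[fun o => (Normc.normc (w n i j o) `^ (4 + eps))%R] <= K%:E)%E)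
  (sigma_max : R) (hsigma : forall n i j, `|sigma n i j| <= sigma_max)
  (hb_meas : forall n i j, measurable_fun setT (b n i j))
  (hb_bernoulli : forall n i j, P [set o | b n i j o = true] = (s n)%:E)
  (hb_indep : forall n, independent_family P
     (fun ij : 'I_(p n) * 'I_n => b n ij.1 ij.2))
  (hbw_indep : forall n, independent_families P
     (fun ij : 'I_(p n) * 'I_n => b n ij.1 ij.2)
     (fun ij : 'I_(p n) * 'I_n => @complex_pair R \o w n ij.1 ij.2))
  (hs : forall n, (0 < n)%N -> s n = q n ^+ 2 / n%:R)
  (phi : R) (hphi : 0 < phi)
  (hq : forall n, (0 < n)%N -> n%:R `^ phi <= q n <= n%:R `^ (2^-1)) :
  let Y (n : nat) (o : Om) : 'M[R[i]]_(p n, n) :=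
    sparse_matrix (s n) (fun i j => b n i j o) (fun i j => w n i j o) in
  let m (n : nat) (o : Om) : R[i] -> R[i] :=
    norm_trace_resolvent (Y n o *m (Y n o)^t*) in
  let mt (n : nat) (o : Om) : R[i] -> R[i] :=
    norm_trace_resolvent ((Y n o)^t* *m Y n o) in
  exists (t : forall n : nat, 'I_(p n) -> R[i] -> R[i])
         (u : forall n : nat, 'I_n -> R[i] -> R[i]),
    (forall n : nat, (0 < n)%N ->
      [/\ stieltjes_solution (sigma n) (t n) (u n),
          (forall t' u', stieltjes_solution (sigma n) t' u' ->
             forall z, cut_plane z ->
               (forall i, t' i z = t n i z) /\ (forall j, u' j z = u n j z)),
          in_stieltjes (norm_trace (t n))
        & in_stieltjes (norm_trace (u n))]) /\
    {ae P, forall o : Om, forall z : R[i], cut_plane z ->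
       ((fun n : nat => m n o z - norm_trace (t n) z) @ \oo
          --> (0 : R[i]^o)) /\
       ((fun n : nat => mt n o z - norm_trace (u n) z) @ \oo
          --> (0 : R[i]^o))}.
Proof.
move=> Y m mt; have sol := fun n => cid (stieltjes_solution_exists hp hsigma n).
have n1 n : (0 < n)%N -> _ := projT2 (sol n).
exists (fun n => (projT1 (sol n)).1), (fun n => (projT1 (sol n)).2); split=> //.
apply: (resolvents_cvg hc hp hpn hw_meas hw_indep hw_mean hw_var heps hw_moment
  hsigma hb_meas hb_bernoulli hb_indep hbw_indep hs hphi hq) => n n0;
  by have [] := n1 n n0.
Qed.
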